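(* Let $1<Q<+\infty$ and $1\le p<Q$. Suppose that $(X,d,\mu)$ is a complete, unbounded metric measure space with metric $d$ and Ahlfors $Q$-regular measure $\mu$ supporting a $p$-Poincaré inequality. Then for every $u\in\dot N^{1,p}(X)$ there exist a constant $c\in\mathbb R$ and a $p$-thin set $E\subset X$ such that $$\lim_{E\not\ni x\to+\infty}u(x)=c .$$ Furthermore, there is only one $c\in\mathbb R$ for which this holds (for some $p$-thin set $E$).
   Context: A metric measure space $(X,d,\mu)$ is a separable metric space $(X,d)$ with a nontrivial locally finite Borel-regular measure $\mu$. $B(x,r)$ is the ball of center $x$ and radius $r$. $\mu$ is Ahlfors $Q$-regular if there is a constant $C_Q\ge1$ with $r^Q/C_Q\le\mu(B(x,r))\le C_Qr^Q$ for all $x\in X$, $r>0$. Upper gradient: a Borel function $\rho:X\to[0,+\infty]$ is an upper gradient of a locally integrable function $u$ if $|u(x)-u(y)|\le\int_\gamma\rho\,ds$ for every rectifiable curve $\gamma$ connecting $x$ and $y$ (for all $x,y\in X$). $\dot N^{1,p}(X)$ is the collection of all locally integrable functions on $X$ (defined pointwise everywhere) that have a $p$-integrable upper gradient on $X$. $p$-Poincaré inequality: every ball has finite positive measure and there are finite constants $C>0$, $\lambda\ge1$ such that $\frac1{\mu(B(x,r))}\int_{B(x,r)}|u-u_{B(x,r)}|\,d\mu\le Cr\left(\frac1{\mu(B(x,\lambda r))}\int_{B(x,\lambda r)}\rho^p\,d\mu\right)^{1/p}$ for all balls $B(x,r)$ and all pairs $(u,\rho)$ with $u$ integrable on balls and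 $\rho$ an upper gradient of $u$, where $u_A=\frac1{\mu(A)}\int_Au\,d\mu$. A base point $O\in X$ is fixed, $|x|:=d(O,x)$, and $x\to+\infty$ means $|x|\to+\infty$; $\lim_{E\not\ni x\to+\infty}$ is the limit as $|x|\to+\infty$ with $x\in X\setminus E$. Hausdorff content: for $\beta\ge0$, $\mathcal H^\beta_{+\infty}(E)=\inf\{\sum_kr_k^\beta: E\subset\bigcup_kB_k,\ B_k \text{ a ball of radius } r_k\in(0,+\infty)\}$ (countable covers). $p$-thin set (for $1\le p\le Q$): $E\subset X$ is $p$-thin if there is a finite constant $C\ge1$ such that $\lim_{k\to+\infty}\sum_{j=k}^{+\infty}\frac{\mathcal H^{Q-(p-\alpha)}_{+\infty}(E\cap A_{C2^{j+1}})}{(C2^{j+1})^\alpha}=0$ for all $0<\alpha<p$, where $A_{C2^{j+1}}:=B(O,C2^{j+2})\setminus B(O,C2^{j+1})$. *)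

(* Defs.v *)
From HB Require Import structures.
From mathcomp Require Import all_boot all_order all_algebra.
From mathcomp Require Import all_classical all_reals all_analysis.
From mathcomp Require Import measurable_realfun.

Set Implicit Arguments.
Unset Strict Implicit.
Unset Printing Implicit Defensive.

Import Order.TTheory GRing.Theory Num.Theory.
Import numFieldTopology.Exports numFieldNormedType.Exports.

Local Open Scope classical_set_scope.
Local Open Scope ring_scope.

(* Measurable types are pointed in the library.  The distinguished point plays
   no role below; in particular it is unrelated to the base point [O]. *)
#[short(type="pointedMetricType")]
HB.structure Definition PointedMetric (R : numDomainType) :=
  {M of Metric R M & isPointed M}.

#[short(type="completeMetricType")]
HB.structure Definition CompleteMetric (R : numDomainType) :=
  {M of Metric R M & Complete M}.

Section MetricMeasureSpace.
Context {R : realType} {X : pointedMetricType R}.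

Definition separable_space : Prop :=
  exists2 D : set X, countable D & dense D.

Definition unbounded_space : Prop :=
  forall M : R, exists x y : X, M < mdist x y.

Definition borel_set : set (set X) := <<s @open X >>.

(* As usual for Borel-regular measures on metric spaces, [mu] is an outer
   measure, defined on all subsets of [X]. *)
Implicit Type mu : {outer_measure set X -> \bar R}.

Definition borel_regular mu : Prop :=
  borel_set `<=` mu.-caratheodory /\
  forall A : set X, exists B : set X, [/\ borel_set B, A `<=` B & mu B = mu A].

Definition locally_finite mu : Prop :=
  forall x : X, exists2 r : R, 0 < r & (mu (ball x r) < +oo)%E.

Definition metric_measure_space mu : Prop :=
  [/\ separable_space, borel_regular mu, locally_finite mu
    & mu [set: X] <> 0%E].

Definition ahlfors_regular mu (Q : R) : Prop :=
  exists2 C : R, 1 <= C & forall (x : X) (r : R), 0 < r ->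
    ((r `^ Q / C)%:E <= mu (ball x r))%E /\
    (mu (ball x r) <= (C * r `^ Q)%:E)%E.

(* Restriction to the (complete) sigma-algebra of [mu]-measurable sets. *)
Definition measure_of mu : {measure set (caratheodory_type mu) -> \bar R} :=
  (mu : set (caratheodory_type mu) -> \bar R).

Definition integrable_on mu (A : set X) (u : X -> R) : Prop :=
  (measure_of mu).-integrable A (fun x => (u x)%:E).

Definition loc_integrable mu (u : X -> R) : Prop :=
  measurable_fun [set: caratheodory_type mu] (u : caratheodory_type mu -> R) /\
  forall x : X, exists2 r : R, 0 < r & integrable_on mu (ball x r) u.

Definition average mu (A : set X) (f : X -> \bar R) : \bar R :=
  ((fine (mu A))^-1%:E * \int[measure_of mu]_(x in A) f x)%E.

Definition mean mu (A : set X) (u : X -> R) : R :=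
  fine (average mu A (fun x => (u x)%:E)).

(* Length of the restriction of [g] to the interval from [a] to [b]; compare
   [total_variation]. *)
Definition curve_length (g : R -> X) (a b : R) : \bar R :=
  ereal_sup [set (\sum_(0 <= i < size s)
      mdist (g (nth b (a :: s) i)) (g (nth b (a :: s) i.+1)))%:E
    | s in itv_partition a b].

Definition rectifiable (g : R -> X) (a b : R) : Prop :=
  {within `[a, b], continuous g} /\ (curve_length g a b < +oo)%E.

(* [g] composed with the right inverse
   [t |-> sup {s in [a, b] | length (g restricted to [a, s]) = t}]
   of its length function. *)
Definition arclength_param (g : R -> X) (a b t : R) : X :=
  g (sup [set s | a <= s <= b /\ curve_length g a s = t%:E]).

Definition line_integral (rho : X -> \bar R) (g : R -> X) (a b : R) : \bar R :=
  (\int[lebesgue_measure]_(t in `[0%R, fine (curve_length g a b)])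
     rho (arclength_param g a b t))%E.

Definition borel_fun (rho : X -> \bar R) : Prop :=
  measurable_fun [set: g_sigma_algebraType (@open X)]
    (rho : g_sigma_algebraType (@open X) -> \bar R).

Definition upper_gradient (u : X -> R) (rho : X -> \bar R) : Prop :=
  [/\ borel_fun rho, (forall x, 0 <= rho x)%E &
    forall (g : R -> X) (a b : R), a <= b -> rectifiable g a b ->
      (`|u (g a) - u (g b)|%:E <= line_integral rho g a b)%E].

Definition dotN1 mu (p : R) (u : X -> R) : Prop :=
  loc_integrable mu u /\
  exists2 rho : X -> \bar R, upper_gradient u rho &
    (\int[measure_of mu]_x (rho x `^ p) < +oo)%E.

Definition poincare mu (p : R) : Prop :=
  (forall (x : X) (r : R), 0 < r -> (0 < mu (ball x r) < +oo)%E) /\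
  exists C lambda : R, [/\ 0 < C, 1 <= lambda &
    forall (u : X -> R) (rho : X -> \bar R),
      (forall (x : X) (r : R), 0 < r -> integrable_on mu (ball x r) u) ->
      upper_gradient u rho ->
      forall (x : X) (r : R), 0 < r ->
        (average mu (ball x r)
           (fun y => `|u y - mean mu (ball x r) u|%:E)
         <= (C * r)%:E *
            average mu (ball x (lambda * r)) (fun y => rho y `^ p)
              `^ p^-1)%E].

(* Covers by at most countably many balls, finite covers included. *)
Definition hausdorff_content (beta : R) (E : set X) : \bar R :=
  ereal_inf [set v | exists (D : set nat) (x : nat -> X) (r : nat -> R),
    [/\ forall k, D k -> 0 < r k,
        E `<=` \bigcup_(k in D) ball (x k) (r k)
      & v = \esum_(k in D) (r k `^ beta)%:E]].

Definition annulus (O : X) (s : R) : set X := ball O (2 * s) `\` ball O s.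

Definition thin (O : X) (Q p : R) (E : set X) : Prop :=
  exists2 C : R, 1 <= C & forall alpha : R, 0 < alpha < p ->
    (fun k : nat => \sum_(k <= j <oo)
        (hausdorff_content (Q - (p - alpha))
           (E `&` annulus O (C * 2 ^+ j.+1))
         * (((C * 2 ^+ j.+1) `^ alpha)^-1)%:E))%E @ \oo --> 0%E.

(* The filter of [|x| -> +oo], where [|x| = d(O, x)]. *)
Definition at_infty (O : X) : set_system X :=
  filter_from [set: R] (fun M => [set x | M < mdist O x]).

End MetricMeasureSpace.

Arguments separable_space {R} X.
Arguments unbounded_space {R} X.

(* Main.v *)
(** Replace the upper gradient by a p-integrable lower semicontinuous majorant
[rho], bounded below by positive constants on balls.  Let [v] be the minimal
[rho]-cost of reaching a point from [x] along chains of small steps, for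
Lipschitz approximations of [rho] from below.  Each such [v] is continuous with
[v x = 0] and has a Lipschitz upper gradient below [rho], so telescoping the
Poincare inequality over the balls [B(x, 2^-j r)] bounds its integral by a sum
of Riesz type
  [sum_j (2^-j r)^(1 - Q/p) (int_{B(x, lam 2^-j r)} rho^p)^(1/p)].
Cheap chains with steps tending to zero converge along an ultrafilter to a
curve, which gives [|u x - u y| <= sup v]; hence the mean of [|u - u x|] over
[B(x, r)] is at most this sum at every point [x].

Call a point of the dyadic shell [2^k <= |x| < 2^(k+1)] bad if its sum starting
at radius about [2^k] exceeds [eps_k].  A bad point has a large energy in some
ball [B(x, 2^k 2^-j)], and maximal disjoint families of such balls bound the
content of the bad set by the energy of the shell over [eps_k^p].  The shell
energies are summable, so [eps_k -> 0] can be chosen so that the union [E] of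
the bad sets is thin.  Outside [E] the radii larger than [2^k] only contribute
[O(2^(k (1 - Q/p)))], and comparing means over balls containing two far away
points shows that [u] is Cauchy at infinity.

The limit is unique because the measure of a thin set in [B(O, T)] is
[o(T^Q)], so two thin sets never cover a neighbourhood of infinity. *)

Require Import Defs.
From HB Require Import structures.
From mathcomp Require Import all_boot all_order all_algebra.
From mathcomp Require Import all_classical all_reals all_analysis.
From mathcomp Require Import measurable_realfun.
From mathcomp Require Import ring lra.

Set Implicit Arguments.
Unset Strict Implicit.
Unset Printing Implicit Defensive.

Import Order.TTheory GRing.Theory Num.Theory.
Import numFieldTopology.Exports numFieldNormedType.Exports.

Local Open Scope classical_set_scope.
Local Open Scope ring_scope.

(** * Length and arc length parametrization *)

(** The obstacle is that [u] must be controlled at every point outside [E]. Telescoping the Poincare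
    inequality for [u] itself reaches only Lebesgue points, and null sets can carry positive
    content. The functions [v] are continuous and vanish at [x], so their means over shrinking balls
    tend to 0 at any [x] whatsoever. Their continuity comes from the use of chains: a single short
    step is always allowed, whether or not a curve joins the points.

    The lower bound on [rho] limits the length of cheap chains, so that the limit curve is
    rectifiable; lower semicontinuity is what lets Lipschitz functions increase to [rho].

    Thinness asks for one set that serves all [alpha]. Badness is therefore defined by the whole
    sum; only the way a bad sum is split among its scales depends on [alpha].

    The assumption [p < Q] enters twice: it makes the ratio [2^(1 - Q/p)] of the large scales less
    than 1, and it makes the volume exponent [alpha Q / (Q - p + alpha)] of thin sets less than
    [Q]. *)

Lemma path_le_last (R : realType) (a : R) s : path <%R a s -> a <= last a s.
Proof.
elim: s a => [|y s IH] a //= /andP[ay /IH]; apply: le_trans; exact: ltW.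
Qed.

Section CurveLength.
Context {R : realType} {X : pointedMetricType R}.
Implicit Types (g : R -> X) (s : seq R).

Fixpoint variation_sum g (a : R) s : R :=
  if s is y :: s' then mdist (g a) (g y) + variation_sum g y s' else 0.

Lemma variation_sumE g a b s :
  \sum_(0 <= i < size s)
     mdist (g (nth b (a :: s) i)) (g (nth b (a :: s) i.+1)) =
  variation_sum g a s.
Proof.
elim: s a => [|y s IH] a; first by rewrite big_geq.
rewrite [size _]/= big_nat_recl//=; congr (_ + _).
by rewrite -IH.
Qed.

Lemma variation_sum_cat g a s s' :
  variation_sum g a (s ++ s') =
  variation_sum g a s + variation_sum g (last a s) s'.
Proof. by elim: s a => [|y s IH] a /=; rewrite ?add0r// IH addrA. Qed.

Lemma curve_length_ub g a b s : path <%R a s -> last a s = b ->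
  ((variation_sum g a s)%:E <= curve_length g a b)%E.
Proof.
move=> pas lab; apply: ereal_sup_ubound; exists s => /=.
  by split => //; apply/eqP.
by rewrite variation_sumE.
Qed.

Lemma curve_length_le g a b (l : \bar R) :
  (forall s, path <%R a s -> last a s = b ->
     ((variation_sum g a s)%:E <= l)%E) ->
  (curve_length g a b <= l)%E.
Proof.
move=> H; apply: ge_ereal_sup => _ [s [pas /eqP lab] <-].
by rewrite variation_sumE; exact: H.
Qed.

Lemma variation_sum_dominated g (F : R -> R) a s :
  (forall t t', a <= t -> t <= t' -> t' <= last a s ->
     mdist (g t) (g t') <= F t' - F t) ->
  path <%R a s -> variation_sum g a s <= F (last a s) - F a.
Proof.
elim: s a => [|y s IH] a H /=; first by rewrite subrr.
move=> /andP[ay pys].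
have yl := path_le_last pys.
have h1 := H a y (lexx _) (ltW ay) yl.
have h2 : variation_sum g y s <= F (last y s) - F y.
  apply: IH => // t t' yt; apply: H; exact: le_trans (ltW ay) yt.
by move: h1 h2 => /=; lra.
Qed.

(* Taking for [F] the arc length with a putative jump removed, this shows that
   the arc length function of a continuous curve has no jumps. *)
Lemma curve_length_dominated g (F : R -> R) a b :
  (forall t t', a <= t -> t <= t' -> t' <= b ->
     mdist (g t) (g t') <= F t' - F t) ->
  (curve_length g a b <= (F b - F a)%:E)%E.
Proof.
move=> H; apply: curve_length_le => s pas lab.
by rewrite lee_fin -lab; apply: variation_sum_dominated; rewrite ?lab.
Qed.

Lemma curve_length_ge_mdist g a b : a <= b ->
  ((mdist (g a) (g b))%:E <= curve_length g a b)%E.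
Proof.
rewrite le_eqVlt => /predU1P[->|ab].
  by rewrite mdistxx; apply: (@curve_length_ub g b b [::]).
have := @curve_length_ub g a b [:: b].
by rewrite /= andbT addr0; apply.
Qed.

Lemma curve_length_ge0 g a b : a <= b -> (0 <= curve_length g a b)%E.
Proof.
move=> ab; apply: le_trans (curve_length_ge_mdist g ab).
by rewrite lee_fin mdist_ge0.
Qed.

Lemma curve_length_superadd g a c b :
  (curve_length g a b < +oo)%E -> a <= c -> c <= b ->
  (curve_length g a c + curve_length g c b <= curve_length g a b)%E.
Proof.
move=> fin ac cb.
have key s s' : path <%R a s -> last a s = c -> path <%R c s' ->
    last c s' = b ->
    ((variation_sum g a s)%:E + (variation_sum g c s')%:E <=
     curve_length g a b)%E.
  move=> p1 l1 p2 l2; have := variation_sum_cat g a s s'; rewrite l1 -EFinD => <-.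
  by apply: curve_length_ub; rewrite ?cat_path ?last_cat l1 // p1.
have k1 s : path <%R a s -> last a s = c ->
   ((variation_sum g a s)%:E + curve_length g c b <= curve_length g a b)%E.
  move=> p1 l1; rewrite addeC -leeBrDr//; apply: curve_length_le => s' p2 l2.
  by rewrite leeBrDr// addeC; apply: key.
(* Prefixing the single step from [a] to [c] to the partitions of [[c, b]] bounds this length by the
   total one; finiteness then permits the subtraction below. *)
have fcb : curve_length g c b \is a fin_num.
  rewrite ge0_fin_numE ?curve_length_ge0//; apply: le_lt_trans fin.
  move: ac; rewrite le_eqVlt => /predU1P[->//|ac].
  have := k1 [:: c]; rewrite /= andbT addr0 => /(_ ac erefl); apply: le_trans.
  by rewrite leeDr// lee_fin mdist_ge0.
rewrite -leeBrDr//; apply: curve_length_le => s p1 l1.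
by rewrite leeBrDr//; apply: k1.
Qed.

End CurveLength.

Section ArclengthParam.
Context {R : realType} {X : pointedMetricType R}.
Context (g : R -> X) (a b : R) (leab : a <= b) (rg : rectifiable g a b).

Definition arclength (t : R) : R := fine (curve_length g a t).

Lemma rectifiable_fin_num t t' : a <= t -> t <= t' -> t' <= b ->
  curve_length g t t' \is a fin_num.
Proof.
move=> ta tt' t'b; have [_ fin] := rg.
have at' := le_trans ta tt'.
rewrite ge0_fin_numE ?curve_length_ge0//; apply: le_lt_trans fin.
have h1 := curve_length_superadd rg.2 at' t'b.
have fin1 : (curve_length g a t' < +oo)%E.
  apply: le_lt_trans rg.2; apply: le_trans h1.
  by rewrite leeDl// curve_length_ge0.
apply: le_trans h1; apply: (@le_trans _ _ (curve_length g a t')); last first.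
  by rewrite leeDl// curve_length_ge0.
apply: le_trans (curve_length_superadd fin1 ta tt').
by rewrite leeDr// curve_length_ge0.
Qed.

Lemma arclengthE t : a <= t -> t <= b ->
  curve_length g a t = (arclength t)%:E.
Proof. by move=> at_ tb; rewrite /arclength fineK//; apply: rectifiable_fin_num. Qed.

Lemma arclength_start : arclength a = 0.
Proof.
suff : curve_length g a a = 0%E by rewrite /arclength => ->.
apply/eqP; rewrite eq_le curve_length_ge0// andbT.
apply: curve_length_le => -[//|y s] pas la.
by move: pas la => /= /andP[ay /path_le_last + la]; rewrite la => /(lt_le_trans ay); rewrite ltxx.
Qed.

Lemma arclength_superadd t t' : a <= t -> t <= t' -> t' <= b ->
  (curve_length g t t' <= (arclength t' - arclength t)%:E)%E.
Proof.
move=> ta tt' t'b.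
have at' := le_trans ta tt'.
rewrite EFinB leeBrDr// -!arclengthE// ?(le_trans tt')// addeC.
by apply: curve_length_superadd => //; rewrite -ge0_fin_numE ?curve_length_ge0// rectifiable_fin_num.
Qed.

Lemma mdist_arclength t t' : a <= t -> t <= t' -> t' <= b ->
  mdist (g t) (g t') <= arclength t' - arclength t.
Proof.
move=> ta tt' t'b; rewrite -lee_fin.
exact: le_trans (curve_length_ge_mdist _ tt') (arclength_superadd ta tt' t'b).
Qed.

Lemma arclength_mono t t' : a <= t -> t <= t' -> t' <= b ->
  arclength t <= arclength t'.
Proof.
move=> ta tt' t'b; rewrite -subr_ge0.
exact: le_trans (mdist_ge0 _ _) (mdist_arclength ta tt' t'b).
Qed.

(** Stands in for the additivity of length, of which only the superadditive half is available.
    Gluing the arc length up to [t] with a translate of [F] afterwards gives a function [G] that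
    dominates distances on all of [[a, t']]. *)
Lemma arclength_dominated (F : R -> R) t t' :
  (forall r r', t <= r -> r <= r' -> r' <= t' ->
     mdist (g r) (g r') <= F r' - F r) ->
  a <= t -> t <= t' -> t' <= b ->
  arclength t' - arclength t <= F t' - F t.
Proof.
move=> H ta tt' t'b.
have at' := le_trans ta tt'.
pose G r := if r <= t then arclength r else arclength t + F r - F t.
have : (curve_length g a t' <= (G t' - G a)%:E)%E.
  apply: curve_length_dominated => r r' ar rr' r't'.
  rewrite /G; have [rt|tr] := leP r t; have [r't|tr'] := leP r' t.
  - by apply: mdist_arclength => //; rewrite (le_trans r't').
  - have := mdist_arclength ar rt (le_trans tt' t'b).
    have := H t r' (lexx _) (ltW tr') r't'.
    by have := metric_triangle (g r) (g t) (g r'); lra.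
  - by have := lt_le_trans tr (le_trans rr' r't); rewrite ltxx.
  - by have := H r r' (ltW tr) rr' r't'; lra.
rewrite arclengthE// lee_fin /G ta arclength_start.
by have [/(conj tt')/andP/le_anti <-|] := leP t' t; lra.
Qed.

Lemma curve_continuousP t e : a <= t <= b -> 0 < e ->
  exists2 d, 0 < d &
    forall t', a <= t' <= b -> `|t' - t| < d -> mdist (g t) (g t') < e.
Proof.
move=> tab e0; have [gc _] := rg.
move: gc => /subspace_continuousP /(_ t).
rewrite /= in_itv/= => /(_ tab) /cvg_ballP /(_ e e0).
rewrite near_withinE => /nbhs_ballP[d /= d0 H]; exists d => // t' t'ab t't.
have : ball (g t) e (g t').
  by apply: H; rewrite ?in_itv//= /ball/= distrC.
by rewrite ballEmdist.
Qed.

(** The arc length is at most [l] to the left of [t] and greater than [l] to the right. If it missed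
    [l] at [t], closing the gap [e] would leave a function [F] that still dominates distances,
    because [g] does not jump at [t]; by [arclength_dominated] it would also dominate the total
    length, which exceeds its increment. *)
Lemma arclength_surj_sup (l : R) : 0 <= l <= arclength b ->
  let t := sup [set t | a <= t <= b /\ arclength t <= l] in
  a <= t <= b /\ arclength t = l.
Proof.
move=> /andP[l0 lb]; set S := [set t | _]; move=> t.
have Sa : S a by rewrite /S/= lexx leab arclength_start.
have Sb : ubound S b by move=> s [/andP[_ sb] _].
have hs : has_sup S by split; [exists a|exists b].
have at_ : a <= t by apply: ub_le_sup => //; exists b.
have tb : t <= b by apply: ge_sup => //; exists a.
split; first by rewrite at_.
have gt s : t < s -> s <= b -> l < arclength s.
  move=> ts sb; rewrite ltNge; apply/negP => sl.
  suff : s <= t by rewrite leNgt ts.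
  apply: ub_le_sup; first by exists b.
  by split => //; rewrite sb (le_trans at_ (ltW ts)).
have lt s : a <= s -> s < t -> arclength s <= l.
  move=> as_ st; have [r [/andP[ar rb] rl] sr] := sup_gt (ex_intro _ a Sa) st.
  exact: le_trans (arclength_mono as_ (ltW sr) rb) rl.
have tab : a <= t <= b by rewrite at_.
apply/eqP; rewrite eq_le; apply/andP; split; rewrite leNgt; apply/negP => tl.
- pose e := arclength t - l; have e0 : 0 < e by rewrite subr_gt0.
  pose F s := if s < t then arclength s else arclength s - e.
  suff : arclength b - arclength a <= F b - F a.
    rewrite /F arclength_start ltNge tb/=; case: ltP => [|ta]; first by lra.
    have ta' : a = t by apply/le_anti; rewrite at_.
    by move: tl; rewrite -ta' arclength_start; lra.
  apply: arclength_dominated => // s s' as_ ss' s'b; rewrite /F.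
  have h := mdist_arclength as_ ss' s'b.
  have [st|ts] := ltP s t; have [s't|ts'] := ltP s' t; [by [] | | | by lra].
    (* For a pair straddling [t] the distance is routed through a point [r] just left of [t]: there
       the arc length is at most [l], and [g r] is within [d] of [g t]. *)
    apply/ler_addgt0Pl => d d0.
    have [d' d'0 Hd] := curve_continuousP tab d0.
    pose r := Num.max s (t - d' / 2).
    have sr : s <= r by rewrite le_max lexx.
    have rt : r < t by rewrite /r gt_max st /=; lra.
    have rd : `|r - t| < d'.
      rewrite ltr0_norm ?subr_lt0// opprB.
      have : t - d' / 2 <= r by rewrite le_max lexx orbT.
      by lra.
    have ar := le_trans as_ sr.
    have := Hd r; rewrite ar (ltW (lt_le_trans rt tb)) => /(_ isT rd).
    have := mdist_arclength as_ sr (ltW (lt_le_trans rt tb)).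
    have := lt _ ar rt.
    have := mdist_arclength at_ ts' s'b.
    have := metric_triangle (g s) (g r) (g s').
    have := metric_triangle (g r) (g t) (g s').
    by rewrite (metric_sym (g r) (g t)) /e; lra.
  by have := le_lt_trans ss' s't; rewrite ltNge ts.
- pose e := l - arclength t; have e0 : 0 < e by rewrite subr_gt0.
  pose F s := if s <= t then arclength s else arclength s - e.
  suff : arclength b - arclength a <= F b - F a.
    rewrite /F arclength_start at_; case: (leP b t) => [bt|]; last by lra.
    have tb' : b = t by apply/le_anti; rewrite tb bt.
    by move: tl lb; rewrite -tb'; lra.
  apply: arclength_dominated => // s s' as_ ss' s'b; rewrite /F.
  have h := mdist_arclength as_ ss' s'b.
  have [st|ts] := leP s t; have [s't|ts'] := leP s' t; [by [] | | | by lra].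
    apply/ler_addgt0Pl => d d0.
    have [d' d'0 Hd] := curve_continuousP tab d0.
    pose r := Num.min s' (t + d' / 2).
    have rs : r <= s' by rewrite ge_min lexx.
    have tr : t < r by rewrite /r lt_min ts' /=; lra.
    have rd : `|r - t| < d'.
      rewrite gtr0_norm ?subr_gt0//.
      have : r <= t + d' / 2 by rewrite ge_min lexx orbT.
      by lra.
    have ar := le_trans at_ (ltW tr).
    have := Hd r; rewrite ar (le_trans rs s'b) => /(_ isT rd).
    have := mdist_arclength as_ st tb.
    have := gt _ tr (le_trans rs s'b).
    have := mdist_arclength ar rs s'b.
    have := metric_triangle (g s) (g t) (g s').
    have := metric_triangle (g t) (g r) (g s').
    by rewrite /e; lra.
  by have := le_lt_trans ss' (le_lt_trans s't ts); rewrite ltxx.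
Qed.

(** The supremum of the sublevel set has arc length exactly [l], so it belongs to the level set used
    by [arclength_param] and both sets have the same supremum. *)
Lemma arclength_paramP (l : R) : 0 <= l <= arclength b ->
  exists2 t, a <= t <= b &
    arclength t = l /\ arclength_param g a b l = g t.
Proof.
move=> l0b; have [] := arclength_surj_sup l0b.
set S := [set t | _]; set t := sup S => tab tl.
exists t => //; split => //; rewrite /arclength_param; congr g.
have /andP[at_ tb] := tab.
apply/eqP; rewrite eq_le; apply/andP; split.
  apply: ge_sup; first by exists t; split => //; rewrite arclengthE// tl.
  move=> s [/andP[as_ sb] sl]; apply: ub_le_sup.
    by exists b => r [/andP[_ rb] _].
  by split; [rewrite as_|rewrite /arclength sl].
apply: ub_le_sup; first by exists b => r [/andP[_ rb] _].
by split => //; rewrite arclengthE// tl.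
Qed.

Lemma arclength_param_arclength t : a <= t <= b ->
  arclength_param g a b (arclength t) = g t.
Proof.
move=> /andP[at_ tb].
have [] := @arclength_paramP (arclength t).
  by rewrite -{1}arclength_start !arclength_mono.
move=> s /andP[as_ sb] [st ->].
apply/mdist_positivity/eqP; rewrite eq_le mdist_ge0 andbT.
have [le|/ltW le] := leP s t.
  by have := mdist_arclength as_ le tb; rewrite st subrr.
by rewrite metric_sym; have := mdist_arclength at_ le sb; rewrite st subrr.
Qed.

Lemma arclength_param_lip (l l' : R) : 0 <= l -> l <= l' -> l' <= arclength b ->
  mdist (arclength_param g a b l) (arclength_param g a b l') <= l' - l.
Proof.
move=> l0 ll' l'b.
have [|t /andP[at_ tb] [tl ->]] := @arclength_paramP l.
  by rewrite l0 (le_trans ll').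
have [|t' /andP[at'_ t'b] [t'l ->]] := @arclength_paramP l'.
  by rewrite l'b (le_trans l0).
have [tt'|t't] := leP t t'.
  by rewrite -tl -t'l; apply: mdist_arclength.
have := arclength_mono at'_ (ltW t't) tb; rewrite tl t'l => l'l.
rewrite metric_sym; apply: le_trans (mdist_arclength at'_ (ltW t't) tb) _.
by rewrite tl t'l; lra.
Qed.

End ArclengthParam.

(** * Quadratic error estimates in place of differentiation *)

Lemma quadratic_error (R : realType) (G : R -> R) (m d L : R) :
  0 <= L -> 0 < d ->
  (forall s t : R, 0 <= s -> s <= t -> t <= L -> t - s <= d ->
     G t - G s <= m * (t - s) ^+ 2) ->
  G L <= G 0.
Proof.
move=> L0 d0 H; apply/ler_addgt0Pr => e e0.
(* With [n] equal steps the errors add up to [m L^2 / n]. The first bound makes the steps shorter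
   than [d], the second makes this total at most [e]. *)
pose n := (Num.truncn (Num.max (L / d) (`|m| * L ^+ 2 / e))).+1.
have nlt : Num.max (L / d) (`|m| * L ^+ 2 / e) < n%:R.
  exact: truncnS_gt.
have n0 : 0 < n%:R :> R by [].
have n0' : n%:R != 0 :> R by rewrite gt_eqF.
move: nlt; rewrite gt_max => /andP[n1 n2].
pose D := L / n%:R.
have D0 : 0 <= D by rewrite divr_ge0.
have Dd : D <= d by rewrite ler_pdivrMr// mulrC -ler_pdivrMr// ltW.
have nD : n%:R * D = L by rewrite mulrC /D divfK.
have step k : (k <= n)%N -> G (k%:R * D) - G 0 <= k%:R * (m * D ^+ 2).
  elim: k => [|k IH] kn; first by rewrite !mul0r subrr.
  have := IH (ltnW kn).
  have := H (k%:R * D) (k.+1%:R * D).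
  rewrite mulr_ge0// ler_wpM2r// ?ler_nat// => /(_ isT isT).
  have -> : k.+1%:R * D - k%:R * D = D by rewrite -mulrBl -natrB// subSnn mul1r.
  have kD : k.+1%:R * D <= L by rewrite -[leRHS]nD ler_wpM2r// ler_nat.
  move=> /(_ kD Dd).
  have -> : k.+1%:R * (m * D ^+ 2) = k%:R * (m * D ^+ 2) + m * D ^+ 2.
    by rewrite -natr1; ring.
  by lra.
have := step n (leqnn _); rewrite nD.
have : n%:R * (m * D ^+ 2) <= e.
  have -> : n%:R * (m * D ^+ 2) = m * L ^+ 2 / n%:R by rewrite /D; field.
  rewrite ler_pdivrMr//; apply: le_trans (_ : `|m| * L ^+ 2 <= _).
    by rewrite ler_wpM2r ?sqr_ge0// ler_norm.
  by rewrite [e * _]mulrC -ler_pdivrMr// ltW.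
by lra.
Qed.

(** The primitive is given in the form that [quadratic_error] consumes: a first-order expansion with
    an explicit remainder. *)
Lemma integral_lipschitz (R : realType) (k : R -> R) (m L : R) :
  0 <= L ->
  (forall s t : R, 0 <= s -> s <= t -> t <= L -> `|k t - k s| <= m * (t - s)) ->
  exists F : R -> R, [/\ F 0 = 0,
    (\int[lebesgue_measure]_(t in `[0%R, L]) (k t)%:E)%E = (F L)%:E &
    forall s t : R, 0 <= s -> s <= t -> t <= L ->
      `|F t - F s - k s * (t - s)| <= m * (t - s) ^+ 2].
Proof.
move=> L0 H.
have kc : {within `[0, L], continuous k}.
  apply/subspace_continuousP => x; rewrite /= in_itv/= => /andP[x0 xL].
  apply/cvgrPdist_le => e e0; rewrite near_withinE.
  have M0 : 0 < `|m| + 1 by rewrite ltr_wpDl.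
  apply/nbhs_ballP; exists (e / (`|m| + 1)); first by rewrite /= divr_gt0.
  move=> y; rewrite /ball/= => xy; rewrite in_itv/= => /andP[y0 yL].
  have key : `|k x - k y| <= m * `|x - y|.
    have [le|/ltW le] := leP y x; first by rewrite [X in m * X]ger0_norm ?subr_ge0// H.
    by rewrite distrC (distrC x) [X in m * X]ger0_norm ?subr_ge0// H.
  apply: le_trans key _; apply: le_trans (_ : (`|m| + 1) * `|x - y| <= _).
    by rewrite ler_wpM2r// (le_trans (ler_norm m))// lerDl.
  by rewrite mulrC -ler_pdivlMr// ltW.
have ki : lebesgue_measure.-integrable `[0, L] (EFin \o k).
  by apply: continuous_compact_integrable => //; exact: segment_compact.
exists (fun t => (\int[lebesgue_measure]_(r in `[0%R, t]) k r)%R); split.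
- by rewrite set_itv1 Rintegral_set1.
- rewrite /Rintegral fineK//; apply: integrable_fin_num => //.
- move=> s t s0 st tL.
  have kit : lebesgue_measure.-integrable `[0, t] (EFin \o k).
    apply: integrableS ki => //.
    by apply: subset_itvl; rewrite bnd_simp.
  rewrite (@Rintegral_itvB _ k (BLeft 0) (BRight t) s)// ?bnd_simp//.
  have kist : lebesgue_measure.-integrable `]s, t] (EFin \o k).
    apply: integrableS kit => //.
    by apply: subset_itvr; rewrite bnd_simp.
  have cst (c : R) : lebesgue_measure.-integrable `]s, t] (EFin \o cst c).
    have : lebesgue_measure.-integrable `[s, t] (EFin \o cst c).
      apply: continuous_compact_integrable; first exact: segment_compact.
      by apply: continuous_subspaceT => x; exact: cvg_cst.
    by apply: integrableS => //; apply: subset_itvr; rewrite bnd_simp.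
  have icst (c : R) : (\int[lebesgue_measure]_(x in `]s, t]) c)%R = c * (t - s).
    rewrite Rintegral_cst//= lebesgue_measure_itv/= lte_fin.
    case: ltP => //= ts; have -> : s = t by apply/le_anti; rewrite st ts.
    by rewrite subrr mulr0.
  have lo : (k s - m * (t - s)) * (t - s) <=
      (\int[lebesgue_measure]_(x in `]s, t]) k x)%R.
    rewrite -icst; apply: le_Rintegral => //; first exact: cst.
    move=> x; rewrite /= in_itv/= => /andP[sx xt].
    have := H s x s0 (ltW sx) (le_trans xt tL).
    have m0 : 0 <= m.
      have := H s x s0 (ltW sx) (le_trans xt tL).
      by move/(le_trans (normr_ge0 _)); rewrite pmulr_lge0// subr_gt0.
    have : m * (x - s) <= m * (t - s) by rewrite ler_wpM2l// lerB.
    by rewrite ler_norml; lra.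
  have hi : (\int[lebesgue_measure]_(x in `]s, t]) k x)%R <=
      (k s + m * (t - s)) * (t - s).
    rewrite -icst; apply: le_Rintegral => //; first exact: cst.
    move=> x; rewrite /= in_itv/= => /andP[sx xt].
    have := H s x s0 (ltW sx) (le_trans xt tL).
    have m0 : 0 <= m.
      have := H s x s0 (ltW sx) (le_trans xt tL).
      by move/(le_trans (normr_ge0 _)); rewrite pmulr_lge0// subr_gt0.
    have : m * (x - s) <= m * (t - s) by rewrite ler_wpM2l// lerB.
    by rewrite ler_norml; lra.
  move: lo hi; set I := (Rintegral _ _ _); move: I => I lo hi.
  by rewrite ler_norml; apply/andP; split; lra.
Qed.

(** * The cost of chains as a function with a Lipschitz upper gradient *)

Section ChainDistance.
Context {R : realType} {X : pointedMetricType R}.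
Implicit Types (h : X -> R) (c : nat -> X) (x y z : X).

Definition chain (d : R) x y c n :=
  [/\ c 0%N = x, c n = y &
      forall k, (k < n)%N -> mdist (c k) (c k.+1) <= d].

(** A left Riemann sum for the line integral of [h]: each step is charged at its starting point. *)
Definition chain_cost h c n := \sum_(k < n) h (c k) * mdist (c k) (c k.+1).

(* Truncated at [N], so that it is finite when no chain joins the points. *)
Definition chain_dist h (d N : R) x y :=
  inf [set t | t = N \/ exists c n, chain d x y c n /\ t = chain_cost h c n].

Lemma chain_cost_ge0 h c n : (forall z, 0 <= h z) -> 0 <= chain_cost h c n.
Proof. by move=> h0; apply: sumr_ge0 => i _; rewrite mulr_ge0// mdist_ge0. Qed.

Section Properties.
Context h (d N : R) x (h0 : forall z, 0 <= h z) (N0 : 0 <= N).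

Lemma chain_dist_lbound y : lbound
  [set t | t = N \/ exists c n, chain d x y c n /\ t = chain_cost h c n] 0.
Proof. by move=> t [->//|[c [n [_ ->]]]]; exact: chain_cost_ge0. Qed.

Lemma chain_dist_ge0 y : 0 <= chain_dist h d N x y.
Proof.
by apply: lb_le_inf; [exists N; left|exact: chain_dist_lbound].
Qed.

Lemma chain_dist_leN y : chain_dist h d N x y <= N.
Proof. by apply: ge_inf; [exists 0; exact: chain_dist_lbound|left]. Qed.

Lemma chain_dist_le y c n :
  chain d x y c n -> chain_dist h d N x y <= chain_cost h c n.
Proof.
move=> H; apply: ge_inf; first by exists 0; exact: chain_dist_lbound.
by right; exists c, n.
Qed.

Lemma chain_dist_lt y M : chain_dist h d N x y < M -> M <= N ->
  exists c n, chain d x y c n /\ chain_cost h c n < M.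
Proof.
move=> vM MN.
have [t [->|[c [n [H ->]]]] tM] := inf_lt (ex_intro _ N (or_introl erefl)) vM.
- by have := lt_le_trans tM MN; rewrite ltxx.
- by exists c, n.
Qed.

Lemma chain_distxx : chain_dist h d N x x = 0.
Proof.
apply/eqP; rewrite eq_le chain_dist_ge0 andbT.
have -> : 0 = chain_cost h (fun=> x) 0 by rewrite /chain_cost big_ord0.
exact: chain_dist_le.
Qed.

Lemma chain_dist_step y z : mdist y z <= d ->
  chain_dist h d N x z <= chain_dist h d N x y + h y * mdist y z.
Proof.
move=> yz; rewrite -lerBlDr; apply: lb_le_inf; first by exists N; left.
move=> t [->|[c [n [[c0 cn Hc] ->]]]]; rewrite lerBlDr.
  by rewrite (le_trans (chain_dist_leN _))// lerDl mulr_ge0// mdist_ge0.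
pose c' k := if (k <= n)%N then c k else z.
have -> : chain_cost h c n + h y * mdist y z = chain_cost h c' n.+1.
  rewrite /chain_cost big_ord_recr/= /c' leqnn ltnn cn; congr (_ + _).
  by apply: eq_bigr => i _; rewrite ltnW// ltn_ord.
apply: chain_dist_le; split.
- by rewrite /c' leq0n.
- by rewrite /c' ltnn.
- move=> k; rewrite ltnS leq_eqVlt => /predU1P[->|kn].
    by rewrite /c' leqnn ltnn cn.
  by rewrite /c' kn ltnW//; exact: Hc.
Qed.

End Properties.

Lemma le_chain_dist h h' d d' N x y : (forall z, 0 <= h z) -> 0 <= N ->
  (forall z, h z <= h' z) -> d' <= d ->
  chain_dist h d N x y <= chain_dist h' d' N x y.
Proof.
move=> h0 N0 hh' dd'; apply: lb_le_inf; first by exists N; left.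
move=> t [->|[c [n [[c0 cn Hc] ->]]]]; first exact: chain_dist_leN.
apply: le_trans (_ : chain_cost h c n <= _).
  apply: chain_dist_le => //; split => // k kn; exact: le_trans (Hc _ kn) dd'.
by apply: ler_sum => i _; rewrite ler_wpM2r// mdist_ge0.
Qed.

(** Along the arc length parametrization a short parameter interval is an admissible chain step, so
    [chain_dist_step] bounds the increment of [v] by that of the primitive of [h], up to a quadratic
    error. *)
Lemma chain_dist_upper_gradient h (d N m : R) x (g : R -> X) a b :
  (forall z, 0 <= h z) -> 0 < d -> 0 <= N ->
  (forall y z, `|h y - h z| <= m * mdist y z) ->
  a <= b -> rectifiable g a b ->
  (`|chain_dist h d N x (g a) - chain_dist h d N x (g b)|%:E <=
   line_integral (EFin \o h) g a b)%E.
Proof.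
move=> h0 d0 N0 hL ab rg.
have m0 y z : 0 <= m * mdist y z := le_trans (normr_ge0 _) (hL y z).
set v := chain_dist h d N x.
pose l := arclength g a b; pose gam := arclength_param g a b.
have l0 : 0 <= l.
  rewrite -(arclength_start g a); exact: (arclength_mono rg).
have gl s t : 0 <= s -> s <= t -> t <= l -> mdist (gam s) (gam t) <= t - s.
  exact: arclength_param_lip.
have kl s t : 0 <= s -> s <= t -> t <= l ->
    `|h (gam t) - h (gam s)| <= `|m| * (t - s).
  move=> s0 st tl; apply: le_trans (hL _ _) _; rewrite metric_sym.
  apply: le_trans (_ : `|m| * mdist (gam s) (gam t) <= _).
    by rewrite ler_wpM2r ?mdist_ge0 ?ler_norm.
  by rewrite ler_wpM2l// gl.
have [F [F0 Fl HF]] := integral_lipschitz l0 kl.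
rewrite /line_integral.
have -> : fine (curve_length g a b) = l by [].
rewrite Fl lee_fin.
have ga : gam 0 = g a.
  by rewrite -(arclength_start g a) /gam arclength_param_arclength ?lexx.
have gb : gam l = g b by rewrite /gam arclength_param_arclength ?lexx ?ab.
rewrite -ga -gb.
have up : v (gam l) - F l <= v (gam 0) - F 0.
  apply: (@quadratic_error _ (fun t => v (gam t) - F t) `|m| d) => // s t s0 st tl ts.
  have gst := gl s t s0 st tl.
  have := chain_dist_step x h0 N0 (le_trans gst ts : mdist (gam s) (gam t) <= d).
  rewrite -/v.
  have : h (gam s) * mdist (gam s) (gam t) <= h (gam s) * (t - s).
    by rewrite ler_wpM2l.
  by have := HF s t s0 st tl; rewrite ler_norml; lra.
(* Backwards the step is charged at [gam t]; returning to [gam s] costs a second Lipschitz error,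
   whence the factor 2. *)
have dn : - v (gam l) - F l <= - v (gam 0) - F 0.
  apply: (@quadratic_error _ (fun t => - v (gam t) - F t) (2 * `|m|) d) => // s t s0 st tl ts.
  have gst := gl s t s0 st tl.
  have gts : mdist (gam t) (gam s) <= t - s by rewrite metric_sym.
  have := chain_dist_step x h0 N0 (le_trans gts ts : mdist (gam t) (gam s) <= d).
  rewrite -/v.
  have : h (gam t) * mdist (gam t) (gam s) <= h (gam t) * (t - s).
    by rewrite ler_wpM2l.
  have : h (gam t) * (t - s) <= (h (gam s) + `|m| * (t - s)) * (t - s).
    by rewrite ler_wpM2r ?subr_ge0//; have := kl s t s0 st tl; rewrite ler_norml; lra.
  by have := HF s t s0 st tl; rewrite ler_norml; lra.
by rewrite ler_norml; move: up dn; rewrite F0; lra.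
Qed.

Lemma chain_dist_continuous h (d N H : R) x :
  (forall z, 0 <= h z <= H) -> 0 < d -> 0 <= N ->
  continuous (chain_dist h d N x).
Proof.
move=> hH d0 N0 y; apply/cvgrPdist_le => e e0.
have h0 z : 0 <= h z by have /andP[] := hH z.
have H0 : 0 < H + 1 by have /andP[a b] := hH x; rewrite ltr_wpDl// (le_trans a).
apply/nbhs_ballP; exists (Num.min d (e / (H + 1))).
  by rewrite /= lt_min d0 divr_gt0.
move=> z; rewrite ballEmdist/= lt_min => /andP[yzd yze].
have zyd : mdist z y <= d by rewrite metric_sym ltW.
have yz0 : 0 <= mdist y z := mdist_ge0 _ _.
have := chain_dist_step x h0 N0 (ltW yzd).
have := chain_dist_step x h0 N0 zyd.
rewrite (metric_sym z y).
have hy : h y * mdist y z <= (H + 1) * mdist y z.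
  by rewrite ler_wpM2r//; have /andP[_] := hH y; lra.
have hz : h z * mdist y z <= (H + 1) * mdist y z.
  by rewrite ler_wpM2r//; have /andP[_] := hH z; lra.
have : (H + 1) * mdist y z <= e by rewrite mulrC -ler_pdivlMr// ltW.
by rewrite ler_norml; lra.
Qed.

End ChainDistance.

(** * Limits of chains *)

Lemma ultra_fmap (T U : Type) (f : T -> U) (F : set_system T) :
  UltraFilter F -> UltraFilter (f @ F).
Proof.
move=> FU; split; first exact: fmap_proper_filter.
move=> G GP FG; apply/seteqP; split => // A GA.
have [//|FnA] := in_ultra_setVsetC (f @^-1` A) FU.
have /FG GnA : (f @ F) (~` A) by exact: FnA.
have : G set0 by rewrite -(setICr A); exact: filterI.
by have := @filter_not_empty _ G GP.
Qed.

Lemma ultra_bounded_cvg (R : realType) (T : Type) (F : set_system T)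
    (f : T -> R) (a b : R) :
  UltraFilter F -> (forall t, a <= f t <= b) -> exists l : R, f @ F --> l.
Proof.
move=> FU fab; have := @segment_compact R a b.
rewrite compact_ultra => /(_ (f @ F) (ultra_fmap f FU)).
case.
  by apply: (@filterE T F _ (f @^-1` `[a, b])) => t; rewrite /= in_itv/= fab.
by move=> l [_ fl]; exists l.
Qed.

Section Proper.
Context {R : realType} {X : completeMetricType R}.

(** Together with completeness this amounts to compactness of closed balls; it is used through the
    convergence of ultrafilters. *)
Definition balls_totally_bounded := forall (x : X) (r e : R), 0 < e ->
  exists s : seq X, ball x r `<=` \bigcup_(z in [set` s]) ball z e.

Lemma ultra_ball_cvg (T : Type) (F : set_system T) (f : T -> X) (x : X) (r : R) :
  balls_totally_bounded -> UltraFilter F -> (forall t, ball x r (f t)) ->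
  exists l : X, f @ F --> l.
Proof.
move=> tb FU fx; have fFU := ultra_fmap f FU.
suff : cvg (f @ F) by move=> /cvg_ex.
apply: cauchy_cvg; apply/cauchyP => e e0.
have [s sx] := tb x r e e0.
suff [z zs Fz] : exists2 z, z \in s & (f @ F) (ball z e).
  by exists z.
apply: contrapT => nF.
have H (s' : seq X) : {subset s' <= s} ->
    F [set t | forall z, z \in s' -> ~ ball z e (f t)].
  elim: s' => [|z s' IH] s's; first exact: filterE.
  have [Fz|FnZ] := in_ultra_setVsetC (f @^-1` ball z e) FU.
    by exfalso; apply: nF; exists z => //; apply: s's; rewrite mem_head.
  have Fs' := IH (fun w ws => s's w (mem_behead (s := z :: s') ws)).
  apply: filterS (filterI FnZ Fs') => t [h1 h2] w.
  by rewrite in_cons => /predU1P[->//|]; exact: h2.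
have /filter_ex[t Ht] := H s (fun _ => id).
by have [z zs zt] := sx _ (fx t); exact: Ht zs zt.
Qed.

End Proper.

Lemma cvg_mdist (R : realType) (X : metricType R) (T : Type) (F : set_system T)
    (f g : T -> X) (x y : X) :
  Filter F -> f @ F --> x -> g @ F --> y ->
  (fun t => mdist (f t) (g t)) @ F --> (mdist x y : R).
Proof.
move=> FF fx gy; apply/cvgrPdist_lt => e e0.
have e2 : 0 < e / 2 by rewrite divr_gt0.
near=> t.
have h1 : mdist x (f t) < e / 2.
  near: t; move/cvg_ballP : fx => /(_ _ e2); apply: filterS => t.
  by rewrite ballEmdist.
have h2 : mdist y (g t) < e / 2.
  near: t; move/cvg_ballP : gy => /(_ _ e2); apply: filterS => t.
  by rewrite ballEmdist.
have := metric_triangle x (f t) y; have := metric_triangle (f t) (g t) y.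
have := metric_triangle (f t) x (g t); have := metric_triangle x y (g t).
rewrite (metric_sym (g t) y) (metric_sym (f t) x) => *.
by rewrite ltr_norml; apply/andP; split; lra.
Unshelve. all: by end_near. Qed.

Lemma cvg_lipschitz (R : realType) (X : metricType R) (T : Type) (F : set_system T)
    (f : T -> X) (x : X) (h : X -> R) (m : R) :
  Filter F -> (forall y z, `|h y - h z| <= m * mdist y z) ->
  f @ F --> x -> h \o f @ F --> h x.
Proof.
move=> FF hL fx; apply/cvgrPdist_le => e e0.
have M0 : 0 < `|m| + 1 by rewrite ltr_wpDl.
near=> t.
have h1 : mdist x (f t) < e / (`|m| + 1).
  near: t; move/cvg_ballP : fx => /(_ (e / (`|m| + 1))); rewrite divr_gt0// => /(_ isT).
  by apply: filterS => t; rewrite ballEmdist.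
apply: le_trans (hL _ _) _.
apply: le_trans (_ : (`|m| + 1) * mdist x (f t) <= _).
  by rewrite ler_wpM2r ?mdist_ge0// (le_trans (ler_norm m))// lerDl.
by rewrite mulrC -ler_pdivlMr// ltW.
Unshelve. all: by end_near. Qed.

Section ChainParam.
Context {R : realType} {X : pointedMetricType R}.

Lemma chain_index (l : nat -> R) n : l 0%N = 0 ->
  exists k : R -> nat, forall t, 0 <= t ->
    [/\ (k t <= n)%N, l (k t) <= t & (k t < n)%N -> t < l (k t).+1].
Proof.
move=> l0.
have H (t : R) : exists k, 0 <= t ->
    [/\ (k <= n)%N, l k <= t & (k < n)%N -> t < l k.+1].
  have [t0|] := pselect (0 <= t); last by move=> t0; exists 0%N.
  have ex : exists k, (k <= n)%N && (l k <= t) by exists 0%N; rewrite l0.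
  have bd k : (k <= n)%N && (l k <= t) -> (k <= n)%N by case/andP.
  exists (ex_maxn ex bd) => _; case: ex_maxnP => k /andP[kn lk] mx.
  split => // kn'; rewrite ltNge; apply/negP => lk'.
  by have := mx k.+1; rewrite kn' lk' ltnn => /(_ isT).
by have [k Hk] := choice H; exists k.
Qed.

(* The chain is run through at unit speed: [Lam] and [K] are the length and the
   cost accumulated at time [s].  The last clause is quantified over [f] because
   the limit curve is tested against all functions preceding [h] in the
   approximating sequence. *)
Lemma chain_param (h : X -> R) (c0 d M : R) x y c n :
  0 < c0 -> (forall z, c0 <= h z) -> 0 < d -> chain d x y c n ->
  chain_cost h c n <= M ->
  exists (p : R -> X) (Lam K : R -> R),
  [/\ p 0 = x, p (M / c0) = y,
    (forall s, 0 <= Lam s <= M / c0),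
    (forall s, 0 <= K s <= M) &
    forall s t, 0 <= s -> s <= t -> t <= M / c0 ->
      [/\ mdist (p s) (p t) <= Lam t - Lam s, Lam t - Lam s <= t - s + d &
       forall (f : X -> R) (m : R), 0 <= m -> (forall z, f z <= h z) ->
         (forall z w, `|f z - f w| <= m * mdist z w) ->
         f (p s) * (Lam t - Lam s) - m * (t - s + d) ^+ 2 <= K t - K s]].
Proof.
move=> c00 hc d0 [c_0 c_n Hc] costM.
have h0 z : 0 <= h z := le_trans (ltW c00) (hc z).
pose l k : R := \sum_(0 <= i < k) mdist (c i) (c i.+1).
pose C k : R := \sum_(0 <= i < k) h (c i) * mdist (c i) (c i.+1).
have lcat i j : (i <= j)%N -> l j = l i + \sum_(i <= q < j) mdist (c q) (c q.+1).
  by move=> ij; rewrite /l (big_cat_nat (leq0n i) ij).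
have Ccat i j : (i <= j)%N ->
    C j = C i + \sum_(i <= q < j) h (c q) * mdist (c q) (c q.+1).
  by move=> ij; rewrite /C (big_cat_nat (leq0n i) ij).
have sum0 i j : 0 <= \sum_(i <= q < j) mdist (c q) (c q.+1).
  by apply: sumr_ge0 => q _; exact: mdist_ge0.
have lmono i j : (i <= j)%N -> l i <= l j.
  by move=> ij; rewrite (lcat _ _ ij) lerDl.
have Cmono i j : (i <= j)%N -> C i <= C j.
  move=> ij; rewrite (Ccat _ _ ij) lerDl; apply: sumr_ge0 => q _.
  by rewrite mulr_ge0// mdist_ge0.
have dl i j : (i <= j)%N -> mdist (c i) (c j) <= l j - l i.
  elim: j => [|j IH]; first by rewrite leqn0 => /eqP ->; rewrite mdistxx subrr.
  rewrite leq_eqVlt => /predU1P[->|]; first by rewrite mdistxx subrr.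
  rewrite ltnS => ij; have -> : l j.+1 = l j + mdist (c j) (c j.+1) by rewrite /l big_nat_recr.
  by have := IH ij; have := metric_triangle (c i) (c j) (c j.+1); lra.
have l0 : l 0%N = 0 by rewrite /l big_geq.
have C0 : C 0%N = 0 by rewrite /C big_geq.
have Cn : C n <= M by rewrite /C big_mkord.
(* Every unit of length costs at least [c0], so time [M / c0] suffices to traverse the chain at unit
   speed. *)
have ln : l n <= M / c0.
  rewrite ler_pdivlMr// mulrC; apply: le_trans Cn; rewrite /l /C mulr_sumr.
  by apply: ler_sum => i _; rewrite ler_wpM2r// mdist_ge0.
have [k Hk] := chain_index n l0.
(* [chain_index] controls [k] at nonnegative times only, while the bounds on [Lam] and [K] are
   claimed for all real [s]; the cap at [n] supplies them. *)
pose k' t := minn (k t) n.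
have kk' t : 0 <= t -> k' t = k t by move=> /Hk[/minn_idPl].
have k'n t : (k' t <= n)%N by rewrite geq_minr.
have L0 : 0 <= M / c0 by apply: le_trans ln; rewrite -l0 lmono.
exists (c \o k'), (l \o k'), (C \o k'); split.
- rewrite /= kk'//; have [_ lk _] := Hk 0 (lexx _).
  apply/mdist_positivity/eqP; rewrite eq_le mdist_ge0 andbT.
  by rewrite metric_sym -c_0; apply: le_trans (dl _ _ (leq0n _)) _; rewrite l0 subr0.
- rewrite /= kk'//; have [kn lk kl] := Hk _ L0.
  move: kn; rewrite leq_eqVlt => /predU1P[->//|kn].
  have := lt_le_trans (kl kn) (le_trans (lmono _ _ kn) ln).
  by rewrite ltxx.
- move=> s /=; rewrite -{1}l0 lmono//=; exact: le_trans (lmono _ _ (k'n _)) ln.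
- move=> s /=; rewrite -{1}C0 Cmono//=; exact: le_trans (Cmono _ _ (k'n _)) Cn.
move=> s t s0 st tL /=; have t0 := le_trans s0 st.
rewrite !kk'//; have [ksn lks ksl] := Hk s s0; have [ktn lkt ktl] := Hk t t0.
have kst : (k s <= k t)%N.
  rewrite leqNgt; apply/negP => kts.
  have := ktl (leq_trans kts ksn); have := lmono _ _ kts.
  by move=> h1 h2; have := lt_le_trans h2 (le_trans h1 lks); rewrite ltNge st.
(* As long as the chain is not exhausted, the vertex reached at time [s] trails the unit-speed
   position by less than one step. This is the origin of the error [d] in the increments. *)
have lb : (k s < k t)%N -> s - d < l (k s).
  move=> lt; have ksn' := leq_trans lt ktn.
  have := ksl ksn'; rewrite (lcat _ _ (leqnSn _)) big_nat1.
  by have := Hc _ ksn'; lra.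
have ld : l (k t) - l (k s) <= t - s + d.
  move: kst; rewrite leq_eqVlt => /predU1P[->|/lb]; last by lra.
  by rewrite subrr addr_ge0 ?subr_ge0// ltW.
split; [exact: dl|exact: ld|].
move=> f m m0 fh fL.
have lst : l (k t) - l (k s) = \sum_(k s <= q < k t) mdist (c q) (c q.+1).
  by rewrite (lcat _ _ kst); ring.
have : (f (c (k s)) - m * (t - s + d)) * (l (k t) - l (k s)) <= C (k t) - C (k s).
  have -> : C (k t) - C (k s) =
      \sum_(k s <= q < k t) h (c q) * mdist (c q) (c q.+1).
    by rewrite (Ccat _ _ kst); ring.
  rewrite lst mulr_sumr.
  rewrite big_nat_cond [leRHS]big_nat_cond; apply: ler_sum => q.
  rewrite andbT => /andP[ksq qkt]; rewrite ler_wpM2r ?mdist_ge0//.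
  apply: le_trans (fh _); rewrite lerBlDr -lerBlDl.
  apply: le_trans (ler_norm _) _; apply: le_trans (fL _ _) _.
  rewrite ler_wpM2l//; apply: le_trans (dl _ _ ksq) _.
  by have := lb (leq_ltn_trans ksq qkt); have := lmono _ _ (ltnW qkt); lra.
have : m * (t - s + d) * (l (k t) - l (k s)) <= m * (t - s + d) * (t - s + d).
  by rewrite ler_wpM2l// mulr_ge0// addr_ge0 ?subr_ge0// ltW.
by lra.
Qed.

End ChainParam.

Section LimitCurve.
Context {R : realType} {X : completeMetricType R}.

(** An ultrafilter replaces the Arzela-Ascoli theorem: positions, lengths and costs all converge
    pointwise, with no passage to subsequences. The limit [Lam] of the lengths dominates distances
    along [g], hence its arc length; the limit [K] of the costs dominates [h m] times the increments
    of [Lam] up to a quadratic error, for each fixed [m]. *)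
Lemma chain_limit_curve (h : nat -> X -> R) (Lm : nat -> R) (c0 M : R) (x y : X)
    (c : nat -> nat -> X) (n : nat -> nat) :
  balls_totally_bounded (X := X) -> 0 < c0 ->
  (forall m, 0 <= Lm m) ->
  (forall m z, c0 <= h m z) ->
  (forall m m' z, (m <= m')%N -> h m z <= h m' z) ->
  (forall m z w, `|h m z - h m w| <= Lm m * mdist z w) ->
  (forall i, chain i.+1%:R^-1 x y (c i) (n i)) ->
  (forall i, chain_cost (h i) (c i) (n i) <= M) ->
  exists g : R -> X, exists2 L, 0 <= L & [/\ rectifiable g 0 L, g 0 = x, g L = y &
    forall m, (line_integral (EFin \o h m) g 0 L <= M%:E)%E].
Proof.
move=> tb c00 Lm0 hc hmono hL Hc HM.
pose L := M / c0.
have d0 i : 0 < i.+1%:R^-1 :> R by rewrite invr_gt0.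
have /choice[q Hq] i : exists q : (R -> X) * (R -> R) * (R -> R),
  [/\ q.1.1 0 = x, q.1.1 L = y,
    (forall s, 0 <= q.1.2 s <= L),
    (forall s, 0 <= q.2 s <= M) &
    forall s t, 0 <= s -> s <= t -> t <= L ->
      [/\ mdist (q.1.1 s) (q.1.1 t) <= q.1.2 t - q.1.2 s,
       q.1.2 t - q.1.2 s <= t - s + i.+1%:R^-1 &
       forall m, (m <= i)%N ->
         h m (q.1.1 s) * (q.1.2 t - q.1.2 s) - Lm m * (t - s + i.+1%:R^-1) ^+ 2 <=
         q.2 t - q.2 s]].
  have [p [Lam [K [p0 pL HLam HK H]]]] := chain_param c00 (hc i) (d0 i) (Hc i) (HM i).
  exists (p, Lam, K); split => // s t s0 st tL.
  have [h1 h2 h3] := H s t s0 st tL; split => // m mi.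
  by apply: h3 => // z; exact: hmono.
have [U [UU ooU]] := ultraFilterLemma eventually_filter.
have L0 : 0 <= L by have [_ _ /(_ 0)/andP[h1 h2] _ _] := Hq 0%N; exact: le_trans h2.
have UF : ProperFilter U by exact: ultra_proper.
have /choice[g Hg] t : exists l : X, 0 <= t <= L -> (fun i => (q i).1.1 t) @ U --> l.
  have [/andP[t0 tL]|] := pselect (0 <= t <= L); last by move=> ?; exists x.
  have [i|l] := @ultra_ball_cvg _ X nat U (fun i => (q i).1.1 t) x (L + 1) tb UU.
    rewrite ballEmdist /=; have [p0 _ HLam _ /(_ 0 t (lexx _) t0 tL)[h1 _ _]] := Hq i.
    rewrite -p0; apply: le_lt_trans h1 _.
    by have /andP[_] := HLam t; have /andP[] := HLam 0; lra.
  by exists l.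
have /choice[Lam HLam] t : exists l : R, (fun i => (q i).1.2 t) @ U --> l.
  by apply: (ultra_bounded_cvg (a := 0) (b := L)) => i; have [] := Hq i.
have /choice[K HK] t : exists l : R, (fun i => (q i).2 t) @ U --> l.
  by apply: (ultra_bounded_cvg (a := 0) (b := M)) => i; have [] := Hq i.
have dU : (fun i : nat => i.+1%:R^-1 : R) @ U --> (0 : R).
  by apply: cvg_trans (@cvg_harmonic R); exact: cvg_app.
have gLam s t : 0 <= s -> s <= t -> t <= L -> mdist (g s) (g t) <= Lam t - Lam s.
  move=> s0 st tL; apply: (ler_cvg_to (a := U)).
  - apply: (@cvg_mdist R X _ _ (fun i => (q i).1.1 s) (fun i => (q i).1.1 t)).
      by apply: Hg; rewrite s0 (le_trans st).
    by apply: Hg; rewrite tL (le_trans s0).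
  - exact: cvgB (HLam t) (HLam s).
  - by near=> i; have [_ _ _ _ /(_ s t s0 st tL)[]] := Hq i.
have Lamd s t : 0 <= s -> s <= t -> t <= L -> Lam t - Lam s <= t - s.
  move=> s0 st tL; rewrite -[leRHS]addr0; apply: (ler_cvg_to (a := U)).
  - exact: cvgB (HLam t) (HLam s).
  - by apply: cvgD (cvg_cst _) dU.
  - by near=> i; have [_ _ _ _ /(_ s t s0 st tL)[]] := Hq i.
have KLam m s t : 0 <= s -> s <= t -> t <= L ->
    h m (g s) * (Lam t - Lam s) - Lm m * (t - s) ^+ 2 <= K t - K s.
  move=> s0 st tL; rewrite -[in X in Lm m * X](addr0 (t - s)).
  apply: (ler_cvg_to (a := U) (f := fun i =>
    h m ((q i).1.1 s) * ((q i).1.2 t - (q i).1.2 s) -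
    Lm m * (t - s + i.+1%:R^-1) ^+ 2) (g := fun i => (q i).2 t - (q i).2 s)).
  - apply: cvgB.
      apply: cvgM; last exact: cvgB (HLam t) (HLam s).
      apply: (@cvg_lipschitz R X nat U (fun i => (q i).1.1 s) _ _ _ _ (hL m)).
      by apply: Hg; rewrite s0 (le_trans st).
    apply: cvgM; first exact: cvg_cst.
    by rewrite expr2; apply: cvgM; apply: cvgD (cvg_cst _) dU.
  - exact: cvgB (HK t) (HK s).
  - near=> i.
    have [_ _ _ _ /(_ s t s0 st tL)[_ _ /(_ m)]] := Hq i.
    apply; near: i; apply: ooU; exact: nbhs_infty_ge.
have g1 s t : 0 <= s -> s <= t -> t <= L -> mdist (g s) (g t) <= t - s.
  move=> s0 st tL; exact: le_trans (gLam s t s0 st tL) (Lamd s t s0 st tL).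
have gx : g 0 = x.
  have := Hg 0; rewrite lexx L0 => /(_ isT).
  have -> : (fun i => (q i).1.1 0) = fun=> x by apply/funext => i; have [] := Hq i.
  by move=> H; apply: (cvg_unique (@metric_hausdorff _ X) H); exact: cvg_cst.
have gy : g L = y.
  have := Hg L; rewrite lexx L0 => /(_ isT).
  have -> : (fun i => (q i).1.1 L) = fun=> y by apply/funext => i; have [] := Hq i.
  by move=> H; apply: (cvg_unique (@metric_hausdorff _ X) H); exact: cvg_cst.
have rg : rectifiable g 0 L.
  split; last first.
    apply: le_lt_trans (ltry (L - 0)).
    by apply: (@curve_length_dominated _ _ g id).
  apply/subspace_continuousP => s; rewrite /= in_itv/= => /andP[s0 sL].
  apply/cvg_ballP => e e0; rewrite near_withinE.
  apply/nbhs_ballP; exists e => // t; rewrite /ball/= => ste.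
  rewrite in_itv/= => /andP[t0 tL]; rewrite -/(ball (g s) e (g t)) ballEmdist/=.
  have [st|/ltW ts] := leP s t.
    by have := g1 s t s0 st tL; move: ste; rewrite ltr_norml; lra.
  by rewrite metric_sym; have := g1 t s t0 ts sL; move: ste; rewrite ltr_norml; lra.
exists g, L => //; split => // m.
pose l := arclength g 0 L; pose gam := arclength_param g 0 L.
have l0 : 0 <= l by rewrite -(arclength_start g 0); exact: (arclength_mono rg).
have gl s t : 0 <= s -> s <= t -> t <= l -> mdist (gam s) (gam t) <= t - s.
  exact: arclength_param_lip.
have kl s t : 0 <= s -> s <= t -> t <= l ->
    `|h m (gam t) - h m (gam s)| <= Lm m * (t - s).
  move=> s0 st tl; apply: le_trans (hL _ _ _) _; rewrite metric_sym.
  by rewrite ler_wpM2l// gl.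
have [F [F0 Fl HF]] := integral_lipschitz l0 kl.
rewrite /line_integral.
have -> : fine (curve_length g 0 L) = l by [].
rewrite Fl lee_fin.
(* [F] lives on arc length and [K] on time. They are compared in time through [tau], whose
   increments are at most those of [Lam]. *)
pose tau := arclength g 0.
have : F (tau L) - K L <= F (tau 0) - K 0.
  apply: (@quadratic_error _ (fun t => F (tau t) - K t) (2 * Lm m) 1) => // s t s0 st tL _.
  have ts0 : 0 <= tau s.
    by rewrite -(arclength_start g 0); apply: (arclength_mono rg) => //; exact: le_trans tL.
  have tst : tau s <= tau t by apply: (arclength_mono rg).
  have tl : tau t <= l by apply: (arclength_mono rg) => //; exact: le_trans st.
  have tLam : tau t - tau s <= Lam t - Lam s.
    apply: (arclength_dominated rg) => // r r' sr rr' r't.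
    by apply: gLam => //; [exact: le_trans sr|exact: le_trans tL].
  have := HF _ _ ts0 tst tl.
  have -> : gam (tau s) = g s.
    by rewrite /gam arclength_param_arclength// s0 (le_trans st).
  have : h m (g s) * (tau t - tau s) <= h m (g s) * (Lam t - Lam s).
    by rewrite ler_wpM2l// (le_trans (ltW c00)).
  have : Lm m * (tau t - tau s) ^+ 2 <= Lm m * (t - s) ^+ 2.
    rewrite ler_wpM2l// ler_sqr ?nnegrE ?subr_ge0//.
    exact: le_trans tLam (Lamd _ _ s0 st tL).
  by have := KLam m s t s0 st tL; rewrite ler_norml; lra.
rewrite /tau arclength_start F0 -/l.
have : 0 <= K 0.
  apply: (ler_cvg_to (a := U) (cvg_cst 0) (HK 0)).
  by near=> i; have [_ _ _ /(_ 0)/andP[]] := Hq i.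
have : K L <= M.
  apply: (ler_cvg_to (a := U) (HK L) (cvg_cst M)).
  by near=> i; have [_ _ _ /(_ L)/andP[]] := Hq i.
by lra.
Unshelve. all: by end_near. Qed.

End LimitCurve.

(** * From chains to a pointwise bound on oscillations *)

Section LipschitzEnvelope.
Context {R : realType} {X : pointedMetricType R}.
Implicit Types (f : X -> R) (x y : X).

(** The inf-convolution of [f] with [k] times the distance: for nonnegative [f] and [k], the
    greatest [k]-Lipschitz function below [f]. *)
Definition lipschitz_envelope f (k : R) x :=
  inf [set f z + k * mdist x z | z in [set: X]].

Section Nonneg.
Context f (k : R) (f0 : forall z, 0 <= f z) (k0 : 0 <= k).

Lemma lipschitz_envelope_has_inf x :
  has_inf [set f z + k * mdist x z | z in [set: X]].
Proof.
split; first by exists (f x + k * mdist x x), x.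
by exists 0 => _ [z _ <-]; rewrite addr_ge0// mulr_ge0// mdist_ge0.
Qed.

Lemma lipschitz_envelope_le x : lipschitz_envelope f k x <= f x.
Proof.
apply: ge_inf; first by have [] := lipschitz_envelope_has_inf x.
by exists x => //; rewrite mdistxx mulr0 addr0.
Qed.

Lemma lipschitz_envelope_ge c x : (forall z, c <= f z + k * mdist x z) ->
  c <= lipschitz_envelope f k x.
Proof.
move=> H; apply: lb_le_inf; first by have [] := lipschitz_envelope_has_inf x.
by move=> _ [z _ <-].
Qed.

Lemma lipschitz_envelope_lip x y :
  `|lipschitz_envelope f k x - lipschitz_envelope f k y| <= k * mdist x y.
Proof.
have H a b : lipschitz_envelope f k a - lipschitz_envelope f k b <= k * mdist a b.
  rewrite lerBlDr addrC -lerBlDr; apply: lipschitz_envelope_ge => z.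
  rewrite lerBlDr; apply: le_trans (_ : f z + k * mdist a z <= _).
    apply: ge_inf; first by have [] := lipschitz_envelope_has_inf a.
    by exists z.
  by rewrite -addrA lerD2l -mulrDr ler_wpM2l// addrC metric_triangle.
have := H x y; have := H y x; rewrite (metric_sym y x) ler_norml.
by move=> h1 h2; apply/andP; split; lra.
Qed.

End Nonneg.

Lemma le_lipschitz_envelope f f' (k k' : R) x : (forall z, 0 <= f z) -> 0 <= k ->
  (forall z, f z <= f' z) -> k <= k' ->
  lipschitz_envelope f k x <= lipschitz_envelope f' k' x.
Proof.
move=> f0 k0 ff' kk'.
have f'0 z : 0 <= f' z := le_trans (f0 z) (ff' z).
apply: lipschitz_envelope_ge => //; first exact: le_trans kk'.
move=> z; apply: le_trans (_ : f z + k * mdist x z <= _).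
  by apply: ge_inf; [have [] := lipschitz_envelope_has_inf f0 k0 x|exists z].
by rewrite lerD// ler_wpM2r// mdist_ge0.
Qed.

(** [h m] is the envelope of [rho] truncated at [m + 1]; as [c0 <= 1], truncation respects the lower
    bound. For the last clause, [rho] exceeds [a] on some ball of radius [r] around [z], and outside
    that ball the penalty [(m + 1) r] exceeds [a] once [m] is large. *)
Lemma lsc_lipschitz_approx (rho : X -> \bar R) (c0 : R) : 0 < c0 <= 1 ->
  (forall x, (c0%:E <= rho x)%E) ->
  (forall a : R, open [set x | (a%:E < rho x)%E]) ->
  exists h : nat -> X -> R,
  [/\ forall m z, c0 <= h m z <= m.+1%:R,
    forall m m' z, (m <= m')%N -> h m z <= h m' z,
    forall m z w, `|h m z - h m w| <= m.+1%:R * mdist z w,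
    forall m z, ((h m z)%:E <= rho z)%E &
    forall z (a : R), (a%:E < rho z)%E -> exists m, a <= h m z].
Proof.
move=> /andP[c00 c01] rhoc lsc.
pose tr m z : R := fine (Order.min m.+1%:R%:E (rho z)).
have rho0 z : (0 <= rho z)%E.
  by apply: le_trans (rhoc z); rewrite lee_fin ltW.
have trE m z : ((tr m z)%:E = Order.min m.+1%:R%:E (rho z))%E.
  rewrite /tr fineK// ge0_fin_numE; last by rewrite le_min rho0 andbT lee_fin.
  by rewrite gt_min ltry.
have trc m z : c0 <= tr m z.
  by rewrite -lee_fin trE le_min rhoc andbT lee_fin (le_trans c01)// ler1n.
have tr0 m z : 0 <= tr m z := le_trans (ltW c00) (trc m z).
have m0 m : 0 <= m.+1%:R :> R by [].
exists (fun m => lipschitz_envelope (tr m) m.+1%:R); split.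
- move=> m z; apply/andP; split.
    apply: lipschitz_envelope_ge => // w; rewrite (le_trans (trc m w))//.
    by rewrite lerDl mulr_ge0// mdist_ge0.
  apply: le_trans (lipschitz_envelope_le _ _ _) _ => //.
  by rewrite -lee_fin trE ge_min lexx.
- move=> m m' z mm'; apply: le_lipschitz_envelope => //; last by rewrite ler_nat.
  move=> w; rewrite -lee_fin !trE le_min !ge_min lexx orbT andbT.
  by rewrite lee_fin ler_nat ltnS mm'.
- by move=> m z w; apply: lipschitz_envelope_lip.
- move=> m z; apply: (@le_trans _ _ (tr m z)%:E).
    by rewrite lee_fin lipschitz_envelope_le.
  by rewrite trE ge_min lexx orbT.
- move=> z a az.
  have : nbhs z [set x | (a%:E < rho x)%E] by apply: open_nbhs_nbhs; split.
  move=> /nbhs_ballP[r /= r0 H].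
  pose m := Num.truncn (Num.max a (a / r)).
  have : Num.max a (a / r) < m.+1%:R by exact: truncnS_gt.
  rewrite gt_max => /andP[am arm].
  exists m; apply: lipschitz_envelope_ge => // w.
  have [zw|zw] := ltP (mdist z w) r.
    have wr : (a%:E < rho w)%E by apply: H; rewrite ballEmdist.
    have : a <= tr m w by rewrite -lee_fin trE le_min ltW ?lte_fin//= ltW.
    move/le_trans; apply; by rewrite lerDl mulr_ge0// mdist_ge0.
  apply: (@le_trans _ _ (m.+1%:R * r)); first by rewrite -ler_pdivrMr// ltW.
  rewrite -[leLHS]add0r lerD// ler_wpM2l//.
Qed.

End LipschitzEnvelope.

(* The library assumes measurability, which is not available for the original
   upper gradient along an arc length parametrization. *)
Lemma ge0_le_integral_nonmeasurable d (T : measurableType d) (R : realType)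
    (mu : {measure set T -> \bar R}) (D : set T) (f g : T -> \bar R) :
  (forall x, D x -> (0 <= f x)%E) -> (forall x, D x -> (f x <= g x)%E) ->
  (\int[mu]_(x in D) f x <= \int[mu]_(x in D) g x)%E.
Proof.
move=> f0 fg; have g0 x : D x -> (0 <= g x)%E.
  by move=> Dx; exact: le_trans (f0 x Dx) (fg x Dx).
rewrite !ge0_integralE//; apply: le_ereal_sup => _ [h hf <-]; exists h => // x.
apply: le_trans (hf x) _; rewrite /patch; case: ifPn => // /set_mem Dx.
exact: fg.
Qed.

Section LineIntegral.
Context {R : realType} {X : pointedMetricType R}.

Lemma arclength_param_measurable (h : X -> R) (m : R) (g : R -> X) a b :
  (forall y z, `|h y - h z| <= m * mdist y z) ->
  a <= b -> rectifiable g a b ->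
  measurable_fun `[0, fine (curve_length g a b)] (h \o arclength_param g a b).
Proof.
move=> hL ab rg; apply: subspace_continuous_measurable_fun => //.
apply/subspace_continuousP => s; rewrite /= in_itv/= => /andP[s0 sl].
apply/cvgrPdist_le => e e0; rewrite near_withinE.
have M0 : 0 < `|m| + 1 by rewrite ltr_wpDl.
apply/nbhs_ballP; exists (e / (`|m| + 1)); first by rewrite /= divr_gt0.
move=> t; rewrite /ball/= => st; rewrite in_itv/= => /andP[t0 tl].
have gst : mdist (arclength_param g a b s) (arclength_param g a b t) <= `|s - t|.
  have [le|/ltW le] := leP s t.
    by rewrite ler0_norm ?subr_le0// opprB (arclength_param_lip ab rg).
  by rewrite metric_sym ger0_norm ?subr_ge0// (arclength_param_lip ab rg).
apply: le_trans (hL _ _) _.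
apply: le_trans (_ : (`|m| + 1) * `|s - t| <= _).
  apply: le_trans (_ : `|m| * mdist (arclength_param g a b s) (arclength_param g a b t) <= _).
    by rewrite ler_wpM2r ?mdist_ge0// ler_norm.
  by apply: ler_pM => //; rewrite ?mdist_ge0// lerDl.
by rewrite mulrC -ler_pdivlMr// ltW.
Qed.

(** Monotone convergence is applied to the continuous integrands coming from [h m]; [rho] enters
    only by comparison with their limit, so it need not be measurable along the curve. *)
Lemma line_integral_le_sup (rho : X -> \bar R) (h : nat -> X -> R) (M : R)
    (g : R -> X) a b :
  a <= b -> rectifiable g a b ->
  (forall x, (0 <= rho x)%E) ->
  (forall m z, 0 <= h m z) ->
  (forall m m' z, (m <= m')%N -> h m z <= h m' z) ->
  (forall m z w, `|h m z - h m w| <= m.+1%:R * mdist z w) ->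
  (forall z (r : R), (r%:E < rho z)%E -> exists m, r <= h m z) ->
  (forall m, (line_integral (EFin \o h m) g a b <= M%:E)%E) ->
  (line_integral rho g a b <= M%:E)%E.
Proof.
move=> ab rg rho0 h0 hmono hL hsup hM; rewrite /line_integral.
set D := `[0, _]; pose gam := arclength_param g a b.
pose u m t := (h m (gam t))%:E.
have und t : nondecreasing_seq (fun m => u m t).
  by move=> m m' mm'; rewrite lee_fin hmono.
have le1 : (\int[lebesgue_measure]_(t in [set` D]) rho (gam t) <=
    \int[lebesgue_measure]_(t in [set` D]) limn (u^~ t))%E.
  apply: ge0_le_integral_nonmeasurable => // t _.
  rewrite (cvg_lim _ (ereal_nondecreasing_cvgn (und t)))//.
  rewrite leNgt; apply/negP.
  set S := ereal_sup _ => Sr.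
  have Sfin : S \is a fin_num.
    rewrite ge0_fin_numE; first exact: lt_le_trans Sr (leey _).
    apply: le_trans (_ : (0 <= u 0%N t)%E) _; first by rewrite lee_fin.
    by apply: ereal_sup_ubound; exists 0%N.
  have [r Sr' rr] : exists2 r : R, (S < r%:E)%E & (r%:E < rho (gam t))%E.
    move: Sr; rewrite -(fineK Sfin); move: (fine S) => s.
    case: (rho (gam t)) (rho0 (gam t)) => [q|_ _|//].
    - move=> _; rewrite lte_fin => sq; exists ((s + q) / 2); rewrite lte_fin; lra.
    - by exists (s + 1); rewrite ?ltry// lte_fin ltrDl.
  have [m rm] := hsup _ _ rr.
  suff : (r%:E <= S)%E by rewrite leNgt Sr'.
  apply: le_trans (_ : (u m t <= S)%E); first by rewrite lee_fin.
  by apply: ereal_sup_ubound; exists m.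
apply: (le_trans le1).
have mu_ m : measurable_fun [set` D] (u m).
  by apply/measurable_EFinP; exact: (arclength_param_measurable (hL m)).
have u0 m t : [set` D] t -> (0 <= u m t)%E by rewrite lee_fin.
have /cvg_lim <- // := cvg_monotone_convergence (mu := lebesgue_measure)
  (measurable_itv D) mu_ u0 (fun t _ => und t).
apply: lime_le.
  apply: ereal_nondecreasing_is_cvgn => m m' mm'.
  apply: ge0_le_integral_nonmeasurable => t Dt; first exact: u0.
  exact: und.
by near=> m; exact: hM.
Unshelve. all: by end_near. Qed.

End LineIntegral.

Section PointwiseBound.
Context {R : realType} {X : completeMetricType R}.

(** Because [M < N], a truncated infimum of at most [M] is nearly attained by genuine chains. Their
    steps shrink with [m], so [chain_limit_curve] applies to them. *)
Lemma chain_dist_bounds_oscillation (u : X -> R) (rho0 rho : X -> \bar R)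
    (h : nat -> X -> R) (c0 N M : R) (x y : X) :
  balls_totally_bounded (X := X) -> 0 < c0 -> 0 <= N ->
  upper_gradient u rho0 -> (forall z, (rho0 z <= rho z)%E) ->
  (forall m z, c0 <= h m z) ->
  (forall m m' z, (m <= m')%N -> h m z <= h m' z) ->
  (forall m z w, `|h m z - h m w| <= m.+1%:R * mdist z w) ->
  (forall z (r : R), (r%:E < rho z)%E -> exists m, r <= h m z) ->
  (forall m, chain_dist (h m) m.+1%:R^-1 N x y <= M) -> M < N ->
  `|u x - u y| <= M.
Proof.
move=> tb c00 N0 [_ rho00 ug] rho0rho hc hmono hL hsup vM MN.
have h0 m z : 0 <= h m z := le_trans (ltW c00) (hc m z).
apply/ler_addgt0Pr => e e0.
(* The slack is kept within [N - M], so that [M + e'] stays below the truncation level. *)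
pose e' := Num.min e (N - M).
have e'0 : 0 < e' by rewrite lt_min e0 subr_gt0.
have e'N : M + e' <= N.
  by rewrite addrC -lerBrDr ge_min lexx orbT.
have /choice[c Hc] m : exists c : (nat -> X) * nat,
    chain m.+1%:R^-1 x y c.1 c.2 /\ chain_cost (h m) c.1 c.2 <= M + e'.
  have lt : chain_dist (h m) m.+1%:R^-1 N x y < M + e'.
    by apply: le_lt_trans (vM m) _; rewrite ltrDl.
  by have [c [n [H1 /ltW H2]]] := chain_dist_lt lt e'N; exists (c, n).
have [g [L L0 [rg g0 gL Hg]]] := chain_limit_curve tb c00 (fun m => ler0n R m.+1)
  hc hmono hL (fun i => (Hc i).1) (fun i => (Hc i).2).
have rho1 z : (0 <= rho z)%E := le_trans (rho00 z) (rho0rho z).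
have := line_integral_le_sup L0 rg rho1 h0 hmono hL hsup Hg.
have := ug g 0 L L0 rg; rewrite g0 gL => h1 h2.
have : (`|u x - u y|%:E <= (M + e')%:E)%E.
  apply: le_trans h1 _; apply: le_trans h2.
  by apply: ge0_le_integral_nonmeasurable.
rewrite lee_fin => /le_trans; apply; rewrite lerD2l.
by rewrite ge_min lexx.
Qed.

End PointwiseBound.

(** * Telescoping the Poincare inequality *)

Lemma mball_open (R : realType) (X : metricType R) (x : X) (r : R) :
  open (ball x r).
Proof.
rewrite openE => y; rewrite ballEmdist /= => xy.
apply/nbhs_ballP; exists (r - mdist x y); first by rewrite /= subr_gt0.
move=> z; rewrite !ballEmdist/= => yz.
by apply: le_lt_trans (metric_triangle x y z) _; rewrite -ltrBrDl.
Qed.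

Lemma measurable_fun_gt (R : realType) d (T : measurableType d) (f : T -> R) :
  (forall a : R, measurable [set x | a < f x]) -> measurable_fun setT f.
Proof.
move=> H; apply: (measurability (RGenOInfty.G (R := R))).
  exact: RGenOInfty.measurableE.
move=> _ [_ [a ->] <-]; rewrite setTI.
by have -> : f @^-1` `]a, +oo[ = [set x | a < f x];
  [apply/seteqP; split => x /=; rewrite in_itv/= andbT|].
Qed.

Lemma emeasurable_fun_gt (R : realType) d (T : measurableType d) (f : T -> \bar R) :
  (forall a : R, measurable [set x | (a%:E < f x)%E]) -> measurable_fun setT f.
Proof.
move=> H; apply: (measurability (ErealGenOInfty.G (R := R))).
  exact: ErealGenOInfty.measurableE.
move=> _ [_ [a ->] <-]; rewrite setTI.
by have -> : f @^-1` `]a%:E, +oo[ = [set x | (a%:E < f x)%E];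
  [apply/seteqP; split => x /=; rewrite in_itv/= andbT|].
Qed.

Lemma continuous_gt_open (R : realType) (X : topologicalType) (f : X -> R) (a : R) :
  continuous f -> open [set x | a < f x].
Proof.
move=> cf; have -> : [set x | a < f x] = f @^-1` [set r | a < r] by [].
by move/continuousP : cf; apply; exact: open_gt.
Qed.

Section BorelMeasurability.
Context {R : realType} {X : pointedMetricType R}.
Context (mu : {outer_measure set X -> \bar R}).
Context (bmu : borel_set `<=` mu.-caratheodory).

Lemma open_borel (A : set X) : open A -> borel_set A.
Proof. exact: sub_sigma_algebra. Qed.

Lemma borel_caratheodory (A : set X) :
  borel_set A -> measurable (A : set (caratheodory_type mu)).
Proof. exact: bmu. Qed.

Lemma mball_measurable (x : X) r :
  measurable (ball x r : set (caratheodory_type mu)).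
Proof. by apply: borel_caratheodory; apply: open_borel; exact: mball_open. Qed.

Lemma continuous_caratheodory (f : X -> R) : continuous f ->
  measurable_fun setT (f : caratheodory_type mu -> R).
Proof.
move=> cf; apply: measurable_fun_gt => a; apply: borel_caratheodory.
by apply: open_borel; exact: continuous_gt_open.
Qed.

Lemma continuous_borel_fun (f : X -> R) : continuous f ->
  borel_fun (fun x => (f x)%:E).
Proof.
move=> cf; apply: emeasurable_fun_gt => a.
suff : borel_set [set x | a < f x] by [].
by apply: open_borel; exact: continuous_gt_open.
Qed.

Lemma borel_fun_caratheodory (rho : X -> \bar R) : borel_fun rho ->
  measurable_fun setT (rho : caratheodory_type mu -> \bar R).
Proof.
move=> mrho _ Y mY; rewrite setTI; apply: borel_caratheodory.
by have := mrho measurableT Y mY; rewrite setTI.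
Qed.

Lemma lsc_caratheodory (rho : X -> \bar R) :
  (forall a : R, open [set x | (a%:E < rho x)%E]) ->
  measurable_fun setT (rho : caratheodory_type mu -> \bar R).
Proof.
move=> lsc; apply: emeasurable_fun_gt => a; apply: borel_caratheodory.
exact: open_borel.
Qed.

End BorelMeasurability.

Section PoincareTelescoping.
Context {R : realType} {X : completeMetricType R}.
Context (mu : {outer_measure set X -> \bar R}) (Q p CQ C lam : R).
Context (bmu : borel_set `<=` mu.-caratheodory)
  (p1 : 1 <= p) (CQ1 : 1 <= CQ) (C0 : 0 < C) (lam1 : 1 <= lam).
Context (ahlfors : forall (x : X) (r : R), 0 < r ->
  ((r `^ Q / CQ)%:E <= mu (ball x r))%E /\
  (mu (ball x r) <= (CQ * r `^ Q)%:E)%E).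
Context (poin : forall (u : X -> R) (rho : X -> \bar R),
  (forall (x : X) (r : R), 0 < r -> integrable_on mu (ball x r) u) ->
  upper_gradient u rho ->
  forall (x : X) (r : R), 0 < r ->
    (average mu (ball x r) (fun y => `|u y - mean mu (ball x r) u|%:E)
     <= (C * r)%:E *
        average mu (ball x (lam * r)) (fun y => rho y `^ p) `^ p^-1)%E).

Let m (x : X) (r : R) := fine (mu (ball x r)).

Lemma ahlfors_fin (x : X) r : 0 < r -> mu (ball x r) = (m x r)%:E.
Proof.
move=> r0; rewrite /m fineK//; have [h1 h2] := ahlfors x r0.
by rewrite ge0_fin_numE ?outer_measure_ge0// (le_lt_trans h2)// ltry.
Qed.

Lemma ahlfors_ge (x : X) r : 0 < r -> r `^ Q / CQ <= m x r.
Proof. by move=> r0; have [h _] := ahlfors x r0; rewrite -lee_fin -ahlfors_fin. Qed.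

Lemma ahlfors_le (x : X) r : 0 < r -> m x r <= CQ * r `^ Q.
Proof. by move=> r0; have [_ h] := ahlfors x r0; rewrite -lee_fin -ahlfors_fin. Qed.

Lemma ahlfors_gt0 (x : X) r : 0 < r -> 0 < m x r.
Proof.
move=> r0; apply: lt_le_trans (ahlfors_ge x r0).
by rewrite divr_gt0 ?powR_gt0// (lt_le_trans _ CQ1).
Qed.

Lemma bounded_integrable_on (v : X -> R) (N : R) x r : 0 < r ->
  measurable_fun setT (v : caratheodory_type mu -> R) ->
  (forall y, 0 <= v y <= N) -> integrable_on mu (ball x r) v.
Proof.
move=> r0 mv vN; apply: measurable_bounded_integrable.
- exact: mball_measurable.
- by rewrite /= ahlfors_fin// ltry.
- exact: measurable_funTS.
- exists N; split; first exact: num_real.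
  move=> M NM y _ /=; have /andP[v0 v1] := vN y.
  by rewrite ger0_norm// (le_trans v1)// ltW.
Qed.

Lemma mean_integral (v : X -> R) x r : 0 < r -> integrable_on mu (ball x r) v ->
  (\int[measure_of mu]_(y in ball x r) (v y)%:E =
   (m x r * mean mu (ball x r) v)%:E)%E.
Proof.
move=> r0 iv; rewrite /mean /average -/(m x r).
have /fineK <- := integrable_fin_num (mball_measurable bmu x r) iv.
rewrite -EFinM /= mulrA mulfV ?mul1r// gt_eqF//; exact: ahlfors_gt0.
Qed.

(* By Ahlfors regularity, a bound at radius [r] on the right-hand side of the
   Poincare inequality for a function of energy [a] on [ball x (lam * r)], up to
   the factor [C]. *)
Definition riesz_term (r a : R) := r * (CQ * (lam * r) `^ (- Q) * a) `^ p^-1.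

(** The first factor bounds the ratio of the measures of [ball x r] and [ball x (r / 2)]; [C] is the
    Poincare constant. *)
Let K0 := CQ ^+ 2 / (2^-1 `^ Q) * C.

(** The difference of the two means is at most the mean of [|v - c|] over the half ball. Enlarging
    the domain of integration to the full ball costs the ratio of the measures and makes the
    Poincare inequality applicable. *)
Lemma mean_halving (v h : X -> R) (N a : R) x r : 0 < r ->
  continuous v -> continuous h ->
  (forall y, 0 <= v y <= N) -> (forall y, 0 <= h y) ->
  upper_gradient v (EFin \o h) ->
  (\int[measure_of mu]_(y in ball x (lam * r)) (h y)%:E `^ p <= a%:E)%E ->
  `|mean mu (ball x (r / 2)) v - mean mu (ball x r) v| <= K0 * riesz_term r a.
Proof.
move=> r0 cv ch vN h0 ug Ha.
have r20 : 0 < r / 2 by rewrite divr_gt0.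
have lr0 : 0 < lam * r by rewrite mulr_gt0// (lt_le_trans _ lam1).
have CQ0 : 0 < CQ by exact: lt_le_trans CQ1.
have pV0 : 0 <= p^-1 by rewrite invr_ge0 (le_trans _ p1).
have mv := continuous_caratheodory bmu cv.
have iv y s : 0 < s -> integrable_on mu (ball y s) v.
  by move=> s0; exact: bounded_integrable_on s0 mv vN.
set c := mean mu (ball x r) v; set b := mean mu (ball x (r / 2)) v.
set A := ball x r; set B := ball x (r / 2).
have mA : measurable (A : set (caratheodory_type mu)) by exact: mball_measurable.
have mB : measurable (B : set (caratheodory_type mu)) by exact: mball_measurable.
have BA : B `<=` A.
  by apply: le_ball; move: r0; lra.
have mvc : measurable_fun setT ((fun y => v y - c) : caratheodory_type mu -> R).
  by apply: measurable_funB => //; exact: measurable_cst.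
have ivc : (measure_of mu).-integrable A (EFin \o (fun y => v y - c)).
  have -> : EFin \o (fun y => v y - c) = ((EFin \o v) \- cst c%:E)%E.
    by apply/funext => y /=; rewrite EFinB.
  apply: integrableB => //; first exact: iv.
  apply: measurable_bounded_integrable => //.
    by rewrite /= ahlfors_fin// ltry.
  exact: bounded_cst.
have iabs : (measure_of mu).-integrable A (fun y => `|v y - c|%:E).
  by have := integrable_abse ivc.
pose i := fine (\int[measure_of mu]_(y in A) `|v y - c|%:E)%E.
have iE : (\int[measure_of mu]_(y in A) `|v y - c|%:E)%E = i%:E.
  by rewrite /i fineK//; exact: integrable_fin_num.
have i0 : 0 <= i by rewrite -lee_fin -iE; apply: integral_ge0 => y _; rewrite lee_fin.
have hB : `|b - c| * m x (r / 2) <= i.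
  have ivB := iv x (r / 2) r20.
  have intB : (\int[measure_of mu]_(y in B) (v y - c)%:E =
      ((b - c) * m x (r / 2))%:E)%E.
    under eq_integral do rewrite EFinB.
    rewrite (@integralB_EFin _ (caratheodory_type mu) _ (measure_of mu) B v (fun=> c))//; last first.
      apply: measurable_bounded_integrable => //.
        by rewrite /= ahlfors_fin// ltry.
      exact: bounded_cst.
    rewrite mean_integral// integral_cst//= ahlfors_fin// -EFinM -EFinB.
    by congr EFin; rewrite -/b; ring.
  rewrite -lee_fin -iE.
  have -> : (`|b - c| * m x (r / 2))%:E = `|(b - c) * m x (r / 2)|%:E.
    by rewrite normrM (gtr0_norm (ahlfors_gt0 x r20)).
  rewrite -[X in (X <= _)%E]abse_EFin -intB.
  apply: le_trans (le_abse_integral _ mB _) _.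
    by apply/measurable_EFinP; exact: measurable_funTS.
  apply: (ge0_subset_integral (measure_of mu) mB mA (f := fun y => `|v y - c|%:E)) => //.
  exact: measurable_int iabs.
have hA : i <= m x r * (C * riesz_term r a).
  have := poin iv ug x r0; rewrite -/c -/A /average iE.
  have mlr := ahlfors_gt0 x lr0.
  rewrite -/(m x r) -/(m x (lam * r)) => H.
  have a0 : 0 <= a.
    rewrite -lee_fin; apply: le_trans Ha; apply: integral_ge0 => y _.
    exact: poweR_ge0.
  have H2 : ((m x (lam * r))^-1%:E * \int[measure_of mu]_(y in ball x (lam * r))
        ((h y)%:E `^ p) <= (CQ * (lam * r) `^ (- Q) * a)%:E)%E.
    rewrite EFinM; apply: lee_pmul => //.
    - by rewrite lee_fin invr_ge0 ltW.
    - by apply: integral_ge0 => y _; exact: poweR_ge0.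
    - rewrite lee_fin powRN -[CQ]invrK -invfM lef_pV2 ?posrE//; last first.
        by rewrite mulr_gt0 ?powR_gt0// invr_gt0.
      by rewrite mulrC; exact: ahlfors_ge.
  have H3 : (((m x r)^-1 * i)%:E <= (C * r * (CQ * (lam * r) `^ (- Q) * a) `^ p^-1)%:E)%E.
    rewrite EFinM; apply: le_trans H _; rewrite [leRHS]EFinM.
    apply: lee_wpmul2l; first by rewrite lee_fin mulr_ge0// ltW.
    rewrite -poweR_EFin; apply: gt0_ler_poweR => //.
    - rewrite in_itv/= leey andbT; apply: mule_ge0.
        by rewrite lee_fin invr_ge0 ltW.
      by apply: integral_ge0 => y _; rewrite lee_fin powR_ge0.
    - by rewrite in_itv/= leey andbT lee_fin !mulr_ge0 ?powR_ge0// ltW.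
  move: H3; rewrite lee_fin ler_pdivrMl ?ahlfors_gt0//.
  by rewrite /riesz_term mulrA.
have T0 : 0 <= riesz_term r a by rewrite mulr_ge0 ?powR_ge0// ltW.
have := le_trans hB hA; rewrite -ler_pdivlMr ?ahlfors_gt0// => /le_trans; apply.
rewrite ler_pdivrMr ?ahlfors_gt0//.
rewrite [K0 * _ * _]mulrAC /K0.
have h1 := ahlfors_le x r0.
have h2 := ahlfors_ge x r20.
rewrite (_ : _ / _ * C * m x (r / 2) * riesz_term r a =
  (CQ ^+ 2 / 2^-1 `^ Q * m x (r / 2)) * (C * riesz_term r a)); last by ring.
have CT0 : 0 <= C * riesz_term r a := mulr_ge0 (ltW C0) T0.
rewrite ler_wpM2r//.
apply: le_trans h1 _.
rewrite powRM ?invr_ge0 ?(ltW r0)// in h2.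
have e0 : 0 < 2^-1 `^ Q :> R by rewrite powR_gt0.
have -> : CQ * r `^ Q = CQ ^+ 2 / (2^-1 `^ Q) * (r `^ Q * 2^-1 `^ Q / CQ).
  by field; rewrite !gt_eqF.
by rewrite ler_wpM2l// divr_ge0// ?sqr_ge0// ltW.
Qed.

Lemma mean_chain (v h : X -> R) (N : R) (a : nat -> R) x r n : 0 < r ->
  continuous v -> continuous h ->
  (forall y, 0 <= v y <= N) -> (forall y, 0 <= h y) ->
  upper_gradient v (EFin \o h) ->
  (forall j, (\int[measure_of mu]_(y in ball x (lam * (r / 2 ^+ j)))
     (h y)%:E `^ p <= (a j)%:E)%E) ->
  mean mu (ball x r) v <= mean mu (ball x (r / 2 ^+ n)) v +
    K0 * \sum_(j < n) riesz_term (r / 2 ^+ j) (a j).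
Proof.
move=> r0 cv ch vN h0 ug Ha; elim: n => [|n IH].
  by rewrite big_ord0 mulr0 addr0 expr0 divr1.
have rn0 : 0 < r / 2 ^+ n by rewrite divr_gt0// exprn_gt0.
have := mean_halving rn0 cv ch vN h0 ug (Ha n).
have -> : r / 2 ^+ n / 2 = r / 2 ^+ n.+1 by rewrite exprS; field.
rewrite big_ord_recr/= ler_norml; move: IH; lra.
Qed.

(** Since [v] vanishes at [x] at a linear rate, the last mean of the telescoping tends to 0; [n] is
    chosen to make the smallest ball fit in the region of linear growth with mean at most [e]. *)
Lemma mean_bound (v h : X -> R) (N S H : R) (a : nat -> R) x r : 0 < r ->
  continuous v -> continuous h ->
  (forall y, 0 <= v y <= N) -> (forall y, 0 <= h y) ->
  upper_gradient v (EFin \o h) ->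
  (\forall y \near x, v y <= H * mdist x y) ->
  (forall j, (\int[measure_of mu]_(y in ball x (lam * (r / 2 ^+ j)))
     (h y)%:E `^ p <= (a j)%:E)%E) ->
  (forall n, \sum_(j < n) riesz_term (r / 2 ^+ j) (a j) <= S) ->
  mean mu (ball x r) v <= K0 * S.
Proof.
move=> r0 cv ch vN h0 ug vH Ha HS; apply/ler_addgt0Pr => e e0.
have K00 : 0 <= K0.
  by rewrite /K0 mulr_ge0 ?(ltW C0)// divr_ge0 ?sqr_ge0 ?powR_ge0.
move/nbhs_ballP : vH => [d /= d0 Hd].
pose M := Num.max (r / d) (r * (`|H| + 1) / e).
pose n := (Num.truncn M).+1.
have Mn : M < 2 ^+ n.
  by apply: lt_trans (truncnS_gt M) _; rewrite -natrX ltr_nat ltn_expl.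
move: Mn; rewrite gt_max => /andP[n1 n2].
have p20 : 0 < 2 ^+ n :> R by rewrite exprn_gt0.
have rn0 : 0 < r / 2 ^+ n by rewrite divr_gt0.
have rnd : r / 2 ^+ n <= d.
  by rewrite ler_pdivrMr// mulrC -ler_pdivrMr// ltW.
have rne : (`|H| + 1) * (r / 2 ^+ n) <= e.
  rewrite mulrA ler_pdivrMr//; move: n2; rewrite ltr_pdivrMr// => /ltW.
  by rewrite (mulrC e) (mulrC r).
have := mean_chain n r0 cv ch vN h0 ug Ha.
have : mean mu (ball x (r / 2 ^+ n)) v <= e.
  have mv := continuous_caratheodory bmu cv.
  have iv := bounded_integrable_on x rn0 mv vN.
  have mg := ahlfors_gt0 x rn0.
  rewrite -(ler_pM2l mg) -lee_fin -mean_integral//.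
  rewrite [leRHS](_ : _ = (\int[measure_of mu]_(y in ball x (r / 2 ^+ n)) cst e%:E y)%E).
    apply: ge0_le_integral_nonmeasurable => y xy.
      by rewrite lee_fin; have /andP[] := vN y.
    rewrite lee_fin; apply: le_trans (Hd y _) _.
      by apply: le_ball xy.
    apply: le_trans rne; apply: le_trans (_ : (`|H| + 1) * mdist x y <= _).
      by rewrite ler_wpM2r ?mdist_ge0// (le_trans (ler_norm H))// lerDl.
    rewrite ler_wpM2l// ?addr_ge0// ltW//.
    by move: xy; rewrite ballEmdist.
  rewrite integral_cst; last exact: mball_measurable.
  by rewrite /= ahlfors_fin// -EFinM mulrC.
have : K0 * \sum_(j < n) riesz_term (r / 2 ^+ j) (a j) <= K0 * S.
  by rewrite ler_wpM2l.
by lra.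
Qed.


(** The bound [B] holds for [v N i] uniformly in both indices. Truncation at [N] keeps [v N i]
    bounded, hence integrable on balls. Two monotone limits follow: in [i], where the limit
    dominates the oscillation of [u] truncated at [N], and then in [N]. *)
Lemma integral_oscillation_le (u : X -> R) (rho0 rho : X -> \bar R) (c0 S : R)
    (a : nat -> R) x r :
  balls_totally_bounded (X := X) ->
  measurable_fun setT (u : caratheodory_type mu -> R) ->
  upper_gradient u rho0 -> (forall z, (rho0 z <= rho z)%E) ->
  0 < c0 <= 1 -> (forall z, (c0%:E <= rho z)%E) ->
  (forall t : R, open [set z | (t%:E < rho z)%E]) ->
  0 < r ->
  (forall j, (\int[measure_of mu]_(y in ball x (lam * (r / 2 ^+ j)))
     rho y `^ p <= (a j)%:E)%E) ->
  (forall n, \sum_(j < n) riesz_term (r / 2 ^+ j) (a j) <= S) ->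
  (\int[measure_of mu]_(y in ball x r) `|u x - u y|%:E <=
   (CQ * r `^ Q * (K0 * S))%:E)%E.
Proof.
move=> tb mu_ ug rr c01 rhoc lsc r0 Ha HS.
have [h [hb hmono hL hrho hsup]] := lsc_lipschitz_approx c01 rhoc lsc.
have /andP[c00 _] := c01.
have hc i z : c0 <= h i z by have /andP[] := hb i z.
have h0 i z : 0 <= h i z := le_trans (ltW c00) (hc i z).
have S0 : 0 <= S by have := HS 0%N; rewrite big_ord0.
have K00 : 0 <= K0.
  by rewrite /K0 mulr_ge0 ?(ltW C0)// divr_ge0 ?sqr_ge0 ?powR_ge0.
have d0 i : 0 < i.+1%:R^-1 :> R by rewrite invr_gt0.
have hcont i : continuous (h i).
  move=> y; apply: (@cvg_lipschitz R X _ (nbhs y) id y (h i) i.+1%:R) => //.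
pose v (N i : nat) y := chain_dist (h i) i.+1%:R^-1 N%:R x y.
have vN N i y : 0 <= v N i y <= N%:R.
  by rewrite chain_dist_ge0// chain_dist_leN.
have vc N i : continuous (v N i).
  apply: (@chain_dist_continuous R X (h i) _ _ i.+1%:R) => // z.
  by rewrite h0; have /andP[] := hb i z.
have vug N i : upper_gradient (v N i) (EFin \o h i).
  split.
  - by apply: continuous_borel_fun; exact: hcont.
  - by move=> z; rewrite lee_fin.
  - by move=> g s t st rg; apply: (chain_dist_upper_gradient (m := i.+1%:R)).
have vx N i : \forall y \near x, v N i y <= h i x * mdist x y.
  apply/nbhs_ballP; exists i.+1%:R^-1; first exact: d0.
  move=> y; rewrite ballEmdist/= => /ltW xy.
  have := chain_dist_step x (h0 i) (ler0n R N) xy.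
  by rewrite chain_distxx// add0r.
have pV0 : 0 <= p by exact: le_trans p1.
have hp i j : (\int[measure_of mu]_(y in ball x (lam * (r / 2 ^+ j)))
     (h i y)%:E `^ p <= (a j)%:E)%E.
  apply: le_trans (Ha j); apply: ge0_le_integral_nonmeasurable => y _.
    exact: poweR_ge0.
  apply: gt0_ler_poweR => //; rewrite ?in_itv/= ?leey ?andbT ?lee_fin//.
  by apply: le_trans (hrho i y); rewrite lee_fin.
pose B := CQ * r `^ Q * (K0 * S).
have mv N i := continuous_caratheodory bmu (vc N i).
have intv N i : (\int[measure_of mu]_(y in ball x r) (v N i y)%:E <= B%:E)%E.
  have iv := bounded_integrable_on x r0 (mv N i) (vN N i).
  rewrite mean_integral// lee_fin /B.
  have := mean_bound r0 (vc N i) (hcont i) (vN N i) (h0 i) (vug N i) (vx N i) (hp i) HS.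
  move=> mb; apply: le_trans (_ : m x r * (K0 * S) <= _).
    by rewrite ler_wpM2l// ltW// ahlfors_gt0.
  have KS0 := mulr_ge0 K00 S0.
  by rewrite ler_wpM2r//; exact: ahlfors_le.
have vnd N y : nondecreasing_seq (fun i => (v N i y)%:E).
  move=> i i' ii'; rewrite lee_fin; apply: le_chain_dist => //.
    by move=> z; exact: hmono.
  by rewrite lef_pV2 ?posrE// ler_nat.
have mB := mball_measurable bmu x r.
have intV N : (\int[measure_of mu]_(y in ball x r)
    limn (fun i => (v N i y)%:E) <= B%:E)%E.
  have mvN i : measurable_fun (ball x r : set (caratheodory_type mu))
      (fun y => (v N i y)%:E).
    by apply/measurable_EFinP; apply: measurable_funTS; exact: mv.
  have v0 i (y : caratheodory_type mu) : ball x r y -> (0 <= (v N i y)%:E)%E.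
    by move=> _; rewrite lee_fin; have /andP[] := vN N i y.
  have /cvg_lim <- // := cvg_monotone_convergence (mu := measure_of mu)
    mB mvN v0 (fun y _ => vnd N y).
  apply: lime_le; last by near=> i; exact: intv.
  apply: ereal_nondecreasing_is_cvgn => i i' ii'.
  apply: ge0_le_integral_nonmeasurable => y xy; first exact: v0.
  exact: vnd.
pose w (N : nat) y := (Num.min N%:R `|u x - u y|)%:E.
have wV N y : (w N y <= limn (fun i => (v N i y)%:E))%E.
  rewrite (cvg_lim _ (ereal_nondecreasing_cvgn (vnd N y)))//.
  set V := ereal_sup _.
  have V0 : (0 <= V)%E.
    apply: le_trans (_ : ((v N 0%N y)%:E <= V)%E).
      by rewrite lee_fin; have /andP[] := vN N 0%N y.
    by apply: ereal_sup_ubound; exists 0%N.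
  have VN : (V <= N%:R%:E)%E.
    apply: ge_ereal_sup => _ [i _ <-]; rewrite lee_fin.
    by have /andP[] := vN N i y.
  have Vfin : V \is a fin_num by rewrite ge0_fin_numE// (le_lt_trans VN)// ltry.
  rewrite -(fineK Vfin) lee_fin ge_min; have [//|lt] := leP N%:R (fine V).
  rewrite /=.
  apply: (chain_dist_bounds_oscillation tb c00 (ler0n R N) ug rr hc hmono hL hsup _ lt).
  move=> i; rewrite -lee_fin fineK//; apply: ereal_sup_ubound; exists i => //.
have wB N : (\int[measure_of mu]_(y in ball x r) w N y <= B%:E)%E.
  apply: le_trans (intV N); apply: ge0_le_integral_nonmeasurable => y _ //.
  by rewrite lee_fin le_min ler0n normr_ge0.
have wnd y : nondecreasing_seq (fun N => w N y).
  move=> N N' NN'; rewrite lee_fin le_min !ge_min lexx orbT andbT.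
  by rewrite ler_nat NN'.
have mw N : measurable_fun (ball x r : set (caratheodory_type mu)) (w N).
  apply/measurable_EFinP; apply: measurable_funTS.
  apply: measurable_minr; first exact: measurable_cst.
  apply: measurableT_comp => //; apply: measurable_funB => //.
have w0 N (y : caratheodory_type mu) : ball x r y -> (0 <= w N y)%E.
  by move=> _; rewrite lee_fin le_min ler0n normr_ge0.
have -> : (\int[measure_of mu]_(y in ball x r) `|u x - u y|%:E =
    \int[measure_of mu]_(y in ball x r) limn (fun N => w N y))%E.
  apply: eq_integral => y _; apply/esym/cvg_lim => //.
  apply: cvg_near_cst; near=> N; rewrite /w; congr EFin.
  apply/min_idPr; near: N; exact: nbhs_infty_ger.
have /cvg_lim <- // := cvg_monotone_convergence (mu := measure_of mu)
    mB mw w0 (fun y _ => wnd y).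
apply: lime_le; last by near=> i; exact: wB.
apply: ereal_nondecreasing_is_cvgn => i i' ii'.
apply: ge0_le_integral_nonmeasurable => y xy; first exact: w0.
exact: wnd.
Unshelve. all: by end_near. Qed.

End PoincareTelescoping.

(** * Packing and outer regularity *)

Section Packing.
Context {R : realType} {X : completeMetricType R}.
Context (mu : {outer_measure set X -> \bar R}).
Context (bmu : borel_set `<=` mu.-caratheodory).

Lemma disjoint_balls_sum (nu : {measure set (caratheodory_type mu) -> \bar R})
    (A : set X) (r : R) (s : seq X) :
  uniq s -> measurable (A : set (caratheodory_type mu)) ->
  (forall z, z \in s -> ball z r `<=` A) ->
  (forall z w, z \in s -> w \in s -> z != w -> ball z r `&` ball w r = set0) ->
  (\sum_(z <- s) nu (ball z r) <= nu A)%E.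
Proof.
elim: s A => [|z s IH] A; first by rewrite big_nil.
move=> /= /andP[zs us] mA sA sD; rewrite big_cons.
have mz := mball_measurable bmu z r.
rewrite (measureDI nu mA mz) addeC; apply: leeD.
  apply: IH => //; first exact: measurableD.
  - move=> w ws y wy; split.
      by apply: (sA w); rewrite // in_cons ws orbT.
    move=> zy; have : (ball z r `&` ball w r) y by split.
    rewrite sD ?mem_head// ?in_cons ?ws ?orbT//.
    by apply: contraNneq zs => ->.
  - by move=> w y ws ys; apply: sD; rewrite in_cons ?ws ?ys orbT.
apply: le_measure; rewrite ?inE//; first exact: measurableI.
by move=> y zy; split => //; apply: (sA z) => //; rewrite mem_head.
Qed.

(** Each disjoint ball takes at least [m] out of the mass [F], so a family of largest cardinality
    exists; a point of [P] outside the doubled balls would enlarge it. *)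
Lemma finite_packing (nu : {measure set (caratheodory_type mu) -> \bar R})
    (P A : set X) (r m F : R) :
  0 < r -> 0 < m -> measurable (A : set (caratheodory_type mu)) ->
  (nu A <= F%:E)%E ->
  (forall z, P z -> ball z r `<=` A /\ (m%:E <= nu (ball z r))%E) ->
  exists s : seq X, [/\ forall z, z \in s -> P z, (size s)%:R * m <= F &
    P `<=` \bigcup_(z in [set` s]) ball z (2 * r)].
Proof.
move=> r0 m0 mA nuA HP.
pose adm (s : seq X) := [/\ uniq s, forall z, z \in s -> P z &
  forall z w, z \in s -> w \in s -> z != w -> ball z r `&` ball w r = set0].
have bnd s : adm s -> (size s)%:R * m <= F.
  move=> [us sP sD]; rewrite -lee_fin; apply: le_trans nuA.
  have sA z : z \in s -> ball z r `<=` A by move=> /sP /HP[].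
  apply: le_trans (disjoint_balls_sum nu us mA sA sD).
  have -> : ((size s)%:R * m)%:E = (\sum_(z <- s) m%:E)%E.
    by rewrite sumEFin big_const_seq count_predT iter_addr_0 mulr_natl.
  rewrite big_seq [leRHS]big_seq; apply: lee_sum => z /sP /HP[_]//.
pose B := (Num.truncn (F / m)).+1.
have bnd' s : adm s -> (size s <= B)%N.
  move=> /bnd; rewrite -ler_pdivlMr// => h; rewrite -(ler_nat R).
  by apply: le_trans h _; apply: ltW; exact: truncnS_gt.
have ex : exists k, `[< exists s, adm s /\ size s = k >].
  by exists 0%N; apply/asboolP; exists [::].
have ub k : `[< exists s, adm s /\ size s = k >] -> (k <= B)%N.
  by move=> /asboolP[s [/bnd' + <-]].
have [k /asboolP[s [ads sk]] kmax] := ex_maxnP ex ub.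
have [us sP sD] := ads.
exists s; split => //; first exact: bnd.
move=> y Py; apply: contrapT => ny.
have far z : z \in s -> 2 * r <= mdist z y.
  move=> zs; rewrite leNgt; apply/negP => lt; apply: ny; exists z => //.
  by rewrite ballEmdist.
have ys : y \notin s.
  by apply/negP => /far; rewrite mdistxx; apply/negP; rewrite -ltNge mulr_gt0.
have dis z : z \in s -> ball z r `&` ball y r = set0.
  move=> /far zy; apply/seteqP; split => // w []; rewrite !ballEmdist/= => h1 h2.
  have := metric_triangle z w y; rewrite (metric_sym w y) => h3.
  by have : mdist z y < 2 * r; [lra|rewrite ltNge zy].
have : (k.+1 <= k)%N.
  apply: kmax; apply/asboolP; exists (y :: s); split; last by rewrite /= sk.
  split; first by rewrite /= ys.
    by move=> z; rewrite in_cons => /predU1P[->|/sP].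
  move=> z w; rewrite !in_cons => /predU1P[->|zs] /predU1P[->|ws] zw.
  - by rewrite eqxx in zw.
  - by rewrite setIC dis.
  - exact: dis.
  - exact: sD.
by rewrite ltnn.
Qed.

Lemma ahlfors_totally_bounded (Q CQ : R) : 0 < CQ ->
  (forall (x : X) (r : R), 0 < r ->
    ((r `^ Q / CQ)%:E <= mu (ball x r))%E /\
    (mu (ball x r) <= (CQ * r `^ Q)%:E)%E) ->
  balls_totally_bounded (X := X).
Proof.
move=> CQ0 H x r e e0.
have [r0|r0] := ltP 0 r; last first.
  exists [::] => y; rewrite ballEmdist/= => /lt_le_trans/(_ r0).
  by rewrite ltNge mdist_ge0.
have e20 : 0 < e / 2 by rewrite divr_gt0.
have [||||s [_ _ sx]] := @finite_packing (measure_of mu) (ball x r)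
  (ball x (r + e / 2)) (e / 2) ((e / 2) `^ Q / CQ) (CQ * (r + e / 2) `^ Q) e20.
- by rewrite divr_gt0// powR_gt0.
- exact: mball_measurable.
- by have [] := H x (r + e / 2) (addr_gt0 r0 e20).
- move=> z; rewrite ballEmdist/= => xz; split; last by have [] := H z _ e20.
  move=> y; rewrite !ballEmdist/= => zy.
  by apply: le_lt_trans (metric_triangle x z y) _; rewrite ltrD.
exists s; apply: subset_trans sx _; rewrite mulrC divfK//.
Qed.

End Packing.

(** * Outer regularity of finite measures *)

Section OuterRegularity.
Context {R : realType} {X : pointedMetricType R}.
Context (mu : {outer_measure set X -> \bar R}).
Context (bmu : borel_set `<=` mu.-caratheodory).
Context (nu : {measure set (caratheodory_type mu) -> \bar R}).
Context (fnu : (nu [set: X] < +oo)%E).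

Definition outer_approximable (A : set X) := forall e : R, 0 < e ->
  exists U : set X, [/\ open U, A `<=` U & (nu (U `\` A) <= e%:E)%E].

Let bm (A : set X) : borel_set A -> measurable (A : set (caratheodory_type mu)).
Proof. exact: borel_caratheodory. Qed.

Let om (A : set X) : open A -> measurable (A : set (caratheodory_type mu)).
Proof. by move=> oA; apply: bm; exact: open_borel. Qed.

Let nufin (A : set X) : measurable (A : set (caratheodory_type mu)) ->
  (nu A < +oo)%E.
Proof.
by move=> mA; apply: le_lt_trans fnu; apply: le_measure; rewrite ?inE.
Qed.

Lemma approximable_excess (A : (set X)^nat) (U : (set X)^nat) (e : R) (D : set X) :
  0 <= e ->
  (forall n, measurable (A n : set (caratheodory_type mu))) ->
  (forall n, open (U n)) ->
  (forall n, (nu (U n `\` A n) <= (e / (2 ^ n.+1)%:R)%:E)%E) ->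
  measurable (D : set (caratheodory_type mu)) ->
  D `<=` \bigcup_n (U n `\` A n) -> (nu D <= e%:E)%E.
Proof.
move=> e0 mA oU H mD DU.
apply: (@le_trans _ _ (\sum_(n <oo) nu (U n `\` A n))%E).
  apply: measure_sigma_subadditive => // n.
  by apply: measurableD => //; exact: om.
apply: le_trans (epsilon_trick0 xpredT e0).
by apply: lee_nneseries => // n _; exact: H.
Qed.

Lemma outer_approximable_bigcup (A : (set X)^nat) :
  (forall n, measurable (A n : set (caratheodory_type mu))) ->
  (forall n, outer_approximable (A n)) -> outer_approximable (\bigcup_n A n).
Proof.
move=> mA HA e e0.
have en n : 0 < e / (2 ^ n.+1)%:R by rewrite divr_gt0// ltr0n expn_gt0.
have /choice[U HU] n := HA n _ (en n).
have oU n : open (U n) by have [] := HU n.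
exists (\bigcup_n U n); split.
- exact: bigcup_open.
- by apply: subset_bigcup => n _; have [] := HU n.
- apply: (approximable_excess (A := A) (U := U)) => //; first exact: ltW.
  + by move=> n; have [] := HU n.
  + by apply: measurableD; [apply: om; exact: bigcup_open|exact: bigcup_measurable].
  + by move=> y [[n _ Uy] nA]; exists n => //; split => // Ay; apply: nA; exists n.
Qed.

(** The intersection of the [U n] need not be open. A finite intersection [G n] replaces it, since
    by finiteness of [nu] the measure of what it contains in excess tends to 0. One half of [e] pays
    for this, the other for the [U n]. *)
Lemma outer_approximable_bigcap (A : (set X)^nat) :
  (forall n, measurable (A n : set (caratheodory_type mu))) ->
  (forall n, outer_approximable (A n)) -> outer_approximable (\bigcap_n A n).
Proof.
move=> mA HA e e0.
have e20 : 0 < e / 2 by rewrite divr_gt0.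
have en n : 0 < e / 2 / (2 ^ n.+1)%:R by rewrite divr_gt0// ltr0n expn_gt0.
have /choice[U HU] n := HA n _ (en n).
have oU n : open (U n) by have [] := HU n.
have mU n := om (oU n).
pose G n := \bigcap_(i < n) U i.
have oG n : open (G n).
  elim: n => [|n IH]; first by rewrite /G bigcap_mkord big_ord0; exact: openT.
  rewrite /G bigcap_mkord big_ord_recr/= -bigcap_mkord.
  exact: openI.
have mG n := om (oG n).
have Gcap : \bigcap_n G n = \bigcap_n U n.
  apply/seteqP; split => y Hy n _.
    by have := Hy n.+1 I; apply => /=.
  by move=> i _; exact: Hy.
have mGU : measurable (\bigcap_n U n : set (caratheodory_type mu)).
  exact: bigcap_measurableType.
have mAA : measurable (\bigcap_n A n : set (caratheodory_type mu)).
  exact: bigcap_measurableType.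
have : (fun n => nu (G n `\` \bigcap_n U n)) @ \oo --> 0%E.
  have -> : 0%E = nu (\bigcap_n (G n `\` \bigcap_n U n)).
    suff -> : \bigcap_n (G n `\` \bigcap_n U n) = set0 by rewrite measure0.
    apply/seteqP; split => // y Hy.
    have [_ nU] := Hy 0%N I; apply: nU; rewrite -Gcap => n _.
    by have [] := Hy n I.
  apply: nonincreasing_cvg_mu.
  - by apply: nufin; exact: measurableD.
  - by move=> n; exact: measurableD.
  - by apply: bigcap_measurableType => n _; exact: measurableD.
  - move=> n m nm; apply/subsetPset; apply: setSD => y Hy i /= im.
    by apply: Hy; exact: leq_trans nm.
move=> /fine_cvgP[_ /cvgrPdist_le /(_ _ e20)[n _ /(_ n (leqnn _))]].
rewrite /= sub0r normrN ger0_norm ?fine_ge0// => nG.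
exists (G n); split => //.
  by move=> y Ay i _; have [_ AU _] := HU i; apply: AU; exact: Ay.
have -> : G n `\` \bigcap_n A n =
    (G n `\` \bigcap_n U n) `|` (\bigcap_n U n `\` \bigcap_n A n).
  apply/seteqP; split => y.
    move=> [Gy nA]; have [Uy|nU] := pselect ((\bigcap_n U n) y).
      by right.
    by left.
  move=> [[Gy nU]|[Uy nA]]; split => //.
    by move=> Ay; apply: nU => i _; have [_ AU _] := HU i; apply: AU; exact: Ay.
  by move=> i _; exact: Uy.
apply: le_trans (measureU2 _ _ _) _ => /=; try exact: measurableD.
rewrite [e]splitr EFinD; apply: leeD.
  rewrite -(@fineK _ (nu _)) ?lee_fin// ge0_fin_numE//.
  by apply: nufin; exact: measurableD.
apply: (approximable_excess (A := A) (U := U)) => //; first exact: ltW.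
- by move=> i; have [] := HU i.
- exact: measurableD.
- move=> y [Uy /existsNP[i /not_implyP[_ nA]]]; exists i => //; split => //.
  exact: Uy.
Qed.

(** A closed set is the intersection of its open neighbourhoods of radius [1 / (n + 1)]. *)
Lemma outer_approximable_closed (U : set X) : open U -> outer_approximable (~` U).
Proof.
move=> oU.
pose V n := \bigcup_(y in ~` U) ball y n.+1%:R^-1.
have -> : ~` U = \bigcap_n V n.
  apply/seteqP; split => [y Uy n _|y Vy Uy].
    by exists y => //; apply: ballxx; rewrite invr_gt0.
  have : nbhs y U by apply: open_nbhs_nbhs; split.
  move=> /nbhs_ballP[r /= r0 rU].
  have [z zU zy] := Vy (Num.truncn r^-1) I; apply: zU; apply: rU.
  apply: ball_sym; apply: le_ball zy.
  by rewrite invf_ple ?posrE// ltW// truncnS_gt.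
have oV n : open (V n) by apply: bigcup_open => y _; exact: mball_open.
apply: outer_approximable_bigcap => n; first exact: om.
move=> e e0; exists (V n); split => //.
by rewrite setDv measure0 lee_fin ltW.
Qed.

(** Approximability alone is not visibly stable under complements, so the sigma-algebra consists of
    the sets that are approximable together with their complement. *)
Lemma borel_outer_approximable (A : set X) : borel_set A -> outer_approximable A.
Proof.
move=> bA.
suff : A \in [set A : set X | [/\ measurable (A : set (caratheodory_type mu)),
    outer_approximable A & outer_approximable (~` A)]].
  by rewrite inE => -[].
rewrite inE; apply: bA; split => /=.
- split.
  + split; first exact: measurable0.
      by move=> e e0; exists set0; split; [exact: open0| |rewrite setDv measure0 lee_fin ltW].
    rewrite setC0 => e e0; exists setT; split; [exact: openT| |].
      by [].
    by rewrite setDv measure0 lee_fin ltW.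
  + move=> B [mB oB oCB]; rewrite setTD; split => //; last by rewrite setCK.
    exact: measurableC.
  + move=> B HB; split.
    * by apply: bigcup_measurable => n _; have [] := HB n.
    * by apply: outer_approximable_bigcup => n; have [] := HB n.
    * rewrite setC_bigcup; apply: outer_approximable_bigcap => n; have [mB _ oCB] := HB n => //.
      exact: measurableC.
- move=> U oU; split.
  + exact: om.
  + by move=> e e0; exists U; split => //; rewrite setDv measure0 lee_fin ltW.
  + exact: outer_approximable_closed.
Qed.

End OuterRegularity.

(** * Measures with densities and lower semicontinuous majorants *)

Section Density.
Context d (T : measurableType d) (R : realType) (mu : {measure set T -> \bar R}).
Context (f : T -> \bar R) (mf : measurable_fun setT f) (f0 : forall x, (0 <= f x)%E).

(** Measurability and nonnegativity are arguments so that the measure structure can be attached to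
    this constant. *)
Definition density of measurable_fun setT f & (forall x, (0 <= f x)%E) :=
  fun A : set T => (\int[mu]_(x in A) f x)%E.

Let density0 : density mf f0 set0 = 0%E.
Proof. exact: integral_set0. Qed.

Let density_ge0 A : (0 <= density mf f0 A)%E.
Proof. by apply: integral_ge0 => x _; exact: f0. Qed.

Let density_sigma_additive : semi_sigma_additive (density mf f0).
Proof. exact: semi_sigma_additive_nng_induced. Qed.

HB.instance Definition _ := isMeasure.Build _ _ _ (density mf f0)
  density0 density_ge0 density_sigma_additive.

Definition density_measure : {measure set T -> \bar R} := density mf f0.

End Density.

Lemma nneseries_ge_term (R : realType) (u : nat -> \bar R) n :
  (forall i, (0 <= u i)%E) -> (u n <= \sum_(i <oo) u i)%E.
Proof.
move=> u0; apply: le_trans (nneseries_lim_ge n.+1 _); last by move=> *; exact: u0.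
rewrite big_nat_recr//= leeDr// sume_ge0//.
Qed.

Section VitaliCaratheodory.
Context {R : realType} {X : completeMetricType R}.
Context (mu : {outer_measure set X -> \bar R}) (Q p CQ : R) (O : X).
Context (bmu : borel_set `<=` mu.-caratheodory) (p1 : 1 <= p) (CQ0 : 0 <= CQ).
Context (ahl : forall (x : X) (r : R), 0 < r -> (mu (ball x r) <= (CQ * r `^ Q)%:E)%E).

(* Any exponent greater than [Q] makes [weight] integrable; being at most [1],
   it is then [p]-integrable as well. *)
Let M := (Num.truncn Q).+1.
Definition weight (x : X) : R := (1 + mdist O x)^-1 ^+ M.+1.

Let base_gt0 x : 0 < 1 + mdist O x.
Proof. by rewrite ltr_pwDl// mdist_ge0. Qed.

Lemma weight_gt0 x : 0 < weight x.
Proof. by rewrite exprn_gt0// invr_gt0. Qed.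

Lemma weight_le1 x : weight x <= 1.
Proof.
apply: exprn_ile1; first by rewrite invr_ge0 ltW.
by rewrite invf_le1// lerDl mdist_ge0.
Qed.

Lemma weight_ge t x : 0 <= t -> mdist O x <= t -> (1 + t)^-1 ^+ M.+1 <= weight x.
Proof.
move=> t0 xt; have t1 : 0 < 1 + t by rewrite ltr_pwDl.
apply: lerXn2r; rewrite ?nnegrE ?invr_ge0 ?(ltW (base_gt0 _)) ?(ltW t1)//.
by rewrite lef_pV2 ?posrE// lerD2l.
Qed.

Lemma weight_continuous : continuous weight.
Proof.
move=> x.
apply: (@continuous_comp _ _ _ (fun x => (1 + mdist O x)^-1) (fun t => t ^+ M.+1));
  last exact: exprn_continuous.
apply: cvgV; first by rewrite gt_eqF.
apply: cvgD; first exact: cvg_cst.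
by apply: cvg_mdist; [exact: cvg_cst|exact: cvg_id].
Qed.

(** If [n] is least with [|x| < 2^n], the weight at [x] is at most [c n]; so it is dominated by the
    sum of the constants [c n] on the balls [B n], whose integrals decay geometrically. *)
Lemma weight_integral : (\int[measure_of mu]_x (weight x)%:E < +oo)%E.
Proof.
pose c n : R := 2 ^+ M.+1 * (2 ^+ n)^-1 ^+ M.+1.
pose B n := ball O (2 ^+ n : R).
pose f n : caratheodory_type mu -> \bar R :=
  (cst (c n)%:E) \_ (B n : set (caratheodory_type mu)).
have c0 n : 0 <= c n by rewrite mulr_ge0 ?exprn_ge0// invr_ge0 exprn_ge0.
have mB n : measurable (B n : set (caratheodory_type mu)).
  exact: mball_measurable.
have f0 n y : (0 <= f n y)%E.
  by rewrite /f/patch; case: ifP; rewrite ?lee_fin.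
have mf n : measurable_fun setT (f n).
  by apply/(measurable_restrictT _ (mB n)); exact: measurable_cst.
apply: (@le_lt_trans _ _ (\int[measure_of mu]_x \sum_(n <oo) f n x)%E).
  apply: ge0_le_integral_nonmeasurable => x _.
    by rewrite lee_fin ltW// weight_gt0.
  have ex : exists n, mdist O x < 2 ^+ n.
    exists (Num.truncn (mdist O x)).+1; apply: lt_trans (truncnS_gt _) _.
    by rewrite -natrX ltr_nat ltn_expl.
  have [n xn nmin] := ex_minnP ex.
  apply: le_trans (nneseries_ge_term n (f0^~ x)).
  rewrite /f patchT; last by rewrite inE /B ballEmdist.
  have p2 : 0 < 2 ^+ n :> R by rewrite exprn_gt0.
  rewrite lee_fin /weight /c -exprMn; apply: lerXn2r; rewrite ?nnegrE.
  - by rewrite invr_ge0 ltW.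
  - by rewrite mulr_ge0// invr_ge0 ltW.
  rewrite -[2 / 2 ^+ n]invf_div lef_pV2 ?posrE ?divr_gt0//.
  move: {p2} xn nmin.
  case: n => [|n] xn nmin.
    by rewrite expr0; have := mdist_ge0 O x; lra.
  have : 2 ^+ n <= mdist O x.
    by rewrite leNgt; apply/negP => /nmin; rewrite ltnn.
  by rewrite exprS; lra.
rewrite integral_nneseries//.
(* As [Q <= M], the [n]-th integral is at most [CQ 2^(M+1) / 2^n]; the additional factor 2 matches
   the [2 ^ n.+1] of [epsilon_trick0]. *)
pose e := CQ * 2 ^+ M.+2.
have e0 : 0 <= e by rewrite mulr_ge0// exprn_ge0.
apply: le_lt_trans (ltry e); apply: le_trans (epsilon_trick0 xpredT e0).
apply: lee_nneseries => [n _ _|n _]; first exact: integral_ge0.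
rewrite /f -integral_mkcond integral_cst//=.
have := ahl O (exprn_gt0 n (ltr0Sn R 1)); rewrite -/(B n) => muB.
apply: le_trans (lee_wpmul2l _ muB) _; first by rewrite lee_fin.
rewrite -EFinM lee_fin.
have q1 : (2 ^+ n) `^ Q <= (2 ^+ n : R) ^+ M.
  have h2 : 0 <= 2 ^+ n :> R by rewrite exprn_ge0.
  rewrite -[leRHS](powR_mulrn M h2) ler_powR//; first by rewrite exprn_ege1// ler1n.
  by rewrite ltW// truncnS_gt.
apply: (@le_trans _ _ (c n * (CQ * (2 ^+ n) ^+ M))).
  by rewrite !ler_wpM2l.
have p2 : 0 < 2 ^+ n :> R by rewrite exprn_gt0.
rewrite /c /e natrX le_eqVlt; apply/orP; left; apply/eqP.
rewrite exprVn (exprS (2 ^+ n) M) (exprS 2 M.+1) (exprS 2 n).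
have pM : 0 < (2 ^+ n) ^+ M :> R by rewrite exprn_gt0.
by field; rewrite !gt_eqF.
Qed.

(** The superlevel sets of [rho0] are taken relative to [weight] and enlarged to open sets. Their
    excess is measured by [nu], the finite measure whose density is the [p]-th power of the weight,
    to which outer regularity applies. *)
Lemma vitali_caratheodory (rho0 : X -> \bar R) :
  borel_fun rho0 -> (forall x, (0 <= rho0 x)%E) ->
  (\int[measure_of mu]_x (rho0 x `^ p) < +oo)%E ->
  exists rho : X -> \bar R, [/\ forall x, (rho0 x <= rho x)%E,
    forall x, ((weight x)%:E <= rho x)%E,
    forall a : R, open [set x | (a%:E < rho x)%E] &
    (\int[measure_of mu]_x (rho x `^ p) < +oo)%E].
Proof.
move=> brho0 rho00 int0.
have p0 : 0 <= p by exact: le_trans p1.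
have p0' : 0 < p by exact: lt_le_trans p1.
have wm := continuous_caratheodory bmu weight_continuous.
pose W x := weight x `^ p.
have W0 x : 0 <= W x by exact: powR_ge0.
have Wm : measurable_fun setT ((fun x => (W x)%:E) : caratheodory_type mu -> \bar R).
  apply/measurable_EFinP.
  exact: (measurableT_comp (measurable_powR p) wm).
have W0' (x : caratheodory_type mu) : (0 <= (W x)%:E)%E by rewrite lee_fin.
have intW : (\int[measure_of mu]_x (W x)%:E < +oo)%E.
  apply: le_lt_trans weight_integral.
  apply: ge0_le_integral_nonmeasurable => x _; rewrite lee_fin//.
  by apply: ge1r_powR; rewrite ?weight_gt0 ?weight_le1.
pose nu := density_measure (measure_of mu) Wm W0'.
have fnu : (nu setT < +oo)%E by [].
pose A k := [set x | ((2 ^+ k * weight x)%:E < rho0 x)%E].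
have bA k : borel_set (A k).
  have mw : measurable_fun [set: g_sigma_algebraType (@open X)]
     ((fun x => (2 ^+ k * weight x)%:E) : g_sigma_algebraType (@open X) -> \bar R).
    apply: continuous_borel_fun => x; apply: cvgM; first exact: cvg_cst.
    exact: weight_continuous.
  have := emeasurable_fun_lt measurableT mw brho0.
  by rewrite setTI.
have mA k : measurable (A k : set (caratheodory_type mu)) by apply: bmu.
(* On [U k] the energy density of [rho] receives [c k * W]; dividing by [c k] in the choice of [U k]
   compensates for this. *)
pose c k : R := (2 ^+ k.+1) `^ p.
have c0 k : 0 < c k by rewrite powR_gt0// exprn_gt0.
have /choice[U HU] k : exists U : set X, [/\ open U, A k `<=` U &
    (nu (U `\` A k) <= ((c k)^-1 / (2 ^ k.+1)%:R)%:E)%E].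
  apply: (borel_outer_approximable bmu fnu (bA k)).
  by rewrite divr_gt0 ?invr_gt0// ltr0n expn_gt0.
pose D k := U k `\` A k.
have mU k : measurable (U k : set (caratheodory_type mu)).
  by apply: bmu; apply: open_borel; have [] := HU k.
have mD k : measurable (D k : set (caratheodory_type mu)) by exact: measurableD.
(* Discretizing the values of [rho0] relative to the weight leaves a total
   excess of [\sum_k 2^-(k+1)], even though [mu] itself is infinite. *)
pose rho x := ereal_sup [set t | t = (weight x)%:E \/
  exists2 k, U k x & t = (2 ^+ k.+1 * weight x)%:E].
have rhow x : ((weight x)%:E <= rho x)%E by apply: ereal_sup_ubound; left.
have rhoU k x : U k x -> ((2 ^+ k.+1 * weight x)%:E <= rho x)%E.
  by move=> Ux; apply: ereal_sup_ubound; right; exists k.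
have wk k x : 0 <= 2 ^+ k * weight x.
  by apply: mulr_ge0; [exact: exprn_ge0|rewrite ltW// weight_gt0].
exists rho; split => //.
(* If [rho x < rho0 x], then [x] lies in every [A k]: membership in [A k] puts [rho x], and hence
   [rho0 x], above the next level. So [rho x] would be infinite. *)
- move=> x; rewrite leNgt; apply/negP => lt.
  have rfin : rho x \is a fin_num.
    rewrite ge0_fin_numE; first exact: lt_le_trans lt (leey _).
    by apply: le_trans (rhow x); rewrite lee_fin ltW// weight_gt0.
  have H k : ((2 ^+ k * weight x)%:E < rho0 x)%E.
    elim: k => [|k IH]; first by rewrite expr0 mul1r; exact: le_lt_trans (rhow x) lt.
    apply: le_lt_trans lt; apply: rhoU; have [_ AU _] := HU k; exact: AU.
  have [k Hk] : exists k, fine (rho x) < 2 ^+ k.+1 * weight x.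
    exists (Num.truncn (fine (rho x) / weight x)).+1.
    rewrite -ltr_pdivrMr ?weight_gt0//; apply: lt_trans (truncnS_gt _) _.
    by rewrite -natrX ltr_nat; apply: ltn_trans (ltn_expl _ (ltnSn 1)) _; rewrite ltn_exp2l.
  have : ((2 ^+ k.+1 * weight x)%:E <= rho x)%E.
    by apply: rhoU; have [_ AU _] := HU k; apply: AU; exact: H.
  by rewrite -(fineK rfin) lee_fin leNgt Hk.
- move=> a; have -> : [set x | (a%:E < rho x)%E] =
      [set x | a < weight x] `|`
      \bigcup_k (U k `&` [set x | a < 2 ^+ k.+1 * weight x]).
    apply/seteqP; split => x /=.
      move=> /ereal_sup_gt[_ [->|[k Ux ->]]]; rewrite lte_fin => lt; first by left.
      by right; exists k.
    move=> [lt|[k _ [Ux lt]]].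
      by apply: lt_le_trans (rhow x); rewrite lte_fin.
    by apply: lt_le_trans (rhoU k x Ux); rewrite lte_fin.
  apply: openU; first exact: continuous_gt_open weight_continuous.
  apply: bigcup_open => k _; apply: openI; first by have [] := HU k.
  apply: (@continuous_gt_open R X (fun x => 2 ^+ k.+1 * weight x)) => x.
  apply: cvgM; first exact: cvg_cst.
  exact: weight_continuous.
- pose f k : caratheodory_type mu -> \bar R :=
    (fun x => (c k * W x)%:E) \_ (D k : set (caratheodory_type mu)).
  have mcW k : measurable_fun setT ((fun x => (c k * W x)%:E) : caratheodory_type mu -> \bar R).
    by apply/measurable_EFinP; apply: measurable_funM => //; exact/measurable_EFinP.
  have f0 k y : (0 <= f k y)%E.
    by rewrite /f/patch; case: ifP; rewrite ?lee_fin ?mulr_ge0// ltW.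
  have mf k : measurable_fun setT (f k).
    apply/(measurable_restrictT _ (mD k)); exact: measurable_funTS.
  have mr0 : measurable_fun setT ((fun x => (rho0 x `^ p)%E) : caratheodory_type mu -> \bar R).
    exact: (measurableT_comp (measurable_poweR p) (borel_fun_caratheodory bmu brho0)).
  (* The summands match the sources of [rho]: the weight, the levels with [x] in [A k], where the
     value is below [2 * rho0 x], and the levels with [x] in the excess [D k]. *)
  pose F x : \bar R := ((W x)%:E + ((2 `^ p)%:E * (rho0 x `^ p) + \sum_(k <oo) f k x))%E.
  have F2 x : (0 <= (2 `^ p)%:E * (rho0 x `^ p))%E.
    by apply: mule_ge0; [rewrite lee_fin powR_ge0|exact: poweR_ge0].
  have F3 x : (0 <= \sum_(k <oo) f k x)%E by apply: nneseries_ge0 => k _ _.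
  have F0 x : (0 <= F x)%E by apply: adde_ge0 => //; exact: adde_ge0.
  have le1 x : ((2 `^ p)%:E * (rho0 x `^ p) <= F x)%E.
    by apply: le_trans (leeDr _ _) => //; rewrite leeDl.
  have step x : (rho x <= F x `^ p^-1)%E.
    have FK (t : \bar R) : (0 <= t)%E -> (t `^ p <= F x)%E -> (t <= F x `^ p^-1)%E.
      move=> t0 tF; rewrite -[t]poweRe1// -[1](mulfV (lt0r_neq0 p0')) poweRrM.
      by apply: gt0_ler_poweR; rewrite ?invr_ge0// in_itv/= leey andbT// poweR_ge0.
    apply: ge_ereal_sup => _ [->|[k Ux ->]]; apply: FK.
    + by rewrite lee_fin ltW// weight_gt0.
    + by rewrite poweR_EFin -/(W x) leeDl// adde_ge0.
    + by rewrite lee_fin.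
    + have [Ax|nAx] := pselect (A k x).
        apply: le_trans (le1 x); rewrite exprS -mulrA EFinM poweRM ?lee_fin//.
        rewrite poweR_EFin; apply: lee_wpmul2l; first by rewrite lee_fin powR_ge0.
        apply: gt0_ler_poweR => //; rewrite ?in_itv/= ?leey ?andbT//.
          by rewrite lee_fin.
        exact: ltW.
      apply: (@le_trans _ _ (\sum_(k <oo) f k x)%E); last first.
        by apply: le_trans (leeDr _ _) => //; rewrite leeDr.
      apply: le_trans (nneseries_ge_term k (f0^~ x)).
      rewrite /f patchT; last by rewrite inE; split.
      have h2 : 0 <= 2 ^+ k.+1 :> R by rewrite exprn_ge0.
      by rewrite poweR_EFin (powRM _ h2 (ltW (weight_gt0 x))).
  apply: (@le_lt_trans _ _ (\int[measure_of mu]_x F x)%E).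
    apply: ge0_le_integral_nonmeasurable => x _; first exact: poweR_ge0.
    rewrite -[F x]poweRe1// -[in leRHS](mulVf (lt0r_neq0 p0')) poweRrM.
    apply: gt0_ler_poweR => //; rewrite ?in_itv/= ?leey ?andbT ?poweR_ge0//.
    by apply: le_trans (rhow x); rewrite lee_fin ltW// weight_gt0.
  rewrite /F ge0_integralD//; first last.
  - apply: emeasurable_funD; last exact: ge0_emeasurable_sum.
    exact: emeasurable_funM.
  - by move=> x _; exact: adde_ge0.
  rewrite ge0_integralD//; first last.
  - exact: ge0_emeasurable_sum.
  - exact: emeasurable_funM.
  have := ge0_integralZl_EFin (measure_of mu) measurableT
    (fun x _ => poweR_ge0 (rho0 x) p) mr0 (powR_ge0 2 p).
  move=> ->.
  apply: lte_add_pinfty => //; apply: lte_add_pinfty.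
    by apply: lte_mul_pinfty => //; rewrite lee_fin powR_ge0.
  rewrite integral_nneseries//.
  apply: le_lt_trans (ltry 1); apply: le_trans (epsilon_trick0 xpredT ler01).
  apply: lee_nneseries => [k _ _|k _]; first exact: integral_ge0.
  rewrite /f -integral_mkcond.
  under eq_integral do rewrite EFinM.
  have mWD : measurable_fun (D k : set (caratheodory_type mu)) (fun x => (W x)%:E).
    exact: measurable_funTS.
  have -> := ge0_integralZl_EFin (measure_of mu) (mD k) (fun x _ => W0' x) mWD
    (ltW (c0 k)).
  have [_ _ h] := HU k.
  have ck : (0 <= (c k)%:E)%E by rewrite lee_fin ltW.
  apply: le_trans (lee_wpmul2l ck h) _; rewrite -EFinM mulrA mulfV ?gt_eqF// mul1r.
Qed.

End VitaliCaratheodory.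

Lemma gt1_ltr_powR (R : realType) (a x y : R) : 1 < a -> x < y -> a `^ x < a `^ y.
Proof.
move=> a1 xy; have a0 : 0 < a by exact: lt_trans a1.
have -> : a `^ y = a `^ x * a `^ (y - x).
  rewrite -powRD; first by rewrite addrC subrK.
  by apply/implyP => _; rewrite gt_eqF.
rewrite ltr_pMr ?powR_gt0//; apply: (@le_lt_trans _ _ (1 `^ (y - x))).
  by rewrite powR1.
by apply: gt0_ltr_powR; rewrite ?subr_gt0// nnegrE// ltW.
Qed.

(** * Hausdorff content and thin sets *)

Section HausdorffContent.
Context {R : realType} {X : pointedMetricType R}.
Implicit Types (E G : set X).

Lemma hausdorff_content_ge0 (beta : R) E : (0 <= hausdorff_content beta E)%E.
Proof.
apply: le_ereal_inf_tmp => _ [D [x [r [_ _ ->]]]].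
by apply: esum_ge0 => k _; rewrite lee_fin powR_ge0.
Qed.

(** The content admits a single family of balls indexed by naturals, so the pairs of a scale and a
    position in its list are coded by [pickle]. *)
Lemma hausdorff_content_bigcup (E : set X) (z : nat -> seq X) (rad v : nat -> R)
    (b : R) :
  (forall j, 0 < rad j) ->
  (forall x, E x -> exists j w, w \in z j /\ ball w (rad j) x) ->
  (forall j, (size (z j))%:R * rad j `^ b <= v j) ->
  (hausdorff_content b E <= \sum_(j <oo) (v j)%:E)%E.
Proof.
move=> rad0 cover Hv.
pose P := [set: nat] `*`` (fun j => `I_(size (z j))).
pose dec (n : nat) : nat * nat := odflt (0, 0)%N (unpickle n).
have decK ji : dec (pickle ji) = ji by rewrite /dec pickleK.
apply: (@le_trans _ _ (\esum_(n in pickle @` P) (rad (dec n).1 `^ b)%:E)%E).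
  apply: ereal_inf_lbound; exists (pickle @` P).
  exists (fun n => nth point (z (dec n).1) (dec n).2), (fun n => rad (dec n).1).
  split => // x /cover[j [w [wz wx]]].
  exists (pickle (j, index w (z j))).
    by exists (j, index w (z j)) => //; split => //=; rewrite index_mem.
  by rewrite decK /= nth_index.
have bij : set_bij P (pickle @` P) (@pickle (nat * nat)%type).
  by apply: inj_bij => x y _ _; exact: (pcan_inj pickleK).
rewrite (@reindex_esum R _ _ P (pickle @` P) (@pickle (nat * nat)%type) _ bij).
under eq_esum do rewrite decK.
rewrite /P -(@esum_esum _ _ _ _ _ (fun j _ => (rad j `^ b)%:E)); last first.
  by move=> *; rewrite lee_fin powR_ge0.
rewrite -nneseries_esumT; last first.
  by move=> j; apply: esum_ge0 => i _; rewrite lee_fin powR_ge0.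
apply: lee_nneseries => [j _ _|j _].
  by apply: esum_ge0 => i _; rewrite lee_fin powR_ge0.
rewrite esum_fset//; last by move=> *; rewrite lee_fin powR_ge0.
rewrite -fsbig_ord sumEFin lee_fin big_const_ord iter_addr_0.
by rewrite -mulr_natl.
Qed.

(** In a cover of [s]-sum less than [h] every radius is at most [h^(1/s)], which bounds [r^Q] by
    [h^((Q-s)/s) r^s]. *)
Lemma measure_le_content (mu : {outer_measure set X -> \bar R}) (Q CQ s h : R) G :
  0 < s -> s <= Q -> 0 <= CQ -> 0 < h ->
  (forall (x : X) (r : R), 0 < r -> (mu (ball x r) <= (CQ * r `^ Q)%:E)%E) ->
  (hausdorff_content s G < h%:E)%E ->
  (mu G <= (CQ * h `^ (Q / s))%:E)%E.
Proof.
move=> s0 sQ CQ0 h0 ahl /ereal_inf_lt[_ [D [x [r [r0 GD ->]]]] sumh].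
have rs k : D k -> r k `^ s < h.
  move=> Dk; rewrite -lte_fin; apply: le_lt_trans sumh.
  apply: esum_ge; exists [set k]; first by split => // _ ->.
  by rewrite fsbig_set1.
have rh k : D k -> r k <= h `^ s^-1.
  move=> Dk; have rk0 := ltW (r0 k Dk).
  rewrite -[r k]powRr1// -(mulfV (lt0r_neq0 s0)) powRrM.
  apply: ge0_ler_powR; rewrite ?nnegrE ?powR_ge0 ?invr_ge0 ?(ltW s0) ?(ltW h0)//.
  exact: ltW (rs k Dk).
pose B k := if k \in D then ball (x k) (r k) else set0.
pose e := h `^ ((Q - s) / s).
have e0 : 0 <= e by exact: powR_ge0.
have muB k : D k -> (mu (ball (x k) (r k)) <= (CQ * e * r k `^ s)%:E)%E.
  move=> Dk; apply: le_trans (ahl _ _ (r0 k Dk)) _.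
  rewrite lee_fin -mulrA ler_wpM2l//.
  have -> : r k `^ Q = r k `^ (Q - s) * r k `^ s.
    rewrite -powRD ?subrK//; apply/implyP => _.
    by rewrite gt_eqF// r0.
  rewrite ler_wpM2r ?powR_ge0//.
  rewrite /e mulrC powRrM; apply: ge0_ler_powR; rewrite ?nnegrE ?powR_ge0 ?subr_ge0//.
    by rewrite ltW// r0.
  exact: rh.
apply: (@le_trans _ _ (mu (\bigcup_k B k))).
  apply: le_outer_measure => y /GD[k Dk ky]; exists k => //.
  by rewrite /B; case: ifPn => [//|/negP]; rewrite inE.
apply: le_trans (outer_measure_sigma_subadditive mu B) _.
apply: (@le_trans _ _ ((CQ * e)%:E * \esum_(k in D) (r k `^ s)%:E)%E); last first.
  apply: (@le_trans _ _ ((CQ * e)%:E * h%:E)%E).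
    by apply: lee_wpmul2l; [rewrite lee_fin mulr_ge0|exact: ltW].
  rewrite -EFinM lee_fin -mulrA ler_wpM2l// /e.
  rewrite -{2}[h](powRr1 (ltW h0)) -powRD; last by apply/implyP => _; rewrite gt_eqF.
  by rewrite mulrBl mulfV ?gt_eqF// subrK.
rewrite esum_mkcond -nneseries_esumT; last first.
  by move=> k; case: ifP => // _; rewrite lee_fin powR_ge0.
rewrite -nneseriesZl; last by move=> k _; case: ifP => // _; rewrite lee_fin powR_ge0.
apply: lee_nneseries => [k _ _|k _]; first exact: outer_measure_ge0.
rewrite /B; case: ifPn => [|_]; last by rewrite outer_measure0 mule0.
by rewrite inE => Dk; rewrite -EFinM; exact: muB.
Qed.

End HausdorffContent.

Lemma summable_weights (R : realType) (F : nat -> R) (B : R) :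
  (forall k, 0 <= F k) -> (forall n, \sum_(k < n) F k <= B) ->
  exists e : nat -> R, exists B' : R, [/\ forall k, 0 < e k, e @ \oo --> (0 : R) &
    forall n, \sum_(k < n) F k / e k <= B'].
Proof.
move=> F0 FB.
pose S n := \sum_(k < n) F k.
have Snd : nondecreasing_seq S.
  by apply/nondecreasing_seqP => n; rewrite /S big_ord_recr/= lerDl.
have Sub : has_ubound (range S) by exists B => _ [n _ <-]; exact: FB.
have Scv := nondecreasing_cvgn Snd Sub.
set L := sup (range S) in Scv.
have SL n : S n <= L by apply: ub_le_sup => //; exists n.
(* With [a] the square root of the tail, [F n / a n <= 2 (a n - a (n + 1))]; the
   term [1 / (n + 1)] only serves to make the weights positive. *)
pose a n := Num.sqrt (L - S n).
have a0 n : 0 <= a n by exact: sqrtr_ge0.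
have aa n : a n ^+ 2 = L - S n by rewrite sqr_sqrtr ?subr_ge0.
have aS n : a n.+1 <= a n.
  by rewrite ler_wsqrtr// lerD2l lerN2 Snd.
have Fa n : F n = a n ^+ 2 - a n.+1 ^+ 2.
  by rewrite !aa /S big_ord_recr/=; ring.
have i0 n : 0 < n.+1%:R^-1 :> R by rewrite invr_gt0.
exists (fun n => a n + n.+1%:R^-1), (2 * a 0%N); split.
- by move=> k; rewrite ltr_wpDl.
- rewrite -[X in _ --> X]addr0; apply: cvgD; last exact: cvg_harmonic.
  rewrite -[X in _ --> X](@sqrtr0 R).
  apply: (@cvg_comp _ _ _ (fun n => L - S n) Num.sqrt \oo (nbhs 0));
    last exact: sqrt_continuous.
  rewrite -(subrr L); apply: cvgB => //; exact: cvg_cst.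
- move=> n; apply: (@le_trans _ _ (2 * (a 0%N - a n))); last first.
    by rewrite ler_wpM2l// gerBl.
  elim: n => [|n IH]; first by rewrite big_ord0 subrr mulr0.
  rewrite big_ord_recr/=.
  suff : F n / (a n + n.+1%:R^-1) <= 2 * (a n - a n.+1) by move: IH; lra.
  rewrite ler_pdivrMr ?ltr_wpDl// Fa subr_sqr.
  have d0 : 0 <= a n - a n.+1 by rewrite subr_ge0.
  rewrite [2 * _]mulrC -mulrA ler_wpM2l//.
  by move: (aS n) (i0 n); move: (a n) (a n.+1) (n.+1%:R^-1) => *; lra.
Qed.

(** * Volume growth of thin sets *)

Section ThinMeasure.
Context {R : realType} {X : pointedMetricType R}.
Context (mu : {outer_measure set X -> \bar R}) (Q p CQ : R) (O : X).
Context (p1 : 1 <= p) (pQ : p < Q) (CQ1 : 1 <= CQ).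
Context (ahl : forall (x : X) (r : R), 0 < r ->
  ((r `^ Q / CQ)%:E <= mu (ball x r))%E /\ (mu (ball x r) <= (CQ * r `^ Q)%:E)%E).

(** Any value in [(0, p)] would serve: [alpha * (Q / s) < Q] means [alpha < s], that is, [p < Q]. *)
Let alpha := p / 2.
Let s := Q - (p - alpha).
Let b : R := 2 `^ (alpha * (Q / s)).

(** Far out the terms of the thinness series are at most 1, so the content of [E] in the annulus of
    radius [a j] is at most [(a j)^alpha]; [measure_le_content] turns this into a volume of order
    [b ^+ j]. *)
Lemma thin_measure_growth (E : set X) : thin O Q p E ->
  exists K : R, forall n, (mu (E `&` ball O (2 ^+ n)) <= (K * b ^+ n)%:E)%E.
Proof.
move=> [C C1 thinE].
have p0 : 0 < p by exact: lt_le_trans p1.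
have al0 : 0 < alpha by rewrite divr_gt0.
have alp : alpha < p by rewrite /alpha; move: p0; lra.
have s0 : 0 < s by rewrite /s; move: alp pQ al0; lra.
have sQ : s <= Q by rewrite /s; move: alp; lra.
have CQ0 : 0 <= CQ by exact: le_trans CQ1.
have C0 : 0 < C by exact: lt_le_trans C1.
have b1 : 1 < b.
  rewrite /b -[ltLHS](powRr0 2); apply: gt1_ltr_powR; first by rewrite ltr1n.
  by rewrite mulr_gt0// divr_gt0// (lt_trans p0).
have muQ x r : 0 < r -> (mu (ball x r) <= (CQ * r `^ Q)%:E)%E.
  by move=> r0; have [] := ahl x r0.
pose a n : R := C * 2 ^+ n.+1.
have a0 n : 0 < a n by rewrite mulr_gt0// exprn_gt0.
have := thinE alpha; rewrite al0 alp => /(_ isT).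
rewrite -/s; pose term j := (hausdorff_content s (E `&` annulus O (a j)) *
  ((a j `^ alpha)^-1)%:E)%E.
move=> cv; have {}cv : (\sum_(k <= j <oo) term j)%E @[k --> \oo] --> 0%E by [].
have term0 j : (0 <= term j)%E.
  by rewrite mule_ge0 ?hausdorff_content_ge0// lee_fin invr_ge0 powR_ge0.
have [k0 Hk0] : exists k0, forall j, (k0 <= j)%N -> (term j <= 1)%E.
  move/fine_cvgP : cv => [fin /cvgrPdist_le /(_ 1 ltr01)] H.
  have [k0 _ Hk] := filterI fin H.
  exists k0 => j kj; have [/= h1 h2] := Hk _ (leqnn k0).
  apply: (@le_trans _ _ (\sum_(k0 <= j <oo) term j)%E).
    apply: le_trans (nneseries_lim_ge j.+1 _); last by move=> *; exact: term0.
    by rewrite big_nat_recr//= leeDr// sume_ge0.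
  rewrite -(fineK h1) lee_fin; move: h2; rewrite sub0r normrN ger0_norm//.
  by apply: fine_ge0; apply: nneseries_ge0.
pose K3 := CQ * (2 * a 0%N `^ alpha) `^ (Q / s).
have shell j : (k0 <= j)%N ->
    (mu (E `&` annulus O (a j)) <= (K3 * b ^+ j)%:E)%E.
  move=> kj; have aj0 : 0 < a j `^ alpha by exact: powR_gt0.
  have hc : (hausdorff_content s (E `&` annulus O (a j)) < (2 * a j `^ alpha)%:E)%E.
    apply: (@le_lt_trans _ _ (a j `^ alpha)%:E); last by rewrite lte_fin; lra.
    have := Hk0 j kj; rewrite /term -/(a j) => h.
    by rewrite -[leRHS]mul1e -lee_pdivrMr.
  apply: le_trans (measure_le_content s0 sQ CQ0 _ muQ hc) _.
    by rewrite mulr_gt0.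
  rewrite lee_fin /K3 -mulrA ler_wpM2l//.
  have -> : a j = a 0%N * 2 ^+ j by rewrite /a exprS expr1; ring.
  have p2 : 0 <= 2 ^+ j :> R by rewrite exprn_ge0.
  rewrite (powRM _ (ltW (a0 0%N)) p2) mulrA.
  rewrite (powRM (Q / s)) ?mulr_ge0 ?powR_ge0//.
  rewrite ler_wpM2l ?powR_ge0// -powRrM /b.
  by rewrite -powR_mulrn// powRAC powR_mulrn ?powR_ge0.
have K30 : 0 <= K3 by rewrite mulr_ge0// powR_ge0.
(* The first summand absorbs the shells before [k0]; the second gives [K3 <= K * (b - 1)], which
   closes the induction when a shell is added. *)
pose K := CQ * a k0 `^ Q + K3 / (b - 1).
have b0 : 0 < b - 1 by rewrite subr_gt0.
have K0 : 0 <= K by rewrite addr_ge0// ?mulr_ge0 ?powR_ge0// invr_ge0 ltW.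
have bn n : 1 <= b ^+ n by rewrite exprn_ege1// ltW.
exists K => n.
apply: (@le_trans _ _ (mu (E `&` ball O (a n)))).
  apply: le_outer_measure; apply: setIS; apply: le_ball.
  rewrite /a exprS mulrA ler_peMl ?exprn_ge0//.
  by move: C1; lra.
elim: n => [|n IH].
  apply: (@le_trans _ _ (mu (ball O (a k0)))).
    apply: le_outer_measure => y [_]; apply: le_ball.
    by rewrite /a ler_wpM2l ?(ltW C0)// ler_eXn2l ?ltr1n.
  apply: le_trans (muQ _ _ (a0 k0)) _; rewrite lee_fin expr0 mulr1 lerDl.
  by rewrite mulr_ge0// invr_ge0 ltW.
have [nk|kn] := ltnP n k0.
  apply: (@le_trans _ _ (mu (ball O (a k0)))).
    apply: le_outer_measure => y [_]; apply: le_ball.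
    by rewrite /a ler_wpM2l ?(ltW C0)// ler_eXn2l ?ltr1n.
  apply: le_trans (muQ _ _ (a0 k0)) _; rewrite lee_fin.
  apply: (@le_trans _ _ (K * 1)); last by rewrite ler_wpM2l.
  by rewrite mulr1 lerDl mulr_ge0// invr_ge0 ltW.
have an : a n.+1 = 2 * a n by rewrite /a (exprS 2 n.+1); ring.
apply: (@le_trans _ _ (mu ((E `&` ball O (a n)) `|` (E `&` annulus O (a n))))).
  apply: le_outer_measure => y [Ey yn].
  have [h|h] := pselect (ball O (a n) y); first by left.
  by right; split => //; split => //; rewrite -an.
apply: le_trans (outer_measureU2 mu _ _) _.
apply: le_trans (leeD IH (shell n kn)) _.
rewrite -EFinD lee_fin -mulrDl exprS mulrA ler_wpM2r//.
  by apply: le_trans (bn n).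
have : K3 <= K * (b - 1).
  rewrite /K mulrDl divfK ?gt_eqF// lerDr !mulr_ge0 ?powR_ge0// ltW//.
by lra.
Qed.

(** Serves uniqueness with two different sets and, with [E1 = E2], provides points of the complement
    arbitrarily far out, without which the limit would be vacuous. *)
Lemma thin_cofinal (E1 E2 : set X) (T : R) : thin O Q p E1 -> thin O Q p E2 ->
  exists x, [/\ T < mdist O x, ~ E1 x & ~ E2 x].
Proof.
move=> /thin_measure_growth[K1 H1] /thin_measure_growth[K2 H2].
have p0 : 0 < p by exact: lt_le_trans p1.
have Q0 : 0 < Q by exact: lt_trans pQ.
have s0 : 0 < s by rewrite /s /alpha; move: p0 pQ; lra.
have CQ0 : 0 < CQ by exact: lt_le_trans CQ1.
apply: contrapT => H.
pose T' := `|T| + 1.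
have T'0 : 0 < T' by rewrite ltr_wpDl.
have cov n : ball O (2 ^+ n) `<=`
    ball O T' `|` ((E1 `&` ball O (2 ^+ n)) `|` (E2 `&` ball O (2 ^+ n))).
  move=> x xn; apply: contrapT => nx; apply: H; exists x; split.
  - rewrite ltNge; apply/negP => xT; apply: nx; left.
    rewrite ballEmdist/=; apply: le_lt_trans xT _.
    by rewrite /T' (le_lt_trans (ler_norm T))// ltrDl.
  - by move=> e1; apply: nx; right; left.
  - by move=> e2; apply: nx; right; right.
pose B : R := 2 `^ Q.
have bB : b < B.
  apply: gt1_ltr_powR; first by rewrite ltr1n.
  rewrite mulrCA gtr_pMr// ltr_pdivrMr// mul1r /s /alpha.
  by move: p0 pQ; lra.
have b1 : 1 <= b.
  rewrite /b -[leLHS](powRr0 2) ler_powR ?ler1n//.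
  by rewrite mulr_ge0 ?divr_ge0 ?(ltW p0) ?(ltW Q0) ?(ltW s0).
have b0 : 0 < b by exact: lt_le_trans b1.
pose K := CQ * (CQ * T' `^ Q + `|K1| + `|K2|).
have key n : (B / b) ^+ n <= K.
  have h : ((2 ^+ n) `^ Q / CQ <= CQ * T' `^ Q + (K1 * b ^+ n + K2 * b ^+ n)).
    have [h _] := ahl O (exprn_gt0 n (ltr0Sn R 1)).
    rewrite -lee_fin; apply: le_trans h _.
    apply: le_trans (le_outer_measure mu _ _ (cov n)) _.
    apply: le_trans (outer_measureU2 mu _ _) _.
    rewrite EFinD; apply: leeD; first by have [] := ahl O T'0.
    apply: le_trans (outer_measureU2 mu _ _) _.
    by rewrite EFinD; apply: leeD.
  have bn : 1 <= b ^+ n by rewrite exprn_ege1.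
  have bn0 : 0 < b ^+ n by rewrite exprn_gt0.
  have e1 : (2 ^+ n) `^ Q = B ^+ n.
    by rewrite /B -powR_mulrn// powRAC powR_mulrn ?powR_ge0.
  rewrite e1 ler_pdivrMr// in h.
  rewrite expr_div_n ler_pdivrMr//; apply: le_trans h _.
  rewrite /K mulrC -mulrA ler_wpM2l ?(ltW CQ0)// !mulrDl -addrA lerD//.
    by rewrite ler_peMr// mulr_ge0 ?(ltW CQ0) ?powR_ge0.
  by rewrite lerD// ler_wpM2r ?(ltW bn0)// ler_norm.
have Bb : 1 < B / b by rewrite ltr_pdivlMr// mul1r.
have d0 : 0 < B / b - 1 by rewrite subr_gt0.
have bern n : n%:R * (B / b - 1) <= (B / b) ^+ n.
  elim: n => [|n IH]; first by rewrite mul0r expr0.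
  rewrite exprS -natr1.
  have : 1 <= (B / b) ^+ n by rewrite exprn_ege1// ltW.
  move: IH d0; move: (B / b) => t; move: (t ^+ n) => y; move: (n%:R : R) => m.
  nra.
have := le_trans (bern (Num.truncn (K / (B / b - 1))).+1) (key _).
rewrite -ler_pdivlMr// leNgt; apply/negP; rewrite negbK.
exact: truncnS_gt.
Qed.

End ThinMeasure.

(** * Behaviour at infinity *)

Lemma le_hausdorff_content (R : realType) (X : pointedMetricType R) (b : R)
    (E G : set X) :
  E `<=` G -> (hausdorff_content b E <= hausdorff_content b G)%E.
Proof.
move=> EG; apply: ereal_inf_le_tmp => _ [D [x [r [r0 GD ->]]]].
by exists D, x, r; split => //; exact: subset_trans GD.
Qed.

Lemma nneseries_le_bound (R : realType) (v : nat -> R) (V : R) :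
  (forall j, 0 <= v j) -> (forall n, \sum_(j < n) v j <= V) ->
  (\sum_(j <oo) (v j)%:E <= V%:E)%E.
Proof.
move=> v0 vV; apply: lime_le; first by apply: is_cvg_nneseries => *; rewrite lee_fin.
by apply: nearW => n; rewrite sumEFin lee_fin big_mkord.
Qed.

Lemma sum_geometric_le (R : realType) (b : R) n : 0 <= b < 1 ->
  \sum_(j < n) b ^+ j <= (1 - b)^-1.
Proof.
move=> /andP[b0 b1]; have b1' : 0 < 1 - b by rewrite subr_gt0.
rewrite -[leRHS]mul1r ler_pdivlMr//.
have -> : (\sum_(j < n) b ^+ j) * (1 - b) = 1 - b ^+ n.
  elim: n => [|n IH]; first by rewrite big_ord0 mul0r expr0 subrr.
  by rewrite big_ord_recr/= mulrDl IH exprS; ring.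
by rewrite gerBl exprn_ge0.
Qed.

Lemma powR_exprn (R : realType) (a x : R) n : 0 <= a ->
  (a ^+ n) `^ x = (a `^ x) ^+ n.
Proof.
by move=> a0; rewrite -powR_mulrn// powRAC powR_mulrn ?powR_ge0.
Qed.

Section LimitAtInfinity.
Context {R : realType} {X : completeMetricType R}.
Context (mu : {outer_measure set X -> \bar R}) (Q p CQ C lam : R) (O : X).
Context (bmu : borel_set `<=` mu.-caratheodory)
  (p1 : 1 <= p) (pQ : p < Q) (CQ1 : 1 <= CQ) (C0 : 0 < C) (lam1 : 1 <= lam).
Context (ahlfors : forall (x : X) (r : R), 0 < r ->
  ((r `^ Q / CQ)%:E <= mu (ball x r))%E /\
  (mu (ball x r) <= (CQ * r `^ Q)%:E)%E).
Context (poin : forall (u : X -> R) (rho : X -> \bar R),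
  (forall (x : X) (r : R), 0 < r -> integrable_on mu (ball x r) u) ->
  upper_gradient u rho ->
  forall (x : X) (r : R), 0 < r ->
    (average mu (ball x r) (fun y => `|u y - mean mu (ball x r) u|%:E)
     <= (C * r)%:E *
        average mu (ball x (lam * r)) (fun y => rho y `^ p) `^ p^-1)%E).
Context (u : X -> R) (rho0 rho : X -> \bar R).
Context (mu_u : measurable_fun setT (u : caratheodory_type mu -> R))
  (ug : upper_gradient u rho0) (rr : forall z, (rho0 z <= rho z)%E)
  (wrho : forall z, ((weight Q O z)%:E <= rho z)%E)
  (lsc : forall a : R, open [set z | (a%:E < rho z)%E])
  (int_rho : (\int[measure_of mu]_x (rho x `^ p) < +oo)%E).

Let p0 : 0 < p. Proof. exact: lt_le_trans p1. Qed.
Let Q0 : 0 < Q. Proof. exact: lt_trans pQ. Qed.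
Let CQ0 : 0 < CQ. Proof. exact: lt_le_trans CQ1. Qed.
Let lam0 : 0 < lam. Proof. exact: lt_le_trans lam1. Qed.
Let tb : balls_totally_bounded (X := X).
Proof. exact: ahlfors_totally_bounded ahlfors. Qed.

Lemma energy_measurable : measurable_fun setT
  ((fun x => rho x `^ p)%E : caratheodory_type mu -> \bar R).
Proof.
exact: (measurableT_comp (measurable_poweR p) (lsc_caratheodory bmu lsc)).
Qed.

Lemma energy_ge0 (x : caratheodory_type mu) : (0 <= rho x `^ p)%E.
Proof. exact: poweR_ge0. Qed.

Definition energy := density_measure (measure_of mu) energy_measurable energy_ge0.

Definition ball_energy (x : X) (s : R) : R := fine (energy (ball x s)).
Definition total_energy : R := fine (energy setT).

Let mb (x : X) r : measurable (ball x r : set (caratheodory_type mu)).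
Proof. exact: mball_measurable. Qed.

Lemma energy_fin (A : set X) : measurable (A : set (caratheodory_type mu)) ->
  (energy A < +oo)%E.
Proof.
move=> mA; apply: le_lt_trans int_rho.
by apply: (le_measure energy); rewrite ?inE.
Qed.

Lemma ball_energyE x s : energy (ball x s) = (ball_energy x s)%:E.
Proof.
rewrite /ball_energy fineK// ge0_fin_numE; first exact: energy_fin.
exact: measure_ge0.
Qed.

Lemma ball_energy_ge0 x s : 0 <= ball_energy x s.
Proof. by rewrite -lee_fin -ball_energyE measure_ge0. Qed.

Lemma ball_energy_le x s : ball_energy x s <= total_energy.
Proof.
rewrite -lee_fin -ball_energyE /total_energy fineK; last first.
  by rewrite ge0_fin_numE ?measure_ge0//; exact: energy_fin.
by apply: (le_measure energy); rewrite ?inE.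
Qed.

Lemma ball_energy_mono x s t : s <= t -> ball_energy x s <= ball_energy x t.
Proof.
move=> st; rewrite -lee_fin -!ball_energyE.
by apply: (le_measure energy); rewrite ?inE//; exact: le_ball.
Qed.

Let rterm := riesz_term Q p CQ lam.

(** [rho] has no uniform positive lower bound, but on [ball x (lam * r)] the weight provides one,
    [c0]. Replacing [rho] by its maximum with [c0] changes none of the energies that enter the
    sum. *)
Lemma oscillation_riesz (S : R) x r : 0 < r ->
  (forall n, \sum_(j < n) rterm (r / 2 ^+ j) (ball_energy x (lam * (r / 2 ^+ j))) <= S) ->
  (\int[measure_of mu]_(y in ball x r) `|u x - u y|%:E <=
   (CQ * r `^ Q * (CQ ^+ 2 / 2^-1 `^ Q * C * S))%:E)%E.
Proof.
move=> r0 HS.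
pose t := mdist O x + lam * r.
have t0 : 0 <= t by rewrite addr_ge0 ?mdist_ge0// mulr_ge0// ltW.
have t1 : 0 < 1 + t by rewrite ltr_pwDl.
pose c0 := (1 + t)^-1 ^+ (Num.truncn Q).+2.
have c00 : 0 < c0 by rewrite exprn_gt0// invr_gt0.
have c01 : c0 <= 1.
  apply: exprn_ile1; first by rewrite invr_ge0 ltW.
  by rewrite invf_le1// lerDl.
have crho y : ball x (lam * r) y -> (c0%:E <= rho y)%E.
  rewrite ballEmdist/= => xy; apply: le_trans (wrho y); rewrite lee_fin.
  apply: weight_ge => //; apply: le_trans (metric_triangle O x y) _.
  by rewrite lerD2l ltW.
apply: (integral_oscillation_le bmu p1 CQ1 C0 lam1 ahlfors poin tb mu_u ug
  (rho := fun y => Order.max (rho y) c0%:E) _ (c0 := c0)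
  (a := fun j => ball_energy x (lam * (r / 2 ^+ j)))) => //.
- by move=> z; rewrite le_max rr.
- by rewrite c00 c01.
- by move=> z; rewrite le_max lexx orbT.
- move=> a; have [ac|ca] := ltP a c0.
    rewrite (_ : [set z | _] = setT); first exact: openT.
    by apply/seteqP; split => // z _ /=; rewrite lt_max lte_fin ac orbT.
  rewrite (_ : [set z | _] = [set z | (a%:E < rho z)%E]) //.
  have ca' : (a < c0) = false by apply/negbTE; rewrite -leNgt.
  by apply/seteqP; split => z /=; rewrite lt_max lte_fin ca' orbF.
- move=> j; rewrite -ball_energyE.
  suff -> : (\int[measure_of mu]_(y in ball x (lam * (r / 2 ^+ j)))
    Order.max (rho y) c0%:E `^ p = energy (ball x (lam * (r / 2 ^+ j))))%E by [].
  apply: eq_integral => y; rewrite inE => yB; congr (_ `^ p)%E.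
  apply/max_idPl/crho; apply: le_ball yB.
  rewrite ler_wpM2l ?(ltW lam0)// ler_pdivrMr ?exprn_gt0// ler_peMr ?(ltW r0)//.
  by rewrite exprn_ege1// ler1n.
Qed.

(** Half the inner radius of the shell: a ball of this radius [S] centred in the shell stays between
    the radii [S] and [8 S] around [O]. *)
Definition shell_radius (k : nat) : R := 2 ^+ k / 2.
(** The division by [lam] makes the dilated balls, whose energy is taken, have radius
    [shell_radius k / 2^j]. *)
Definition shell_riesz (k j : nat) x : R :=
  rterm (shell_radius k / lam / 2 ^+ j)
    (ball_energy x (lam * (shell_radius k / lam / 2 ^+ j))).
Definition in_shell (k : nat) x := 2 ^+ k <= mdist O x < 2 ^+ k.+1.

Definition bad_shell (k : nat) (e : R) : set X :=
  [set x | in_shell k x /\ exists n, e < \sum_(j < n) shell_riesz k j x].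

Definition shell_energy (k : nat) : R :=
  ball_energy O (shell_radius k.+3) - ball_energy O (shell_radius k).

Lemma shell_radius_gt0 k : 0 < shell_radius k.
Proof. by rewrite divr_gt0// exprn_gt0. Qed.

Lemma shell_radius3 k : shell_radius k.+3 = 8 * shell_radius k.
Proof. by rewrite /shell_radius !exprS; ring. Qed.

Lemma shell_energy_ge0 k : 0 <= shell_energy k.
Proof.
rewrite subr_ge0 ball_energy_mono// shell_radius3.
by have := shell_radius_gt0 k; lra.
Qed.

(** Each annulus spans three consecutive dyadic ones, hence telescoping with overlap 3. *)
Lemma shell_energy_sum n : \sum_(k < n) shell_energy k <= 3 * total_energy.
Proof.
pose g k := ball_energy O (shell_radius k).
have -> : \sum_(k < n) shell_energy k =
    g n + g n.+1 + g n.+2 - (g 0%N + g 1%N + g 2%N).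
  elim: n => [|n IH]; first by rewrite big_ord0 subrr.
  by rewrite big_ord_recr/= IH /shell_energy -/(g n) -/(g n.+3); ring.
have gl k : g k <= total_energy by exact: ball_energy_le.
have g0 k : 0 <= g k by exact: ball_energy_ge0.
by have := gl n; have := gl n.+1; have := gl n.+2; have := g0 0%N;
   have := g0 1%N; have := g0 2%N; lra.
Qed.

(** The threshold [e] is split into parts [eta j] of ratio [q], so a bad point has energy at least
    [m j] at some scale [sj j]. Packing at that scale gives content of order
    [shell_energy k * (sj j)^s / m j]. Its factor [(sj j)^alpha] decays like [b^(2j)]; half of this
    decay pays for [q^(-jp)], which is [b^(-j)], and the other half makes the sum over [j]
    converge. *)
Lemma bad_shell_content (alpha : R) : 0 < alpha < p ->
  exists2 K : R, 0 <= K & forall (k : nat) (e : R), 0 < e ->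
    (hausdorff_content (Q - (p - alpha)) (bad_shell k e) <=
     (K * (2 ^+ k) `^ alpha * (shell_energy k / e `^ p))%:E)%E.
Proof.
move=> /andP[al0 alp].
pose s := Q - (p - alpha); rewrite -/s.
have h0 : 0 < 2^-1 :> R by rewrite invr_gt0.
have h1 : 2^-1 < 1 :> R by rewrite invf_lt1// ltr1n.
pose q : R := 2^-1 `^ (alpha / 2 / p).
pose b : R := 2^-1 `^ (alpha / 2).
have powlt (x : R) : 0 < x -> 0 < 2^-1 `^ x < 1.
  move=> x0; rewrite powR_gt0//=.
  apply: (@lt_le_trans _ _ (1 `^ x)); last by rewrite powR1.
  by apply: gt0_ltr_powR => //; rewrite nnegrE ltW.
have /andP[q0 q1] : 0 < q < 1 by apply: powlt; rewrite !divr_gt0.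
have /andP[b0 b1] : 0 < b < 1 by apply: powlt; rewrite divr_gt0.
have qp : q `^ p = b by rewrite /q -powRrM divfK ?gt_eqF.
have bb : 2^-1 `^ alpha = b * b.
  rewrite /b -powRD; last by apply/implyP => _; rewrite gt_eqF.
  by rewrite -splitr.
have q1' : 0 < 1 - q by rewrite subr_gt0.
have b1' : 0 < 1 - b by rewrite subr_gt0.
pose K := 2 `^ s * CQ / (lam * (1 - q)) `^ p / (1 - b).
have K0 : 0 <= K.
  by rewrite /K !mulr_ge0 ?invr_ge0 ?powR_ge0 ?(ltW CQ0) ?(ltW b1').
exists K => // k e e0.
set S := shell_radius k; have S0 : 0 < S := shell_radius_gt0 k.
pose sj j : R := S / 2 ^+ j.
have sj0 j : 0 < sj j by rewrite divr_gt0// exprn_gt0.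
pose eta j : R := e * (1 - q) * q ^+ j.
have eta0 j : 0 < eta j by rewrite !mulr_gt0// exprn_gt0.
(* The energy for which the Riesz term at scale [sj j] equals [eta j]. *)
pose m j : R := sj j `^ Q * (lam * eta j / sj j) `^ p / CQ.
have le0 j : 0 < lam * eta j / sj j by rewrite divr_gt0// mulr_gt0.
have m0 j : 0 < m j by rewrite divr_gt0// mulr_gt0// powR_gt0.
have lamsj j : lam * (S / lam / 2 ^+ j) = sj j.
  by rewrite /sj; field; rewrite gt_eqF ?exprn_gt0// gt_eqF.
pose A := ball O (shell_radius k.+3) `\` ball O S.
have mA : measurable (A : set (caratheodory_type mu)) by exact: measurableD.
have energyA : (energy A <= (shell_energy k)%:E)%E.
  rewrite /A measureD ?energy_fin// setIidr; last first.
    by apply: le_ball; rewrite shell_radius3; move: S0; rewrite -/S; lra.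
  by rewrite /= !ball_energyE -EFinB.
pose P j := [set x | in_shell k x /\ m j <= ball_energy x (sj j)].
have /choice[z Hz] j : exists z : seq X,
    [/\ forall w, w \in z -> P j w, (size z)%:R * m j <= shell_energy k &
    P j `<=` \bigcup_(w in [set` z]) ball w (2 * sj j)].
  apply: (finite_packing bmu (sj0 j) (m0 j) mA energyA) => x [/andP[kx xk] mx].
  split; last by rewrite ball_energyE lee_fin.
  have sS : sj j <= S.
    by rewrite /sj ler_pdivrMr ?exprn_gt0// ler_peMr ?(ltW S0)// exprn_ege1// ler1n.
  have kS : 2 ^+ k = 2 * S by rewrite /S /shell_radius; field.
  rewrite exprS kS in xk; rewrite kS in kx.
  move=> y; rewrite ballEmdist/= => xy; split.
    rewrite ballEmdist/= shell_radius3 -/S.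
    by have := metric_triangle O x y; move: S0; lra.
  rewrite ballEmdist/= => Oy.
  have := metric_triangle O y x; rewrite (metric_sym y x).
  by lra.
pose G := 2 `^ s * CQ * S `^ alpha / (lam * (e * (1 - q))) `^ p.
have G0 : 0 <= G.
  by rewrite /G !mulr_ge0 ?invr_ge0 ?powR_ge0// ltW.
have rad j : (2 * sj j) `^ s = m j * (G * b ^+ j).
  have e1 : sj j `^ s = sj j `^ Q * sj j `^ (- p) * sj j `^ alpha.
    rewrite -!powRD; first by congr powR; rewrite /s; ring.
      by apply/implyP => _; rewrite gt_eqF.
    by apply/implyP => _; rewrite gt_eqF.
  have e2 : sj j `^ alpha = S `^ alpha * (b ^+ j * b ^+ j).
    rewrite /sj -exprVn powRM ?(ltW S0) ?exprn_ge0// powR_exprn// bb exprMn//.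
  have e3 : (lam * eta j / sj j) `^ p =
      (lam * (e * (1 - q))) `^ p * b ^+ j * sj j `^ (- p).
    have -> : lam * eta j / sj j = lam * (e * (1 - q)) * q ^+ j * (sj j)^-1.
      by rewrite /eta; ring.
    have c0 : 0 <= lam * (e * (1 - q)) :> R.
      by rewrite !mulr_ge0// ltW.
    have qj0 : 0 <= q ^+ j by rewrite exprn_ge0// ltW.
    have si0 : 0 <= (sj j)^-1 by rewrite invr_ge0 ltW.
    rewrite (powRM _ (mulr_ge0 c0 qj0) si0) (powRM _ c0 qj0) powR_exprn ?(ltW q0)//.
    by rewrite qp -powR_inv1 ?(ltW (sj0 j))// -powRrM mulN1r.
  rewrite powRM ?(ltW (sj0 j))// e1 e2 /m e3 /G.
  have : (lam * (e * (1 - q))) `^ p != 0.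
    by rewrite gt_eqF// powR_gt0// !mulr_gt0.
  move: CQ0 => /lt0r_neq0.
  move: (_ `^ p) (sj j `^ Q) (sj j `^ (- p)) (S `^ alpha) (2 `^ s) (b ^+ j) CQ.
  by move=> W x1 x2 x3 x4 x5 x6 ? ?; field; apply/andP; split.
have bad_term x : bad_shell k e x -> exists j, P j x.
  move=> [kx [n Hn]]; apply: contrapT => nP; move: Hn; apply/negP; rewrite -leNgt.
  apply: (@le_trans _ _ (\sum_(j < n) eta j)); last first.
    rewrite -mulr_sumr -mulrA ler_piMr ?(ltW e0)//.
    rewrite -ler_pdivlMl// mulr1; apply: sum_geometric_le.
    by rewrite (ltW q0) q1.
  apply: ler_sum => j _; rewrite leNgt; apply/negP => jx; apply: nP.
  exists j; split => //; move: jx.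
  rewrite /shell_riesz -/S /rterm /riesz_term lamsj => jx.
  have fr : 0 <= CQ * sj j `^ (- Q) * ball_energy x (sj j).
    by rewrite !mulr_ge0 ?powR_ge0 ?ball_energy_ge0 ?(ltW CQ0).
  have {}jx : lam * eta j / sj j < (CQ * sj j `^ (- Q) * ball_energy x (sj j)) `^ p^-1.
    rewrite ltr_pdivrMr// mulrC -ltr_pdivlMr//; apply: lt_le_trans jx _.
    by rewrite /sj le_eqVlt; apply/orP; left; apply/eqP; field;
       rewrite gt_eqF ?exprn_gt0// gt_eqF.
  have {jx} : (lam * eta j / sj j) `^ p <= CQ * sj j `^ (- Q) * ball_energy x (sj j).
    rewrite -[leRHS]powRr1// -(mulVf (lt0r_neq0 p0)) powRrM.
    by apply: ge0_ler_powR; rewrite ?nnegrE ?powR_ge0 ?(ltW p0) ?(ltW (le0 j)) ?(ltW jx).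
  rewrite powRN /m ler_pdivrMr// => h.
  rewrite -ler_pdivlMl ?powR_gt0//; apply: le_trans h _.
  by rewrite le_eqVlt; apply/orP; left; apply/eqP; ring.
apply: (@le_trans _ _ (\sum_(j <oo) (shell_energy k * (G * b ^+ j))%:E)%E).
  apply: (@hausdorff_content_bigcup _ _ _ z (fun j => 2 * sj j)).
  - by move=> j; rewrite mulr_gt0.
  - move=> x /bad_term[j Pj]; have [_ _ Pz] := Hz j.
    by have [w wz wx] := Pz x Pj; exists j, w.
  - move=> j; have [_ sz _] := Hz j.
    by rewrite -/s rad mulrA ler_wpM2r// mulr_ge0// exprn_ge0// ltW.
have F0 := shell_energy_ge0 k.
apply: (@le_trans _ _ (shell_energy k * G / (1 - b))%:E).
  apply: nneseries_le_bound => [j|n].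
    by apply: mulr_ge0 => //; apply: mulr_ge0 => //; rewrite exprn_ge0// ltW.
  rewrite -!mulr_sumr -mulrA ler_wpM2l// ler_wpM2l//; apply: sum_geometric_le.
  by rewrite (ltW b0) b1.
rewrite lee_fin /G /K mulrA [lam * (e * _)]mulrCA mulrC.
rewrite (powRM _ (ltW e0)); last by rewrite mulr_ge0 ?ltW.
have Sk : S `^ alpha <= (2 ^+ k) `^ alpha.
  apply: ge0_ler_powR; rewrite ?nnegrE ?(ltW al0) ?(ltW S0) ?exprn_ge0//.
  by rewrite /S /shell_radius ler_pdivrMr// ler_peMr ?exprn_ge0// ler1n.
set W := (lam * (1 - q)) `^ p; set Ep := e `^ p.
have W0 : 0 <= W by exact: powR_ge0.
have Ep0 : 0 <= Ep by exact: powR_ge0.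
pose L := 2 `^ s * CQ / W / (1 - b) * (shell_energy k / Ep).
have L0 : 0 <= L.
  by rewrite /L !mulr_ge0 ?invr_ge0 ?powR_ge0 ?(ltW CQ0) ?(ltW b1').
apply: (@le_trans _ _ (L * S `^ alpha)).
  by rewrite le_eqVlt; apply/orP; left; apply/eqP; rewrite /L invfM; ring.
apply: le_trans (ler_wpM2l L0 Sk) _.
by rewrite le_eqVlt; apply/orP; left; apply/eqP; rewrite /L; ring.
Qed.

Lemma in_shell_uniq k l x : in_shell k x -> in_shell l x -> k = l.
Proof.
move=> /andP[kx xk] /andP[lx xl]; apply/eqP; rewrite eqn_leq.
have lt1 : 1 < 2 :> R by rewrite ltr1n.
have := le_lt_trans kx xl; have := le_lt_trans lx xk.
by rewrite !ltr_eXn2l// !ltnS => -> ->.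
Qed.

Lemma in_shell_ex x : 1 <= mdist O x -> exists k, in_shell k x.
Proof.
move=> x1.
have [n xn] : exists n, mdist O x < 2 ^+ n.
  exists (Num.truncn (mdist O x)).+1; apply: lt_le_trans (truncnS_gt _) _.
  by rewrite -natrX ler_nat ltnW// ltn_expl.
have := ex_minnP (P := fun n => mdist O x < 2 ^+ n) (ex_intro _ n xn).
move=> [[|k] xk kmin]; first by move: xk; rewrite expr0 ltNge x1.
exists k; rewrite /in_shell xk andbT leNgt; apply/negP => /kmin.
by rewrite ltnn.
Qed.

(** The thresholds are [p]-th roots because the content bound divides by their [p]-th power. *)
Lemma thin_bad_shells (e : nat -> R) (B : R) :
  (forall k, 0 < e k) -> (forall n, \sum_(k < n) shell_energy k / e k <= B) ->
  thin O Q p [set x | exists k, bad_shell k (e k `^ p^-1) x].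
Proof.
move=> e0 eB; exists 1 => // alpha al.
have [K K0 HK] := bad_shell_content al.
pose w j := K * (shell_energy j.+1 / e j.+1).
have w0 j : 0 <= w j.
  by rewrite mulr_ge0// divr_ge0 ?shell_energy_ge0// ltW.
have sumw : (\sum_(0 <= j <oo) (w j)%:E < +oo)%E.
  apply: (@le_lt_trans _ _ (K * B)%:E); last exact: ltry.
  apply: nneseries_le_bound => // n; rewrite /w -mulr_sumr ler_wpM2l//.
  apply: le_trans (eB n.+1); rewrite big_ord_recl/= lerDr.
  by rewrite divr_ge0 ?shell_energy_ge0// ltW.
apply: (@squeeze_cvge _ _ _ _ (fun=> 0%E) _ (fun k => \sum_(k <= j <oo) (w j)%:E)%E).
- apply: nearW => k; apply/andP; split.
    apply: nneseries_ge0 => j _ _; apply: mule_ge0.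
      exact: hausdorff_content_ge0.
    by rewrite lee_fin invr_ge0 powR_ge0.
  apply: lee_nneseries => [j _ _|j _].
    apply: mule_ge0; first exact: hausdorff_content_ge0.
    by rewrite lee_fin invr_ge0 powR_ge0.
  rewrite mul1r; have t0 : 0 < (2 ^+ j.+1) `^ alpha :> R.
    by rewrite powR_gt0// exprn_gt0.
  apply: (@le_trans _ _ (((2 ^+ j.+1) `^ alpha * w j)%:E *
    (((2 ^+ j.+1) `^ alpha)^-1)%:E)%E); last first.
    by rewrite -EFinM mulrAC mulfV ?gt_eqF// mul1r.
  apply: lee_wpmul2r; first by rewrite lee_fin invr_ge0 powR_ge0.
  apply: (@le_trans _ _ (hausdorff_content (Q - (p - alpha))
      (bad_shell j.+1 (e j.+1 `^ p^-1)))).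
    (* With [C = 1] the annulus of index [j] is the shell [j.+1]; shells are disjoint, so only one
       bad set meets it. *)
    apply: le_hausdorff_content => x [[m bx] [x1 x2]].
    suff jx : in_shell j.+1 x by rewrite -(in_shell_uniq (proj1 bx) jx).
    rewrite /in_shell; move: x1 x2; rewrite !ballEmdist/= -exprS => -> /negP.
    by rewrite -leNgt => ->.
  apply: le_trans (HK _ _ _) _; first by rewrite powR_gt0.
  rewrite -powRrM mulVf ?gt_eqF// powRr1 ?(ltW (e0 _))// lee_fin.
  by rewrite /w mulrAC mulrC.
- exact: cvg_cst.
- by apply: nneseries_tail_cvg => // j _; rewrite lee_fin.
Qed.

(** Raising the shell index prepends one larger scale to the sum and leaves the other scales
    unchanged. *)
Lemma shell_riesz_shift k j x : shell_riesz k.+1 j.+1 x = shell_riesz k j x.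
Proof.
rewrite /shell_riesz.
suff -> : shell_radius k.+1 / lam / 2 ^+ j.+1 = shell_radius k / lam / 2 ^+ j by [].
by rewrite /shell_radius !exprS; field; rewrite expf_neq0//= gt_eqF.
Qed.

Let gam : R := 2 `^ (1 - Q / p).

(** With the energy bounded by the total one, the leading term is a multiple of [S^(1 - Q/p)] for
    [S = shell_radius k]. *)
Lemma shell_riesz0_le : exists2 L : R, 0 <= L & forall k x, shell_riesz k 0 x <= L * gam ^+ k.
Proof.
exists ((CQ * total_energy) `^ p^-1 / lam * 2^-1 `^ (1 - Q / p)).
  by rewrite !mulr_ge0 ?powR_ge0// invr_ge0 ltW.
move=> k x; rewrite /shell_riesz /rterm /riesz_term expr0 divr1.
have S0 := shell_radius_gt0 k.
have -> : lam * (shell_radius k / lam) = shell_radius k.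
  by rewrite mulrC divfK// gt_eqF.
set S := shell_radius k in S0 *; set phi := ball_energy x S.
have phi0 : 0 <= phi by exact: ball_energy_ge0.
have -> : CQ * S `^ (- Q) * phi = S `^ (- Q) * (CQ * phi) by ring.
rewrite powRM ?powR_ge0 ?mulr_ge0 ?(ltW CQ0)// -powRrM mulNr.
have -> : S / lam * (S `^ (- (Q / p)) * (CQ * phi) `^ p^-1) =
  (CQ * phi) `^ p^-1 / lam * (S `^ 1 * S `^ (- (Q / p))).
  by rewrite powRr1 ?(ltW S0)//; ring.
rewrite -powRD; last by apply/implyP => _; rewrite gt_eqF.
have -> : S `^ (1 - Q / p) = 2^-1 `^ (1 - Q / p) * gam ^+ k.
  by rewrite /S /shell_radius mulrC powRM ?exprn_ge0// powR_exprn.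
have le1 : (CQ * phi) `^ p^-1 <= (CQ * total_energy) `^ p^-1.
  apply: ge0_ler_powR; rewrite ?nnegrE ?invr_ge0 ?(ltW p0) ?mulr_ge0 ?(ltW CQ0)//.
    by apply: le_trans phi0 _; exact: ball_energy_le.
  by rewrite ler_wpM2l ?(ltW CQ0)// ball_energy_le.
have t0 : 0 <= 2^-1 `^ (1 - Q / p) :> R by exact: powR_ge0.
have g0 : 0 <= gam ^+ k by apply: exprn_ge0; exact: powR_ge0.
move: le1 t0 g0; move: ((CQ * phi) `^ p^-1) ((CQ * total_energy) `^ p^-1).
move: (2^-1 `^ (1 - Q / p)) (gam ^+ k) => t g a b ab t0 g0.
by rewrite mulrA !ler_wpM2r ?invr_ge0 ?(ltW lam0).
Qed.

Let gam01 : 0 <= gam < 1.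
Proof.
rewrite powR_ge0/= -[ltRHS](powRr0 2); apply: gt1_ltr_powR; first by rewrite ltr1n.
by rewrite subr_lt0 ltr_pdivlMr// mul1r.
Qed.

(** Points of different shells are compared on balls of one common radius, so the sums must start at
    scales beyond [2^k]. Each additional scale adds one leading term, and these form a geometric
    series. *)
Lemma riesz_large_scales : exists2 L : R, 0 <= L &
  forall k x (eps : R), (forall n, \sum_(j < n) shell_riesz k j x <= eps) ->
  forall i n, \sum_(j < n) shell_riesz (k + i) j x <= eps + L * gam ^+ k.
Proof.
have [L L0 HL] := shell_riesz0_le; have /andP[g0 g1] := gam01.
exists (L / (1 - gam)); first by rewrite divr_ge0// subr_ge0 ltW.
move=> k x eps Heps i n.
have eps0 : 0 <= eps by have := Heps 0%N; rewrite big_ord0.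
have gk0 m : 0 <= gam ^+ m by exact: exprn_ge0.
have s0 m : 0 <= \sum_(j < m) gam ^+ j by exact: sumr_ge0.
suff H : \sum_(j < n) shell_riesz (k + i) j x <=
    eps + L * gam ^+ k * \sum_(m < i) gam ^+ m.
  apply: le_trans H _; rewrite lerD2l [leRHS]mulrAC.
  apply: ler_wpM2l; first exact: mulr_ge0.
  by apply: sum_geometric_le; rewrite g0.
elim: i n => [|i IH] n; first by rewrite big_ord0 mulr0 addr0 addn0.
case: n => [|n]; first by rewrite big_ord0 addr_ge0// !mulr_ge0.
rewrite big_ord_recl/= addnS.
under eq_bigr do rewrite /= shell_riesz_shift.
rewrite [X in _ <= _ + _ * X]big_ord_recr/= mulrDr addrA [leLHS]addrC.
apply: lerD; first exact: IH.
apply: le_trans (HL _ _) _; rewrite -mulrA ler_wpM2l// -exprD exprS.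
by apply: ler_piMl => //; exact: ltW.
Qed.

Lemma cauchy_estimate : exists2 K : R, 0 <= K & forall x y k l (s t : R),
  in_shell k x -> in_shell l y ->
  (forall i n, \sum_(j < n) shell_riesz (k + i) j x <= s) ->
  (forall i n, \sum_(j < n) shell_riesz (l + i) j y <= t) ->
  `|u x - u y| <= K * (s + t).
Proof.
pose A := CQ * (CQ ^+ 2 / 2^-1 `^ Q * C).
have A0 : 0 <= A by rewrite !mulr_ge0 ?invr_ge0 ?powR_ge0 ?exprn_ge0 ?(ltW CQ0) ?(ltW C0).
exists (A * CQ / 2^-1 `^ Q).
  by rewrite mulr_ge0 ?invr_ge0 ?powR_ge0// mulr_ge0// ltW.
move=> x y k l s t /andP[kx xk] /andP[ly yl] Hx Hy.
pose a := (Num.truncn (16 * lam)).+1.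
have lama : 16 * lam <= 2 ^+ a.
  apply: ltW; apply: lt_le_trans (truncnS_gt _) _.
  by rewrite -natrX ler_nat ltnW// ltn_expl.
(* An index large enough for both points: [2^k] and [2^l] are at least 1, so their product controls
   the distance, and [2^a] absorbs [lam] and the numerical constants. The ball of radius [r / 2]
   about [x] then lies in both balls of radius [r]. *)
pose N := (k + (l + a))%N.
pose r := shell_radius N / lam.
have r0 : 0 < r by rewrite divr_gt0// shell_radius_gt0.
have h0 : 0 < 2^-1 * r by rewrite mulr_gt0// invr_gt0.
have dxy : mdist x y <= 2^-1 * r.
  have tri : mdist x y <= mdist O x + mdist O y.
    by rewrite (metric_sym O x); exact: metric_triangle.
  have hk : 1 <= 2 ^+ k :> R by rewrite exprn_ege1// ler1n.
  have hl : 1 <= 2 ^+ l :> R by rewrite exprn_ege1// ler1n.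
  rewrite !exprS in xk yl.
  apply: (@le_trans _ _ (4 * (2 ^+ k * 2 ^+ l))).
    by move: xk yl tri hk hl; move: (2 ^+ k) (2 ^+ l) => *; nra.
  have -> : 2^-1 * r = 2 ^+ k * 2 ^+ l * (2 ^+ a / (4 * lam)).
    by rewrite /r /shell_radius /N !exprD; field; rewrite gt_eqF.
  rewrite mulrC ler_wpM2l ?mulr_ge0 ?exprn_ge0// ler_pdivlMr ?mulr_gt0//.
  by move: lama; lra.
have oscx := oscillation_riesz r0 (Hx (l + a)%N).
have oscy : (\int[measure_of mu]_(z in ball y r) `|u y - u z|%:E <=
   (CQ * r `^ Q * (CQ ^+ 2 / 2^-1 `^ Q * C * t))%:E)%E.
  by apply: oscillation_riesz => // n; have := Hy (k + a)%N n; rewrite addnCA.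
have mdiff (v : X) : measurable_fun setT
    ((fun z => `|u v - u z|%:E) : caratheodory_type mu -> \bar R).
  apply/measurable_EFinP; apply: measurableT_comp => //.
  exact: measurable_funB.
have mdiffD (v : X) (D : set (caratheodory_type mu)) : measurable D -> measurable_fun D
    ((fun z => `|u v - u z|%:E) : caratheodory_type mu -> \bar R).
  by move=> mD; apply: measurable_funS (mdiff v).
pose D : set (caratheodory_type mu) := ball x (2^-1 * r).
have mD : measurable D by exact: mb.
have Dx : D `<=` ball x r.
  by apply: le_ball; move: h0; lra.
have Dy : D `<=` ball y r.
  move=> z; rewrite /D !ballEmdist/= => xz.
  by have := metric_triangle y x z; rewrite (metric_sym y x); move: xz dxy; lra.
have key : (`|u x - u y|%:E * mu D <=
    (CQ * r `^ Q * (CQ ^+ 2 / 2^-1 `^ Q * C * s))%:E +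
    (CQ * r `^ Q * (CQ ^+ 2 / 2^-1 `^ Q * C * t))%:E)%E.
  apply: (@le_trans _ _ (\int[measure_of mu]_(z in D) (`|u x - u y|%:E))%E).
    by rewrite integral_cst.
  apply: (@le_trans _ _ (\int[measure_of mu]_(z in D) (`|u x - u z|%:E + `|u y - u z|%:E))%E).
    apply: ge0_le_integral => //.
    - by apply: emeasurable_funD; exact: mdiffD.
    - by move=> z _; rewrite -EFinD lee_fin (distrC (u y)); exact: ler_distD.
  rewrite ge0_integralD//; [|exact: mdiffD|exact: mdiffD].
  apply: leeD.
    by apply: le_trans oscx; apply: ge0_subset_integral => //; exact: mdiffD.
  by apply: le_trans oscy; apply: ge0_subset_integral => //; exact: mdiffD.
have [muD _] := ahlfors x h0.
have rQ0 : 0 < r `^ Q by rewrite powR_gt0.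
have : `|u x - u y| * ((2^-1 * r) `^ Q / CQ) <= A * r `^ Q * (s + t).
  rewrite -lee_fin EFinM; apply: (@le_trans _ _ (`|u x - u y|%:E * mu D)%E).
    by apply: lee_wpmul2l => //; rewrite lee_fin.
  apply: le_trans key _; rewrite -EFinD lee_fin le_eqVlt; apply/orP; left.
  by apply/eqP; rewrite /A; ring.
rewrite powRM ?(ltW r0) ?invr_ge0// => h.
have q0 : 0 < 2^-1 `^ Q :> R by rewrite powR_gt0// invr_gt0.
rewrite -(ler_pM2r (mulr_gt0 q0 rQ0)).
rewrite mulrA ler_pdivrMr// in h; apply: le_trans h _.
rewrite le_eqVlt; apply/orP; left; apply/eqP; field.
by rewrite gt_eqF.
Qed.

Lemma thin_filter (E : set X) : thin O Q p E -> ProperFilter (within (~` E) (at_infty O)).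
Proof.
move=> thinE.
have fO : Filter (at_infty O).
  apply: filter_from_filter; first by exists 0.
  move=> i j _ _; exists (Num.max i j) => // x /=.
  by rewrite gt_max => /andP[].
split; last exact: within_filter.
move=> [M _ HM].
have [x [Mx Ex _]] := thin_cofinal p1 pQ CQ1 ahlfors M thinE thinE.
exact: (HM x Mx Ex).
Qed.

Lemma limit_outside_thin : exists c, exists2 E : set X,
  thin O Q p E & u @ within (~` E) (at_infty O) --> (c : R).
Proof.
have [e [B [e0 ecvg eB]]] := summable_weights shell_energy_ge0 shell_energy_sum.
pose E := [set x | exists k, bad_shell k (e k `^ p^-1) x].
have thinE : thin O Q p E by exact: thin_bad_shells eB.
have FE := thin_filter thinE.
have [L L0 HL] := riesz_large_scales.
have [K K0 HK] := cauchy_estimate.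
pose d k := e k `^ p^-1 + L * gam ^+ k.
have good x k : ~ E x -> in_shell k x ->
    forall i n, \sum_(j < n) shell_riesz (k + i) j x <= d k.
  move=> nE kx; apply: HL => n; rewrite leNgt; apply/negP => lt; apply: nE.
  by exists k; split => //; exists n.
have dcvg : d @ \oo --> (0 : R).
  rewrite -[X in _ --> X]addr0; apply: cvgD.
    have p00 : (0 : R) = 0 `^ p^-1 by rewrite powR0// invr_neq0// gt_eqF.
    apply/cvgrPdist_lt => eps eps0.
    move/cvgrPdist_lt : ecvg => /(_ (eps `^ p)) H.
    near=> k.
    have : `|0 - e k| < eps `^ p by near: k; apply: H; rewrite powR_gt0.
    rewrite !sub0r !normrN gtr0_norm// ger0_norm ?powR_ge0// => ek.
    rewrite -[ltRHS]powRr1 ?(ltW eps0)// -(mulfV (lt0r_neq0 p0)) powRrM.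
    by apply: gt0_ltr_powR; rewrite ?invr_gt0 ?nnegrE ?powR_ge0// ltW.
  rewrite -[X in _ --> X](mulr0 L); apply: cvgMr.
  apply: cvg_expr; have /andP[g0 g1] := gam01.
  by rewrite ger0_norm.
have cau : cauchy (u @ within (~` E) (at_infty O)).
  apply: cauchy_exP => eps eps0.
  have K1 : 0 < 2 * (K + 1) by rewrite mulr_gt0// ltr_wpDl.
  move/cvgrPdist_lt : dcvg => /(_ (eps / (2 * (K + 1)))).
  rewrite divr_gt0// => /(_ isT)[n _ Hn].
  have dn k : (n <= k)%N -> d k < eps / (2 * (K + 1)).
    by move=> /Hn/=; rewrite sub0r normrN; exact: le_lt_trans (ler_norm _).
  have shell y : 2 ^+ n < mdist O y -> exists2 k, (n <= k)%N & in_shell k y.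
    move=> ny; have [|k ky] := @in_shell_ex y.
      by apply: le_trans (ltW ny); rewrite exprn_ege1// ler1n.
    exists k => //; have /andP[_ yk] := ky.
    by have := lt_trans ny yk; rewrite ltr_eXn2l ?ltr1n.
  have [x [nx Ex _]] := thin_cofinal p1 pQ CQ1 ahlfors (2 ^+ n) thinE thinE.
  exists (u x); exists (2 ^+ n) => // y /= ny Ey.
  have [k nk kx] := shell x nx; have [l nl ly] := shell y ny.
  apply: le_lt_trans (HK x y k l _ _ kx ly (good _ _ Ex kx) (good _ _ Ey ly)) _.
  have := dn k nk; have := dn l nl; rewrite !ltr_pdivlMr//.
  move: (d k) (d l) => dk dl h1 h2.
  have : K * (dk + dl) <= (K + 1) * Num.max (dk + dl) 0.
    rewrite maxEle; case: ifPn => h; nra.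
  rewrite maxEle; case: ifPn => _; nra.
exists (lim (u @ within (~` E) (at_infty O))); exists E => //.
exact: cauchy_cvg.
Unshelve. all: by end_near.
Qed.

End LimitAtInfinity.

(** * Existence and uniqueness of the limit *)

Theorem theorem1p1 (R : realType) (Q p : R) (X : completeMetricType R)
    (mu : {outer_measure set X -> \bar R}) (O : X) :
  1 < Q -> 1 <= p < Q ->
  metric_measure_space mu ->
  unbounded_space X ->
  ahlfors_regular mu Q ->
  poincare mu p ->
  forall u : X -> R, dotN1 mu p u ->
    exists! c : R, exists2 E : set X,
      thin O Q p E & u @ within (~` E) (at_infty O) --> c.
Proof.
move=> _ /andP[p1 pQ] [_ [bmu _] _ _] _ [CQ CQ1 ahlfors] [_ [C [lam [C0 lam1 poin]]]].
move=> u [[mu_u _] [rho0 ug int0]].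
have [brho0 rho00 _] := ug.
have CQ0 : 0 <= CQ by exact: le_trans CQ1.
have [rho [rr wrho lsc int_rho]] := vitali_caratheodory O bmu p1 CQ0
  (fun x r r0 => proj2 (ahlfors x r r0)) brho0 rho00 int0.
have [c Hc] := limit_outside_thin bmu p1 pQ CQ1 C0 lam1 ahlfors poin mu_u ug rr
  wrho lsc int_rho.
exists c; split => // c' [E' thinE' cvE'].
have [E thinE cvE] := Hc.
apply/eqP; rewrite eq_sym; apply/negPn/negP => cc'.
pose d := `|c' - c| / 2.
have d0 : 0 < d by rewrite divr_gt0// normr_gt0 subr_eq0.
have [T _ HT] : (u @ within (~` E) (at_infty O)) (ball c d) by exact/cvE/nbhsx_ballx.
have [T' _ HT'] : (u @ within (~` E') (at_infty O)) (ball c' d).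
  by exact/cvE'/nbhsx_ballx.
have [x [TT'x Ex E'x]] :=
  thin_cofinal p1 pQ CQ1 ahlfors (Num.max T T') thinE thinE'.
move: TT'x; rewrite gt_max => /andP[Tx T'x].
have := HT x Tx Ex; have := HT' x T'x E'x; rewrite /= /ball/= => h1 h2.
have := ler_distD (u x) c' c; rewrite (distrC (u x)).
by move: h1 h2; rewrite /d; lra.
Qed.
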